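(* Let $a$ be the multiplicative function with $a(p^f)=\sigma_1(p^f)$ for odd primes $p$ and $a(2^f)=2^f$, and let $b$ be the multiplicative function with $b(p^f)=\sigma_1(p^f)$ for odd primes $p$ and $b(2^f)=0$ for $f\ge1$ (so $b(m)=\sigma_1(m)$ for odd $m$ and $b(m)=0$ for even $m$). For positive integers $j$ and complex $s$ define $$c_j(s)=\sum_{d\mid j}a(d)\,b\!\left(\frac{j}{d}\right)\left(\frac{j}{d^2}\right)^{s/2}.$$ Then for complex $s$ (the left-hand side being understood via its analytic continuation), $$\frac{s(s+1)}{32\pi^2\sqrt{2}}\left(2^{\frac{s}{2}}-2^{-\frac{s}{2}}\right)\left(2^{\frac{s-1}{2}}-2^{-\frac{s-1}{2}}\right)\zeta^{*}(s)\,\zeta^{*}(s+1)=\sum_{j=1}^{\infty}c_j(s)\,K_s(2\pi\sqrt{j}),$$ where $\zeta^*(s)=\pi^{-s/2}\Gamma(s/2)\zeta(s)$.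
   Context: $\sigma_1$ is the sum-of-divisors function, $\zeta$ the Riemann zeta function, and $K_\nu$ the modified Bessel function of the second kind, $2K_\nu(x)=\int_0^\infty u^{\nu-1}e^{-\frac{x}{2}(u+1/u)}\,du$ for $x>0$. With $q=e^{-\pi y}$, $\theta_4=\sum_n(-1)^nq^{n^2}$ and $\theta_2=\sum_n q^{(n-1/2)^2}$, one has $\dot\theta_4/\theta_4=2\pi\sum a(n)q^n$ and $\theta_2^4=16\sum b(m)q^m$. *)

(* Defs.v *)
From HB Require Import structures.
From mathcomp Require Import all_boot all_order all_algebra.
From mathcomp Require Import all_classical all_reals all_analysis.
From mathcomp Require Import complex.

Set Implicit Arguments.
Unset Strict Implicit.
Unset Printing Implicit Defensive.
Import Order.TTheory GRing.Theory Num.Theory.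
Import numFieldNormedType.Exports.

Local Open Scope classical_set_scope.
Local Open Scope complex_scope.
Local Open Scope ring_scope.

Definition sigma1 (n : nat) : nat := (\sum_(d <- divisors n) d)%N.

(* The value at 0 is left free. *)
Definition arith_multiplicative (f : nat -> nat) : Prop :=
  f 1%N = 1%N /\
  forall m n : nat, (0 < m)%N -> (0 < n)%N -> coprime m n ->
    f (m * n)%N = (f m * f n)%N.

Section ComplexFunctions.
Variable R : realType.
Implicit Types (x : R) (s : R[i]).

(* x ^ s = exp (s * ln x), with the real logarithm; meaningful for x > 0. *)
Definition cpow x s : R[i] :=
  (expR (complex.Re s * ln x))%:C *
  (cos (complex.Im s * ln x) +i* sin (complex.Im s * ln x)).

Definition cintegral (D : set R) (f : R -> R[i]) : R[i] :=
  (\int[lebesgue_measure]_(u in D) complex.Re (f u)) +i*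
  (\int[lebesgue_measure]_(u in D) complex.Im (f u)).

(* Euler's integral, absolutely convergent for Re s > 0. *)
Definition Gamma s : R[i] :=
  cintegral `]0, +oo[ (fun u : R => cpow u (s - 1) * (expR (- u))%:C).

(* The Dirichlet series, convergent for Re s > 1.  Here and below R[i] is
   regarded as R[i]^o, which carries the topology given by the norm. *)
Definition zeta s : R[i] :=
  limn (series (fun n : nat => cpow n.+1%:R (- s) : R[i]^o)).

(* Equals pi^(-s/2) Gamma(s/2) zeta(s) for Re s > 1 only: no continuation is
   built into Gamma or zeta. *)
Definition zeta_star s : R[i] :=
  cpow pi (- (s / 2)) * Gamma (s / 2) * zeta s.

Definition besselK (nu : R[i]) x : R[i] :=
  2^-1 * cintegral `]0, +oo[
    (fun u : R => cpow u (nu - 1) * (expR (- (x / 2 * (u + u^-1))))%:C).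

Definition cj (a b : nat -> nat) (j : nat) s : R[i] :=
  \sum_(d <- divisors j)
    (a d)%:R * (b (j %/ d)%N)%:R * cpow (j%:R / (d ^ 2)%:R) (s / 2).

(* F is entire and extends the restriction of f to U; when U has nonempty
   interior, such an F is unique by the identity theorem. *)
Definition entire_continuation (U : set R[i]) (f F : R[i] -> R[i]) : Prop :=
  (forall s, derivable (F : R[i]^o -> R[i]^o) s 1) /\
  (forall s, U s -> F s = f s).

End ComplexFunctions.

(* Main.v *)
(** Put q = e^(-pi y), y = e^v, and
      A(y) = sum of a q^(a x) over a, x >= 1 with x odd,
      B(y) = sum of k q^(k r) over odd k, r,
      T(y) = sum of (-1)^(b+x) b q^(b x),   W(y) = sum of (-1)^(b+x) b^2 x q^(b x).
    The coefficients a(n), b(n) are those of A and B, so collecting terms with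
    d m = j in A(y) B(1/y) and integrating termwise against e^(s v) dv turns the
    Bessel series into one half of the Mellin transform of A(y) B(1/y), which
    decays faster than any power of y at 0 and oo and hence is entire in s.

    Two identities separate the variables.  First, A (1 - 8 T) = W: sum a function
    H(a,b,x,y) q^(a x + b y) over all quadruples, once split by a < b, a = b, a > b
    and once by x < y, x = y, x > y; the substitution (a, a + b, x, y) <->
    (a, b, x + y, y) matches the two splittings up to boundary terms (Liouville's
    method).  Secondly, 16 B(1/y) = y^2 (1 - 8 T(y)): expand both sides in partial
    fractions of sech^2 and csch^2 and interchange the double sum; the expansions
    come from iterating the duplication formula of Re (1 / sin^2).
    Hence A(y) B(1/y) = y^2 W(y) / 16, whose Mellin transform for Re s > 1 is
    Gamma(s+2) pi^(-s-2) times a product of two alternating zeta series; the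
    duplication formula for Gamma rewrites this in terms of zeta^*. *)
Require Import Defs.
From HB Require Import structures.
From mathcomp Require Import all_boot all_order all_algebra.
From mathcomp Require Import all_classical all_reals all_analysis.
From mathcomp Require Import measurable_realfun complex.
From mathcomp Require Import zify ring lra.
Import Order.TTheory GRing.Theory Num.Theory.
Import numFieldNormedType.Exports.
Local Open Scope classical_set_scope.
Local Open Scope complex_scope.
Local Open Scope ring_scope.
Set Implicit Arguments.
Unset Strict Implicit.
Unset Printing Implicit Defensive.

(** * Unconditional sums *)

(** Two interchanges of summation shape the proof. Liouville's method reorders signed sums over
    quadruples, so sums are unconditional: differences of convergent nonnegative sums, which can be
    regrouped freely. In the transformation formula the double sum of Re 1/(k + i n y)^2 over odd k,
    with signs alternating in n, is not absolutely convergent, its terms having size 1/(k^2 + n^2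
    y^2). Pairing n = 2l + 1 with n = 2l + 2 gains a factor y/k, and the paired sum converges
    absolutely. The factorisation into two zeta series is available only for Re s > 1, where the
    double series for the Mellin transform of y^2 W converges absolutely. The continuation is
    therefore not built from zeta: it is the transform of A(y) B(1/y) / 2 itself. There e^(-u) <=
    K!/u^K bounds A(y) by a multiple of y^(-3-k) and B(1/y) by a multiple of y^(3+l), for all k and
    l. All terms of this product are nonnegative, so their total dominates the partial sums, at
    every s. *)

Section has_sum.
Context {R : realType}.

(** The sum is formed in the extended reals, so a real value on the right makes convergence part of
    the statement. *)
Definition nnsum (T : choiceType) (f : T -> R) (s : R) : Prop :=
  (forall i, 0 <= f i) /\ (\esum_(i in [set: T]) (f i)%:E = s%:E)%E.

(** Absolute convergence together with its value. The decomposition is left existential because any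
    one gives the same value ([has_sum_unique]), so positive and negative parts are never
    computed. *)
Definition has_sum (T : choiceType) (f : T -> R) (s : R) : Prop :=
  exists p m : T -> R, exists P M : R,
    [/\ nnsum p P, nnsum m M, forall i, f i = p i - m i & s = P - M].

Lemma nnsum_ge0 (T : choiceType) (f : T -> R) s : nnsum f s -> 0 <= s.
Proof.
move=> [f0 fs]; rewrite -lee_fin -fs; apply: esum_ge0 => i _.
by rewrite lee_fin.
Qed.

Lemma nnsum_unique (T : choiceType) (f : T -> R) s t :
  nnsum f s -> nnsum f t -> s = t.
Proof. by move=> [_ fs] [_]; rewrite fs => -[]. Qed.

Lemma eq_nnsum (T : choiceType) (f g : T -> R) s :
  f =1 g -> nnsum f s -> nnsum g s.
Proof. by move=> /funext ->. Qed.

Lemma nnsum0 (T : choiceType) : nnsum (fun _ : T => 0) 0.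
Proof. by split=> //; rewrite esum1. Qed.

Lemma nnsumD (T : choiceType) (f g : T -> R) s t :
  nnsum f s -> nnsum g t -> nnsum (fun i => f i + g i) (s + t).
Proof.
move=> [f0 fs] [g0 gt]; split=> [i|]; first exact: addr_ge0.
under eq_esum do rewrite EFinD.
by rewrite esumD ?fs ?gt // => i _; rewrite lee_fin.
Qed.

Lemma nnsumZ (T : choiceType) (c : R) (f : T -> R) s :
  0 <= c -> nnsum f s -> nnsum (fun i => c * f i) (c * s).
Proof.
rewrite le_eqVlt => /predU1P[<- _|c0 [f0 fs]].
  rewrite mul0r; apply: (eq_nnsum _ (nnsum0 T)) => i; by rewrite mul0r.
(* One inequality suffices: applied to [c^-1] and [c * f] it gives the converse. *)
have le_esumZ (d : R) (g : T -> R) : 0 < d -> (forall i, 0 <= g i) ->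
    (\esum_(i in [set: T]) (d * g i)%:E <= d%:E * \esum_(i in [set: T]) (g i)%:E)%E.
  move=> d0 g0; apply: ub_ereal_sup => _ [A [finA AT] <-].
  under eq_fsbigr do rewrite EFinM.
  rewrite -ge0_mule_fsumr; last by move=> i; rewrite lee_fin.
  rewrite lee_pmul2l ?lte_fin//; apply: ereal_sup_ubound.
  by exists A.
split=> [i|]; first by rewrite mulr_ge0// ltW.
apply/eqP; rewrite eq_le; apply/andP; split.
  by rewrite (le_trans (le_esumZ _ _ c0 f0))// fs EFinM.
have := le_esumZ c^-1 (fun i => c * f i).
rewrite invr_gt0 => /(_ c0) H.
have /H : forall i, 0 <= c * f i by move=> i; rewrite mulr_ge0// ltW.
under eq_esum do rewrite mulKf ?gt_eqF//.
rewrite fs => H1.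
rewrite -(@lee_pmul2l _ c^-1%:E) ?lte_fin ?invr_gt0//.
by rewrite -EFinM mulKf ?gt_eqF.
Qed.

Lemma nnsum_le (T : choiceType) (f g : T -> R) s :
  (forall i, 0 <= f i <= g i) -> nnsum g s -> exists t, nnsum f t.
Proof.
move=> fg [g0 gs].
have f0 i : 0 <= f i by have /andP[] := fg i.
exists (fine (\esum_(i in [set: T]) (f i)%:E)%E); split=> //.
rewrite fineK// ge0_fin_numE; last by apply: esum_ge0 => i _; rewrite lee_fin.
apply: (@le_lt_trans _ _ s%:E); last exact: ltry.
rewrite -gs; apply: le_esum => i _; rewrite lee_fin.
by have /andP[] := fg i.
Qed.

Lemma nnsum_reindex (T T' : choiceType) (e : T -> T') (f : T' -> R) s :
  bijective e -> nnsum f s -> nnsum (f \o e) s.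
Proof.
move=> be [f0 fs]; split=> [i|]; first exact: f0.
rewrite -fs [RHS](@reindex_esum _ _ _ setT _ e)//.
by rewrite setTT_bijective.
Qed.

Lemma nnsum_pair (T1 T2 : choiceType) (f : T1 * T2 -> R) s :
  nnsum f s ->
  exists2 r, forall i, nnsum (fun j => f (i, j)) (r i) & nnsum r s.
Proof.
move=> [f0 fs].
have E : (\esum_(i in [set: T1]) \esum_(j in [set: T2]) (f (i, j))%:E = s%:E)%E.
  rewrite esum_esum; last by move=> *; rewrite lee_fin.
  rewrite -fs; congr esum.
    by apply/seteqP; split => // -[].
  by apply/funext => -[].
have g0 i : (0 <= \esum_(j in [set: T2]) (f (i, j))%:E)%E.
  by apply: esum_ge0 => j _; rewrite lee_fin.
have fin i : (\esum_(j in [set: T2]) (f (i, j))%:E)%E \is a fin_num.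
  rewrite ge0_fin_numE// (@le_lt_trans _ _ s%:E) ?ltry// -E.
  apply: esum_ge; exists [set i]; last by rewrite fsbig_set1.
  by split=> //; exact: finite_set1.
exists (fun i => fine (\esum_(j in [set: T2]) (f (i, j))%:E)%E).
  by move=> i; split=> //; rewrite fineK.
split=> [i|]; first by rewrite fine_ge0.
by under eq_esum do rewrite fineK//.
Qed.

Lemma pair_nnsum (T1 T2 : choiceType) (f : T1 * T2 -> R) r s :
  (forall i, nnsum (fun j => f (i, j)) (r i)) -> nnsum r s -> nnsum f s.
Proof.
move=> fr [r0 rs]; split=> [[i j]|]; first by have [] := fr i.
rewrite -rs; under [RHS]eq_esum do rewrite -(fr _).2.
rewrite esum_esum; last by move=> i j _ _; rewrite lee_fin; have [] := fr i.
congr esum; first by apply/seteqP; split => // -[].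
by apply/funext => -[].
Qed.

Lemma nnsum_sum (T1 T2 : choiceType) (f : T1 + T2 -> R) s :
  nnsum f s -> exists s1 s2, [/\ nnsum (f \o inl) s1, nnsum (f \o inr) s2 &
    s = s1 + s2].
Proof.
move=> [f0 fs].
have f0' i : (0 <= (f i)%:E)%E by rewrite lee_fin.
have E : (\esum_(i in [set: T1]) (f (inl i))%:E
          + \esum_(i in [set: T2]) (f (inr i))%:E = s%:E)%E.
  rewrite -fs (esumID (range inl)) ?setTI//; congr (_ + _)%E.
    by rewrite esum_image// => x y _ _ [].
  rewrite (_ : ~` range inl = range (@inr T1 T2)).
    by rewrite esum_image// => x y _ _ [].
  apply/seteqP; split=> [[x|x]//= h|_ [x _ <-] [y _]//].
    by exfalso; apply: h; exists x.
  by exists x.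
have fin1 : (\esum_(i in [set: T1]) (f (inl i))%:E)%E \is a fin_num.
  rewrite ge0_fin_numE ?esum_ge0// (@le_lt_trans _ _ s%:E) ?ltry// -E.
  by rewrite leeDl// esum_ge0.
have fin2 : (\esum_(i in [set: T2]) (f (inr i))%:E)%E \is a fin_num.
  rewrite ge0_fin_numE ?esum_ge0// (@le_lt_trans _ _ s%:E) ?ltry// -E.
  by rewrite leeDr// esum_ge0.
do 2 eexists; split; [split=> [i|]; first exact: f0 |split=> [i|]; first exact: f0|].
- by symmetry; apply: fineK fin1.
- by symmetry; apply: fineK fin2.
- by apply: EFin_inj; rewrite EFinD !fineK.
Qed.

Lemma nnsum_series (f : nat -> R) s : nnsum f s -> series f @ \oo --> s.
Proof.
move=> [f0 fs].
have E : (\big[+%E/0%E]_(0 <= i <oo) (f i)%:E = s%:E)%E.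
  by rewrite nneseries_esumT// => i; rewrite lee_fin.
have : (fun n => (series f n)%:E) @ \oo --> s%:E.
  rewrite -E; apply: cvg_trans; last first.
    by apply: (@is_cvg_nneseries _ (fun i => (f i)%:E)) => n _ _; rewrite lee_fin.
  apply: near_eq_cvg; near=> n; by rewrite /series/= sumEFin.
by move/fine_cvg.
Unshelve. all: by end_near. Qed.

Lemma series_nnsum (f : nat -> R) s :
  (forall i, 0 <= f i) -> series f @ \oo --> s -> nnsum f s.
Proof.
move=> f0 fs; split=> //.
rewrite -nneseries_esumT; last by move=> i; rewrite lee_fin.
apply/cvg_lim => //.
rewrite (_ : (fun n => _) = (fun n => (series f n)%:E)).
  by apply: cvg_EFin; first exact: nearW.
by apply/funext => n; rewrite /series/= sumEFin.
Qed.

Lemma nnsum_has_sum (T : choiceType) (f : T -> R) s : nnsum f s -> has_sum f s.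
Proof.
move=> fs; exists f, (fun _ => 0), s, 0; split=> //.
- exact: nnsum0.
- by move=> i; rewrite subr0.
- by rewrite subr0.
Qed.

Lemma eq_has_sum (T : choiceType) (f g : T -> R) s :
  f =1 g -> has_sum f s -> has_sum g s.
Proof. by move=> /funext ->. Qed.

Lemma has_sum0 (T : choiceType) : has_sum (fun _ : T => 0) 0.
Proof. exact/nnsum_has_sum/nnsum0. Qed.

Lemma has_sum_unique (T : choiceType) (f : T -> R) s t :
  has_sum f s -> has_sum f t -> s = t.
Proof.
move=> [p [m [P [M [pP mM fpm ->]]]]] [p' [m' [P' [M' [pP' mM' fpm' ->]]]]].
have := nnsumD pP mM'; have := nnsumD pP' mM.
rewrite (_ : (fun i => p' i + m i) = (fun i => p i + m' i)).
  move=> /nnsum_unique h /h e; lra.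
by apply/funext => i; have := fpm i; rewrite fpm'; lra.
Qed.

Lemma has_sumN (T : choiceType) (f : T -> R) s :
  has_sum f s -> has_sum (fun i => - f i) (- s).
Proof.
move=> [p [m [P [M [pP mM fpm ->]]]]]; exists m, p, M, P; split=> //.
  by move=> i; rewrite fpm opprB.
by rewrite opprB.
Qed.

Lemma has_sumD (T : choiceType) (f g : T -> R) s t :
  has_sum f s -> has_sum g t -> has_sum (fun i => f i + g i) (s + t).
Proof.
move=> [p [m [P [M [pP mM fpm ->]]]]] [p' [m' [P' [M' [pP' mM' fpm' ->]]]]].
exists (fun i => p i + p' i), (fun i => m i + m' i), (P + P'), (M + M'); split.
- exact: nnsumD.
- exact: nnsumD.
- by move=> i; rewrite fpm fpm'; ring.
- ring.
Qed.

Lemma has_sumB (T : choiceType) (f g : T -> R) s t :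
  has_sum f s -> has_sum g t -> has_sum (fun i => f i - g i) (s - t).
Proof. by move=> fs /has_sumN; exact: has_sumD. Qed.

Lemma has_sumZ (T : choiceType) (c : R) (f : T -> R) s :
  has_sum f s -> has_sum (fun i => c * f i) (c * s).
Proof.
wlog c0 : c / 0 <= c.
  move=> H fs; have [/H|/ltW] := leP 0 c; first exact.
  rewrite -oppr_ge0 => /H/(_ fs)/has_sumN; rewrite mulNr opprK.
  by apply: eq_has_sum => i; rewrite mulNr opprK.
move=> [p [m [P [M [pP mM fpm ->]]]]].
exists (fun i => c * p i), (fun i => c * m i), (c * P), (c * M); split.
- exact: nnsumZ.
- exact: nnsumZ.
- by move=> i; rewrite fpm mulrBr.
- by rewrite mulrBr.
Qed.

Lemma has_sum_reindex (T T' : choiceType) (e : T -> T') (f : T' -> R) s :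
  bijective e -> has_sum f s -> has_sum (f \o e) s.
Proof.
move=> be [p [m [P [M [pP mM fpm ->]]]]].
exists (p \o e), (m \o e), P, M; split=> //.
- exact: nnsum_reindex.
- exact: nnsum_reindex.
- by move=> i; rewrite /= fpm.
Qed.

Lemma has_sum_nnsum (T : choiceType) (f : T -> R) s :
  (forall i, 0 <= f i) -> has_sum f s -> nnsum f s.
Proof.
move=> f0 fs; have := fs => -[p [m [P [M [pP mM fpm _]]]]].
have [t ft] : exists t, nnsum f t.
  apply: nnsum_le pP => i; rewrite f0 fpm lerBlDr lerDl; exact: mM.1.
by rewrite (has_sum_unique fs (nnsum_has_sum ft)).
Qed.

Lemma has_sum_pair (T1 T2 : choiceType) (f : T1 * T2 -> R) s :
  has_sum f s ->
  exists2 r, forall i, has_sum (fun j => f (i, j)) (r i) & has_sum r s.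
Proof.
move=> [p [m [P [M [pP mM fpm ->]]]]].
have [rp prp rpP] := nnsum_pair pP; have [rm mrm rmM] := nnsum_pair mM.
exists (fun i => rp i - rm i); last by exists rp, rm, P, M.
by move=> i; exists (fun j => p (i, j)), (fun j => m (i, j)), (rp i), (rm i).
Qed.

Lemma has_sum_fubini (T1 T2 : choiceType) (f : T1 * T2 -> R) r s :
  (forall i, has_sum (fun j => f (i, j)) (r i)) -> has_sum f s -> has_sum r s.
Proof.
move=> fr /has_sum_pair[r' fr' r's].
by rewrite (_ : r = r')//; apply/funext => i; exact: has_sum_unique (fr' i).
Qed.

Lemma bij_swap (T1 T2 : Type) : bijective (fun x : T1 * T2 => (x.2, x.1)).
Proof. by exists (fun x => (x.2, x.1)); case. Qed.

Lemma has_sum_swap (T1 T2 : choiceType) (f : T1 * T2 -> R) s :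
  has_sum f s -> has_sum (fun x : T2 * T1 => f (x.2, x.1)) s.
Proof. exact/has_sum_reindex/bij_swap. Qed.

(** Since [g + f] lies between 0 and [2 * g], it is summable by comparison, and [f] is its
    difference with [g]. *)
Lemma has_sum_dom (T : choiceType) (f g : T -> R) t :
  (forall i, `|f i| <= g i) -> nnsum g t -> exists s, has_sum f s.
Proof.
move=> fg gt.
have gf0 i : 0 <= g i + f i <= 2 * g i.
  have := fg i; rewrite ler_norml; lra.
have [u fu] := nnsum_le gf0 (nnsumZ (ler0n R 2) gt).
exists (u - t); exists (fun i => g i + f i), g, u, t; split=> // i; lra.
Qed.

Lemma nnsum_mul (T1 T2 : choiceType) (f : T1 -> R) (g : T2 -> R) s t :
  nnsum f s -> nnsum g t -> nnsum (fun x : T1 * T2 => f x.1 * g x.2) (s * t).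
Proof.
move=> fs gt; apply: (@pair_nnsum _ _ _ (fun i => f i * t)).
  by move=> i; exact: (nnsumZ (fs.1 i) gt).
rewrite mulrC; apply: eq_nnsum (nnsumZ (nnsum_ge0 gt) fs) => i.
by rewrite mulrC.
Qed.

Lemma has_sum_mul (T1 T2 : choiceType) (f : T1 -> R) (g : T2 -> R) s t :
  has_sum f s -> has_sum g t -> has_sum (fun x : T1 * T2 => f x.1 * g x.2) (s * t).
Proof.
move=> [p [m [P [M [pP mM fpm ->]]]]] [p' [m' [P' [M' [pP' mM' fpm' ->]]]]].
exists (fun x => p x.1 * p' x.2 + m x.1 * m' x.2),
  (fun x => p x.1 * m' x.2 + m x.1 * p' x.2), (P * P' + M * M'),
  (P * M' + M * P'); split.
- by apply: nnsumD; exact: nnsum_mul.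
- by apply: nnsumD; exact: nnsum_mul.
- by move=> i; rewrite fpm fpm'; ring.
- ring.
Qed.

Lemma has_sum_sum (T1 T2 : choiceType) (f : T1 + T2 -> R) s :
  has_sum f s -> exists s1 s2, [/\ has_sum (f \o inl) s1, has_sum (f \o inr) s2 &
    s = s1 + s2].
Proof.
move=> [p [m [P [M [pP mM fpm ->]]]]].
have [p1 [p2 [hp1 hp2 ->]]] := nnsum_sum pP.
have [m1 [m2 [hm1 hm2 ->]]] := nnsum_sum mM.
exists (p1 - m1), (p2 - m2); split.
- by exists (p \o inl), (m \o inl), p1, m1; split=> // i; rewrite /= fpm.
- by exists (p \o inr), (m \o inr), p2, m2; split=> // i; rewrite /= fpm.
- ring.
Qed.

Lemma has_sum_series (f : nat -> R) s : has_sum f s -> series f @ \oo --> s.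
Proof.
move=> [p [m [P [M [/nnsum_series pP /nnsum_series mM fpm ->]]]]].
rewrite (_ : f = p - m); last by apply/funext.
by rewrite seriesD seriesN; apply: cvgB.
Qed.

Lemma nnsum_fin (f : nat -> R) N : (forall i, 0 <= f i) ->
  (forall i, (N <= i)%N -> f i = 0) -> nnsum f (\sum_(i < N) f i).
Proof.
move=> f0 fN; apply: series_nnsum => //.
rewrite -(big_mkord xpredT f).
have c : (fun _ : nat => \sum_(0 <= i < N) f i) @ \oo --> \sum_(0 <= i < N) f i.
  exact: cvg_cst.
apply: cvg_trans c; apply: near_eq_cvg; near=> n; rewrite /series/= (@big_cat_nat _ _ _ N 0%N n)//=.
  rewrite [X in _ = _ + X]big1_seq ?addr0//.
  by move=> i; rewrite /= mem_index_iota => /andP[Ni _]; exact: fN.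
by near: n; exact: nbhs_infty_ge.
Unshelve. all: by end_near. Qed.

Lemma has_sum_fin (f : nat -> R) N :
  (forall i, (N <= i)%N -> f i = 0) -> has_sum f (\sum_(i < N) f i).
Proof.
move=> fN.
exists (fun i => `|f i| + f i), (fun i => `|f i|),
  (\sum_(i < N) (`|f i| + f i)), (\sum_(i < N) `|f i|); split.
- apply: (@nnsum_fin (fun i => `|f i| + f i)) => i; last by move/fN => ->; rewrite normr0 addr0.
  have := ler_norm (- f i); rewrite normrN; lra.
- by apply: (@nnsum_fin (fun i => `|f i|)) => i // /fN ->; rewrite normr0.
- by move=> i; rewrite addrAC subrr add0r.
- by rewrite big_split/= addrAC subrr add0r.
Qed.

(** Spread [f] over the graph of [p] in [T * nat]: summing over [nat] first returns [f], summing
    over [T] first gives the fibre sums. *)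
Lemma has_sum_regroup (T : choiceType) (p : T -> nat) (f : T -> R) s :
  has_sum f s ->
  exists2 r, forall n, has_sum (fun t => if p t == n then f t else 0) (r n) &
    has_sum r s.
Proof.
have nnregroup (g : T -> R) u : nnsum g u ->
    nnsum (fun x : T * nat => if p x.1 == x.2 then g x.1 else 0) u.
  move=> gu; apply: (pair_nnsum _ gu) => t /=; have g0 := gu.1 t.
  have := @nnsum_fin (fun j => if p t == j then g t else 0) (p t).+1.
  rewrite big_ord_recr/= eqxx big1 ?add0r; last first.
    by move=> i _; rewrite gtn_eqF.
  apply; first by move=> i; case: ifP.
  by move=> i pti; rewrite ltn_eqF.
move=> [q [m [P [M [/nnregroup qP /nnregroup mM fpm ->]]]]].
have : has_sum (fun x : T * nat => if p x.1 == x.2 then f x.1 else 0) (P - M).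
  exists (fun x => if p x.1 == x.2 then q x.1 else 0),
    (fun x => if p x.1 == x.2 then m x.1 else 0), P, M; split=> // i.
  by rewrite fpm; case: ifP => // _; rewrite subr0.
by move/has_sum_swap/has_sum_pair.
Qed.

Lemma has_sum_fin2 (f : nat * nat -> R) N :
  (forall i j, (N <= i)%N || (N <= j)%N -> f (i, j) = 0) ->
  has_sum f (\sum_(i < N) \sum_(j < N) f (val i, val j)).
Proof.
move=> fN.
pose g (x : nat * nat) := (x.1 < N)%:R * (x.2 < N)%:R : R.
have h n : nnsum (fun i => (i < n)%:R : R) n%:R.
  have := @nnsum_fin (fun i => (i < n)%:R) n.
  rewrite (eq_bigr (fun=> 1)) ?sumr_const ?card_ord; last by move=> i _; rewrite ltn_ord.
  by apply=> // i; rewrite leqNgt => /negbTE ->.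
have hg := nnsum_mul (h N) (h N).
pose C := \sum_(i < N) \sum_(j < N) `|f (val i, val j)|.
have C0 : 0 <= C by apply: sumr_ge0 => i _; apply: sumr_ge0.
have [||s fs] := @has_sum_dom _ f (fun x => C * ((x.1 < N)%:R * (x.2 < N)%:R)) (C * (N%:R * N%:R)).
- move=> [i j] /=; have [iN|iN] := ltnP i N; last by rewrite fN ?iN// normr0 mulr_ge0.
  have [jN|jN] := ltnP j N; last by rewrite fN ?jN ?orbT// normr0 !mulr0.
  rewrite !mulr1 /C (bigD1 (Ordinal iN))//= (bigD1 (Ordinal jN))//=.
  rewrite -addrA lerDl addr_ge0// ?sumr_ge0// => k _; exact: sumr_ge0.
- exact: (nnsumZ C0 hg).
suff -> : \sum_(i < N) \sum_(j < N) f (val i, val j) = s by [].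
have h1 i : has_sum (fun j => f (i, j)) (\sum_(j < N) f (i, val j)).
  by apply: (@has_sum_fin (fun j => f (i, j))) => j jN; rewrite fN ?jN ?orbT.
apply: has_sum_unique (has_sum_fubini h1 fs).
apply: (@has_sum_fin (fun i => \sum_(j < N) f (i, val j))) => i iN.
by rewrite big1// => j _; rewrite fN ?iN.
Qed.

End has_sum.

(** * Summability of zeta and Lambert series *)

Section summability.
Context {R : realType}.

Lemma nnsum_bounded (f : nat -> R) (M : R) : (forall i, 0 <= f i) ->
  (forall n, series f n <= M) -> exists s, nnsum f s.
Proof.
move=> f0 fM.
have nd : nondecreasing_seq (series f).
  by apply: (@nondecreasing_series _ f xpredT 0%N) => n _ _; exact: f0.
have cv : cvgn (series f).
  by apply: nondecreasing_is_cvgn => //; exists M => _ [n _ <-].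
by exists (limn (series f)); exact: series_nnsum.
Qed.

(** A telescoping form of the comparison of (n+2)^(-1-e) with the integral of x^(-1-e) over
    [n+1, n+2], obtained from ln (1 + x) <= x and 1 + x <= e^x. *)
Lemma zeta_bound (e : R) (n : nat) : 0 < e ->
  expR (- (1 + e) * ln n.+2%:R) <=
  e^-1 * (expR (- e * ln n.+1%:R) - expR (- e * ln n.+2%:R)).
Proof.
move=> e0.
have n1 : (0 : R) < n.+1%:R by [].
have n2 : (0 : R) < n.+2%:R by [].
set u := ln n.+2%:R; set v := ln n.+1%:R.
have h1 : n.+2%:R^-1 <= u - v.
  have : ln (1 + (- n.+2%:R^-1)) <= - n.+2%:R^-1 :> R.
    by apply: le_ln1Dx; rewrite ltrN2 invf_lt1// ltr1n.
  have -> : 1 + - n.+2%:R^-1 = n.+1%:R / n.+2%:R :> R.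
    have -> : n.+1%:R = n.+2%:R - 1 :> R by rewrite -[n.+2%:R]natr1 addrK.
    by rewrite mulrBl divff ?mul1r// gt_eqF.
  by rewrite ln_div ?posrE// -/u -/v lerNr opprB.
have -> : expR (- (1 + e) * u) = n.+2%:R^-1 * expR (- e * u).
  rewrite (_ : _ * u = - u + - e * u); last by ring.
  by rewrite expRD expRN lnK ?posrE.
have -> : expR (- e * v) = expR (- e * u) * expR (e * (u - v)).
  by rewrite -expRD; congr expR; ring.
have h2 := expR_ge1Dx (e * (u - v)).
have h3 := expR_gt0 (- e * u).
rewrite [leRHS](_ : _ = expR (- e * u) * (e^-1 * (expR (e * (u - v)) - 1)));
  last by ring.
rewrite mulrC ler_pM2l// (le_trans h1)// ler_pdivlMl// lerBrDl.
exact: h2.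
Qed.

Lemma zeta_summable (c : R) : 1 < c ->
  exists s, nnsum (fun n => expR (- c * ln n.+1%:R)) s.
Proof.
move=> c1; pose e := c - 1; have e0 : 0 < e by rewrite subr_gt0.
have ce : c = 1 + e by rewrite addrC subrK.
have ie : 0 < e^-1 by rewrite invr_gt0.
apply: (@nnsum_bounded _ (1 + e^-1)) => [i|n]; first exact: expR_ge0.
suff H : series (fun n => expR (- c * ln n.+1%:R)) n.+1 <=
    1 + e^-1 * (1 - expR (- e * ln n.+1%:R)).
  have := expR_ge0 (- e * ln n.+1%:R); move=> h5.
  have : e^-1 * (1 - expR (- e * ln n.+1%:R)) <= e^-1 * 1.
    rewrite ler_pM2l//; lra.
  have : series (fun n => expR (- c * ln n.+1%:R)) n <=
    series (fun n => expR (- c * ln n.+1%:R)) n.+1.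
    by rewrite seriesSr lerDl expR_ge0.
  lra.
elim: n => [|n ih].
  by rewrite seriesSr /series/= big_nil add0r ln1 !mulr0 expR0; lra.
rewrite seriesSr; have := @zeta_bound e n e0; rewrite -ce; lra.
Qed.

Lemma expR_le_pow (k : nat) (u : R) : 0 < u -> expR (- u) <= k`!%:R / u ^+ k.
Proof.
move=> u0; rewrite expRN -[leRHS]invrK lef_pV2 ?posrE ?expR_gt0//; last first.
  by rewrite invr_gt0 divr_gt0 ?exprn_gt0// ltr0n fact_gt0.
rewrite invf_div; case: k => [|k]; first by rewrite expr0 fact0 divr1 -expR0 ler_expR ltW.
by have := @expR_ge1Dxn R u k (ltW u0); lra.
Qed.

Lemma nnsum_inv2 : exists s : R, nnsum (fun n => (n.+1%:R ^+ 2)^-1) s.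
Proof.
have [s hs] := @zeta_summable 2 (ltr1n _ 2).
exists s; apply: eq_nnsum hs => n.
by rewrite mulNr expRN expRM_natl lnK ?posrE.
Qed.

(** This is q^n for q = e^(-t); later t is pi y or pi / y. *)
Definition wexp (t : R) (n : nat) : R := expR (- (t * n%:R)).

Lemma wexpD t m n : wexp t (m + n) = wexp t m * wexp t n.
Proof. by rewrite /wexp -expRD natrD; congr expR; ring. Qed.

Lemma wexp_ge0 t n : 0 <= wexp t n. Proof. exact: expR_ge0. Qed.

(** From e^(-u) <= K!/u^K at u = t a x with K = i + j + 2 + k: the powers i and j absorb the
    weights, 2 leaves a convergent double series, and the free k gives any power of 1/t. *)
Lemma lambert_bound (i j k : nat) (t : R) (a x : nat) : 0 < t ->
  a.+1%:R ^+ i * x.+1%:R ^+ j * wexp t (a.+1 * x.+1) <=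
  (i + j + 2 + k)`!%:R / t ^+ (i + j + 2 + k) *
  ((a.+1%:R ^+ 2)^-1 * (x.+1%:R ^+ 2)^-1).
Proof.
move=> t0; set K := (i + j + 2 + k)%N.
have a1 : 1 <= a.+1%:R :> R by rewrite ler1n.
have x1 : 1 <= x.+1%:R :> R by rewrite ler1n.
have a0 : 0 < a.+1%:R :> R by [].
have x0 : 0 < x.+1%:R :> R by [].
move: a1 x1 a0 x0; rewrite /wexp natrM.
set A := a.+1%:R; set X := x.+1%:R => a1 x1 a0 x0.
have u0 : 0 < t * (A * X) by rewrite !mulr_gt0.
apply: (@le_trans _ _ (A ^+ i * X ^+ j * (K`!%:R / (t * (A * X)) ^+ K))).
  by rewrite ler_wpM2l ?expR_le_pow// mulr_ge0// exprn_ge0// ltW.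
have h (Y : R) m : 1 <= Y -> (m + 2 <= K)%N -> Y ^+ m / Y ^+ K <= (Y ^+ 2)^-1.
  move=> Y1 mK; have Y0 : 0 < Y by apply: lt_le_trans Y1.
  rewrite ler_pdivrMr ?exprn_gt0// ler_pdivlMl ?exprn_gt0// -exprD addnC.
  exact: ler_weXn2l.
rewrite [leLHS](_ : _ = K`!%:R / t ^+ K * (A ^+ i / A ^+ K * (X ^+ j / X ^+ K))).
  rewrite ler_wpM2l ?divr_ge0 ?exprn_ge0 ?(ltW t0)//.
  apply: ler_pM; rewrite ?divr_ge0 ?exprn_ge0 ?(ltW a0) ?(ltW x0)//; apply: h => //; rewrite /K.
    by rewrite -!addnA leq_add2l; apply: leq_trans (leq_addl _ _); rewrite leq_addr.
  by rewrite -addnA -addnA addnA (addnC i) -!addnA leq_add2l addnCA leq_addr.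
rewrite !exprMn; field.
by rewrite !expf_neq0 ?gt_eqF.
Qed.

Lemma lambert_summable (i j : nat) (t : R) : 0 < t -> exists s,
  nnsum (fun p : nat * nat =>
    p.1.+1%:R ^+ i * p.2.+1%:R ^+ j * wexp t (p.1.+1 * p.2.+1)) s.
Proof.
move=> t0; have [s hs] := nnsum_inv2.
have c0 : 0 <= (i + j + 2 + 0)`!%:R / t ^+ (i + j + 2 + 0) :> R.
  by rewrite divr_ge0// exprn_ge0// ltW.
apply: nnsum_le (nnsumZ c0 (nnsum_mul hs hs)) => p.
rewrite lambert_bound// andbT !mulr_ge0 ?exprn_ge0//; exact: wexp_ge0.
Qed.

End summability.

(** * The product identity A (1 - 8 T) = W *)

Section regrouping.
Context {R : realType}.

Lemma has_sum_graph (T : choiceType) (p : T -> nat) (f : T -> R) s :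
  has_sum f s ->
  has_sum (fun x : T * nat => if p x.1 == x.2 then f x.1 else 0) s.
Proof.
have nngraph (g : T -> R) u : nnsum g u ->
    nnsum (fun x : T * nat => if p x.1 == x.2 then g x.1 else 0) u.
  move=> gu; apply: (pair_nnsum _ gu) => t /=; have g0 := gu.1 t.
  have := @nnsum_fin R (fun j => if p t == j then g t else 0) (p t).+1.
  rewrite big_ord_recr/= eqxx big1 ?add0r; last first.
    by move=> i _; rewrite gtn_eqF.
  apply; first by move=> i; case: ifP.
  by move=> i pti; rewrite ltn_eqF.
move=> [q [m [P [M [/nngraph qP /nngraph mM fpm ->]]]]].
exists (fun x => if p x.1 == x.2 then q x.1 else 0),
  (fun x => if p x.1 == x.2 then m x.1 else 0), P, M; split=> // i.
by rewrite fpm; case: ifP => // _; rewrite subr0.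
Qed.

(** Grouping by i + j + 1 = n. As indices stand for i + 1 and j + 1, the positive integers being
    added have sum n + 1; n = 0 contributes an empty sum. *)
Lemma has_sum_conv (U : choiceType) (f : (nat * nat) * U -> R) s :
  has_sum f s ->
  has_sum (fun x : nat * U =>
    \sum_(i < x.1) f ((val i, (x.1 - i.+1)%N), x.2)) s.
Proof.
move=> /(@has_sum_graph _ (fun y => (y.1.1 + y.1.2).+1)) h.
pose e (z : (nat * U) * (nat * nat)) : ((nat * nat) * U) * nat :=
  ((z.2, z.1.2), z.1.1).
have be : bijective e.
  exists (fun w => ((w.2, w.1.2), w.1.1)); first by case=> [[? ?] [? ?]].
  by case=> [[[? ?] ?] ?].
move/(has_sum_reindex be): h => h; apply: has_sum_fubini h => -[n u] /=.
pose g (j : nat * nat) := if (j.1 + j.2).+1 == n then f (j, u) else 0.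
suff -> : \sum_(i < n) f (val i, (n - i.+1)%N, u) =
    \sum_(i < n) \sum_(j < n) g (val i, val j).
  apply: (eq_has_sum _ (has_sum_fin2 (f := g) (N := n) _)) => //.
  move=> i j /orP[] h; rewrite /g/=; case: eqP => // E; exfalso; move: h;
    rewrite -E leqNgt ltnS ?leq_addr ?leq_addl//.
apply: eq_bigr => i _.
have lti : (n - i.+1 < n)%N by rewrite ltn_subrL/= (leq_ltn_trans _ (ltn_ord i)).
rewrite (bigD1 (Ordinal lti))//= big1 ?addr0 /g/=.
  by rewrite -addSn subnKC ?eqxx.
move=> j; rewrite -val_eqE/= => nj; case: eqP => // E; exfalso.
by move/eqP: nj; apply; apply: (@addnI i.+1); rewrite subnKC ?addSn.
Qed.

(** The case a < b is parametrised by b = a + c + 1, so that the strict inequality becomes a free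
    index c. *)
Lemma has_sum_trichotomy (U : choiceType) (f : (nat * nat) * U -> R) s :
  has_sum f s -> exists s1 s2 s3, [/\
    has_sum (fun x : nat * U => f ((x.1, x.1), x.2)) s1,
    has_sum (fun x : (nat * nat) * U =>
      f ((x.1.1, (x.1.1 + x.1.2).+1), x.2)) s2,
    has_sum (fun x : (nat * nat) * U =>
      f (((x.1.1 + x.1.2).+1, x.1.1), x.2)) s3 &
    s = s1 + s2 + s3].
Proof.
pose e (z : nat * U + ((nat * nat) * U + (nat * nat) * U)) : (nat * nat) * U :=
  match z with
  | inl x => ((x.1, x.1), x.2)
  | inr (inl x) => ((x.1.1, (x.1.1 + x.1.2).+1), x.2)
  | inr (inr x) => (((x.1.1 + x.1.2).+1, x.1.1), x.2)
  end.
pose e' (z : (nat * nat) * U) : nat * U + ((nat * nat) * U + (nat * nat) * U) :=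
  if z.1.1 == z.1.2 then inl (z.1.1, z.2)
  else if (z.1.1 < z.1.2)%N then inr (inl ((z.1.1, (z.1.2 - z.1.1.+1)%N), z.2))
  else inr (inr ((z.1.2, (z.1.1 - z.1.2.+1)%N), z.2)).
have be : bijective e.
  exists e'; rewrite /e /e'.
    move=> [[a u]|[[[a c] u]|[[a c] u]]] /=; first by rewrite eqxx.
      by rewrite ltn_eqF ?ltnS ?leq_addr// subSS addKn.
    by rewrite gtn_eqF ?ltnS ?leq_addr// ltnNge leqW ?leq_addr//= subSS addKn.
  move=> [[a b] u] /=; case: eqP => [->//|/eqP ab]; case: ltnP => /= h.
    by rewrite -addSn subnKC.
  by rewrite -addSn subnKC// ltn_neqAle eq_sym ab.
move=> /(has_sum_reindex be)/has_sum_sum[s1 [s4 [h1 /has_sum_sum[s2 [s3 [h2 h3 ->]]] ->]]].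
exists s1, s2, s3; split => //; exact: addrA.
Qed.

End regrouping.

Section alternating_sums.
Context {R : realType}.

Lemma sum_sign (m : nat) : \sum_(i < m) (-1) ^+ i.+1 = ((-1) ^+ m - 1) / 2 :> R.
Proof.
elim: m => [|m ih]; first by rewrite big_ord0 subrr mul0r.
by rewrite big_ord_recr/= ih !exprS; lra.
Qed.

Lemma sum_sign_lin (m : nat) : \sum_(i < m) (-1) ^+ i.+1 * i.+1%:R
  = ((-1) ^+ m * (2 * m%:R + 1) - 1) / 4 :> R.
Proof.
elim: m => [|m ih]; first by rewrite big_ord0 expr0; lra.
by rewrite big_ord_recr/= ih !exprS -[m.+1%:R]natr1; lra.
Qed.

Lemma sum_sign_sqr (m : nat) : \sum_(i < m) (-1) ^+ i.+1 * i.+1%:R ^+ 2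
  = (-1) ^+ m * m%:R * (m%:R + 1) / 2 :> R.
Proof.
elim: m => [|m ih]; first by rewrite big_ord0; lra.
rewrite big_ord_recr/= ih !exprS -[m.+1%:R]natr1; set x := (-1) ^+ m; by field.
Qed.

End alternating_sums.

(** * Liouville's weight function and its boundary sums *)

Section eisenstein.
Context {R : realType}.

(* The quadratic forms below, one for each parity class of (a, b, x, y), are a
   solution of the linear system eisH_step. *)
Definition eisH (a b x y : nat) : R :=
  let A := a%:R in let B := b%:R in
  match odd a, odd b, odd x, odd y with
  | false, false, false, true => 4 * A ^+ 2 + 4 * A * B - 2 * B ^+ 2
  | false, false, true, false => 4 * B ^+ 2 + 4 * A * B - 2 * A ^+ 2
  | false, false, true, true => - (2 * A ^+ 2) - 8 * A * B - 2 * B ^+ 2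
  | false, true, false, true => 2 * B ^+ 2 + 4 * A * B
  | true, false, true, false => 2 * A ^+ 2 + 4 * A * B
  | false, true, true, false => 2 * A ^+ 2 - 4 * A * B - 4 * B ^+ 2
  | true, false, false, true => 2 * B ^+ 2 - 4 * A * B - 4 * A ^+ 2
  | false, true, true, true => 2 * B ^+ 2 - 2 * A ^+ 2
  | true, false, true, true => 2 * A ^+ 2 - 2 * B ^+ 2
  | true, true, false, true => - (2 * B ^+ 2) - 4 * A * B
  | true, true, true, false => - (2 * A ^+ 2) - 4 * A * B
  | true, true, true, true => 2 * A ^+ 2 + 8 * A * B + 2 * B ^+ 2
  | _, _, _, _ => 0
  end.

(* Eight times the summand of A T. *)
Definition eist (a b x y : nat) : R :=
  8 * a%:R * b%:R * (odd x)%:R * (-1) ^+ (b + y).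

(** This symmetry exchanges the halves a < b and a > b, and likewise x < y and x > y, so only one
    half of each splitting has to be evaluated. *)
Lemma eisH_sym a b x y : eisH a b x y = eisH b a y x.
Proof.
rewrite /eisH; case: (odd a); case: (odd b); case: (odd x); case: (odd y) => //;
  ring.
Qed.

(** The heart of Liouville's method: both values of [eisH] carry the same power of q, because a x +
    (a + b) y = a (x + y) + b y, and their difference is a symmetrised summand of 8 A T. *)
Lemma eisH_step a b x y : eisH a (a + b) x y - eisH a b (x + y) y =
  eist a (a + b) x y + eist (a + b) a y x.
Proof.
rewrite /eist -[(-1) ^+ (a + b + y)]signr_odd -[(-1) ^+ (a + x)]signr_odd.
rewrite /eisH !oddD natrD.
by case: (odd a); case: (odd b); case: (odd x); case: (odd y) => /=; ring.
Qed.

(** The boundary x = y, collected at a + b = n + 1, where the exponent of q is constant. The linear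
    term over odd x produces 2 A; the quadratic one goes into W. *)
Lemma eisH_diag_x n x : \sum_(i < n) eisH i.+1 (n - i) x x =
  (odd x)%:R * (2 * n.+1%:R + 2 * (-1) ^+ n.+1 * n.+1%:R ^+ 2).
Proof.
case ox : (odd x); last first.
  rewrite mul0r big1// => i _; rewrite /eisH ox.
  by case: (odd _); case: (odd _).
set d : R := n.+1%:R.
have E (i : 'I_n) : (n - i)%:R = d - i.+1%:R :> R.
  by rewrite -subSS natrB// ltnS ltnW.
have Eo (i : 'I_n) : odd (n - i) = odd n (+) odd i by rewrite oddB// ltnW.
have [on|on] := boolP (odd n).
  rewrite (eq_bigr (fun i : 'I_n => - (2 * d ^+ 2) * (-1) ^+ i.+1
    + - (4 * d) * ((-1) ^+ i.+1 * i.+1%:R)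
    + 4 * ((-1) ^+ i.+1 * i.+1%:R ^+ 2))); last first.
    move=> i _; rewrite /eisH ox Eo on E -[(-1) ^+ _]signr_odd /=.
    by case: (odd i) => /=; ring.
  rewrite !big_split/= -!mulr_sumr sum_sign sum_sign_lin sum_sign_sqr.
  rewrite -[(-1) ^+ n]signr_odd -[(-1) ^+ n.+1]signr_odd /= on /= /d -[n.+1%:R]natr1; by field.
rewrite (eq_bigr (fun i : 'I_n => 2 * d ^+ 2 * (-1) ^+ i.+1
    + - (4 * d) * ((-1) ^+ i.+1 * i.+1%:R))); last first.
  move=> i _; rewrite /eisH ox Eo (negbTE on) E -[(-1) ^+ _]signr_odd /=.
  by case: (odd i) => /=; ring.
rewrite !big_split/= -!mulr_sumr sum_sign sum_sign_lin.
rewrite -[(-1) ^+ n]signr_odd -[(-1) ^+ n.+1]signr_odd /= (negbTE on) /= /d -[n.+1%:R]natr1; by field.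
Qed.

(** The boundary a = b, collected at x + y = n + 1: what the diagonal of the symmetrised sum for A T
    leaves over against that of [eisH]. *)
Lemma eisH_diag_a n a :
  \sum_(i < n) (eist a a i.+1 (n - i) + eist a a (n - i) i.+1
    - eisH a a i.+1 (n - i)) =
  (-1) ^+ a * a%:R ^+ 2 * (if odd n then - (2 * n.+1%:R) else 2 * n%:R).
Proof.
have Eo (i : 'I_n) : odd (n - i) = odd n (+) odd i by rewrite oddB// ltnW.
rewrite (eq_bigr (fun i : 'I_n => (-1) ^+ a * a%:R ^+ 2 *
    (if odd n then - 2 * (1 - (-1) ^+ i.+1) else 2))); last first.
  move=> i _; rewrite /eist /eisH -![(-1) ^+ (_ + _)]signr_odd !oddD Eo.
  rewrite -[(-1) ^+ a]signr_odd -[(-1) ^+ i.+1]signr_odd /=.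
  by case: (odd a); case: (odd n); case: (odd i) => /=; ring.
rewrite -mulr_sumr; congr (_ * _); case on: (odd n).
  rewrite -mulr_sumr big_split/= sumr_const card_ord sumrN sum_sign.
  rewrite -[(-1) ^+ n]signr_odd on -[n.+1%:R]natr1; lra.
by rewrite sumr_const card_ord mulr_natr.
Qed.

End eisenstein.

Section eisenstein_product.
Context {R : realType}.
Variable t : R.
Hypothesis t0 : 0 < t.

Let Q := ((nat * nat) * (nat * nat))%type.

Let w (a b x y : nat) : R := wexp t (a * x + b * y).

Lemma eisH_bound a b x y :
  `|eisH a.+1 b.+1 x y| <= 16 * (a.+1%:R ^+ 2 * b.+1%:R ^+ 2) :> R.
Proof.
rewrite /eisH.
have : (1 : R) <= a.+1%:R by rewrite ler1n.
have : (1 : R) <= b.+1%:R by rewrite ler1n.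
set A : R := a.+1%:R; set B : R := b.+1%:R => B1 A1.
have A2 : 1 <= A ^+ 2 by rewrite exprn_ege1.
have B2 : 1 <= B ^+ 2 by rewrite exprn_ege1.
have h1 : A ^+ 2 <= A ^+ 2 * B ^+ 2 by rewrite ler_peMr// (le_trans _ A2).
have h2 : B ^+ 2 <= A ^+ 2 * B ^+ 2 by rewrite ler_peMl// (le_trans _ B2).
have h3 : 0 <= A * B by rewrite mulr_ge0// (le_trans _ A1, le_trans _ B1).
have h4 : 2 * (A * B) <= A ^+ 2 + B ^+ 2.
  by have := sqr_ge0 (A - B); rewrite sqrrB -mulr_natl; lra.
rewrite -[4 * A * B]mulrA -[8 * A * B]mulrA.
move: (A ^+ 2 * B ^+ 2) (A * B) (A ^+ 2) (B ^+ 2) h1 h2 h3 h4 A2 B2 => C D E F *.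
by case: (odd _); case: (odd _); case: (odd _); case: (odd _);
  rewrite ler_norml; apply/andP; split; lra.
Qed.

Lemma eist_has_sum (A T : R) :
  has_sum (fun p : nat * nat =>
    (odd p.2.+1)%:R * p.1.+1%:R * wexp t (p.1.+1 * p.2.+1)) A ->
  has_sum (fun p : nat * nat =>
    (-1) ^+ (p.1.+1 + p.2.+1) * p.1.+1%:R * wexp t (p.1.+1 * p.2.+1)) T ->
  has_sum (fun z : Q => eist z.1.1.+1 z.1.2.+1 z.2.1.+1 z.2.2.+1 *
    w z.1.1.+1 z.1.2.+1 z.2.1.+1 z.2.2.+1) (8 * (A * T)).
Proof.
move=> hA hT; have h := has_sumZ 8 (has_sum_mul hA hT).
pose e (z : Q) := ((z.1.1, z.2.1), (z.1.2, z.2.2)).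
have be : bijective e.
  by exists e; case=> [[? ?] [? ?]].
move: (has_sum_reindex be h); apply: eq_has_sum => -[[a b] [x y]] /=.
by rewrite /w /eist wexpD; ring.
Qed.

Lemma eisenstein_product (A T W : R) :
  has_sum (fun p : nat * nat =>
    (odd p.2.+1)%:R * p.1.+1%:R * wexp t (p.1.+1 * p.2.+1)) A ->
  has_sum (fun p : nat * nat =>
    (-1) ^+ (p.1.+1 + p.2.+1) * p.1.+1%:R * wexp t (p.1.+1 * p.2.+1)) T ->
  has_sum (fun p : nat * nat =>
    (-1) ^+ (p.1.+1 + p.2.+1) * p.1.+1%:R ^+ 2 * p.2.+1%:R *
    wexp t (p.1.+1 * p.2.+1)) W ->
  A * (1 - 8 * T) = W.
Proof.
move=> hA hT hW; have ht := eist_has_sum hA hT.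
pose sw (z : Q) : Q := ((z.1.2, z.1.1), (z.2.2, z.2.1)).
have bsw : bijective sw by exists sw; case=> [[? ?] [? ?]].
pose sw1 (z : Q) : Q := (z.1, (z.2.2, z.2.1)).
have bsw1 : bijective sw1 by exists sw1; case=> [[? ?] [? ?]].
pose sw2 (z : Q) : Q := ((z.2.2, z.2.1), z.1).
have bsw2 : bijective sw2.
  by exists (fun z => (z.2, (z.1.2, z.1.1))); case=> [[? ?] [? ?]].
have bswap T1 T2 := bij_swap T1 T2.
(* Symmetrised, the sum for 8 A T becomes one for 16 A T and acquires the symmetry of [eisH]. *)
pose fT (z : Q) := (eist z.1.1.+1 z.1.2.+1 z.2.1.+1 z.2.2.+1 +
  eist z.1.2.+1 z.1.1.+1 z.2.2.+1 z.2.1.+1) * w z.1.1.+1 z.1.2.+1 z.2.1.+1 z.2.2.+1.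
pose fH (z : Q) := eisH z.1.1.+1 z.1.2.+1 z.2.1.+1 z.2.2.+1 *
  w z.1.1.+1 z.1.2.+1 z.2.1.+1 z.2.2.+1.
have hfT : has_sum fT (16 * (A * T)).
  rewrite (_ : 16 * (A * T) = 8 * (A * T) + 8 * (A * T)); last by ring.
  apply: eq_has_sum (has_sumD ht (has_sum_reindex bsw ht)) => -[[a b] [x y]] /=.
  by rewrite /fT /w /= [(b.+1 * _ + _)%N]addnC; ring.
have [s hfH] : exists s, has_sum fH s.
  have [u hu] := lambert_summable 2 0 t0.
  pose e (z : Q) := ((z.1.1, z.2.1), (z.1.2, z.2.2)).
  have be : bijective e by exists e; case=> [[? ?] [? ?]].
  have hh := nnsum_reindex be (nnsum_mul hu hu).
  apply: has_sum_dom (nnsumZ (ler0n R 16) hh) => -[[a b] [x y]].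
  rewrite /fH /= normrM /w [`|wexp _ _|]ger0_norm ?wexp_ge0// wexpD.
  have := ler_wpM2r (mulr_ge0 (wexp_ge0 t (a.+1 * x.+1)) (wexp_ge0 t (b.+1 * y.+1)))
    (eisH_bound a b x.+1 y.+1).
  move=> h; apply: le_trans h _; rewrite !expr0; lra.
have [s1 [s2 [s3 [h1 h2 h3 sE]]]] := has_sum_trichotomy hfH.
have s23 : s2 = s3.
  apply: has_sum_unique h2 _; move: (has_sum_reindex bsw1 h3).
  apply: eq_has_sum => -[[i c] [k l]]; rewrite /fH/= eisH_sym /w.
  by rewrite [(_ * l.+1 + _)%N]addnC.
have [s1' [s2' [s3' [h1' h2' h3' sE']]]] := has_sum_trichotomy (has_sum_swap hfH).
have s23' : s2' = s3'.
  apply: has_sum_unique h2' _; move: (has_sum_reindex bsw1 h3').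
  apply: eq_has_sum => -[[k c] [i j]]; rewrite /fH/= eisH_sym /w.
  by rewrite [(j.+1 * _ + _)%N]addnC.
have [r1 [r2 [r3 [k1 k2 k3 rE]]]] := has_sum_trichotomy hfT.
have r23 : r2 = r3.
  apply: has_sum_unique k2 _; move: (has_sum_reindex bsw1 k3).
  apply: eq_has_sum => -[[i c] [k l]]; rewrite /fT/= addrC /w.
  by rewrite [(_ * l.+1 + _)%N]addnC.
(* [eisH_step] term by term: the a < b part of the symmetrised sum is the a < b part of the sum of
   [eisH] minus its x > y part; [sw2] aligns the parametrisations. *)
have r2E : r2 = s2 - s3'.
  apply: has_sum_unique k2 _.
  move: (has_sumB h2 (has_sum_reindex bsw2 h3')).
  apply: eq_has_sum => -[[i c] [z y]]; rewrite /fH /fT /w /=.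
  have -> : (i.+1 * (y + z).+2 + c.+1 * y.+1 =
    i.+1 * z.+1 + (i + c).+2 * y.+1)%N.
    rewrite (_ : (y + z).+2 = z.+1 + y.+1)%N; last by rewrite addSn addnS addnC.
    have -> : ((i + c).+2 = i.+1 + c.+1)%N by rewrite addSn addnS.
    by rewrite mulnDr mulnDl addnA.
  have := eisH_step (R := R) i.+1 c.+1 z.+1 y.+1.
  by rewrite !addSn !addnS [(z + y)%N]addnC => <-; ring.
have g1 : has_sum (fun x : nat * nat => (odd x.2.+1)%:R *
   (2 * x.1.+1%:R + 2 * (-1) ^+ x.1.+1 * x.1.+1%:R ^+ 2) *
   wexp t (x.1.+1 * x.2.+1)) s1'.
  move: (has_sum_conv (has_sum_swap h1')).
  apply: eq_has_sum => -[n k] /=.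
  transitivity ((\sum_(i < n) eisH i.+1 (n - i) k.+1 k.+1) *
    wexp t (n.+1 * k.+1)); last by rewrite eisH_diag_x.
  rewrite mulr_suml; apply: eq_bigr => i _.
  have E : (i.+1 + (n - i) = n.+1)%N by rewrite addSn subnKC// ltnW.
  by rewrite /fH /= /w (subnSK (ltn_ord i)) -mulnDl E.
have g2 : has_sum (fun x : nat * nat => (-1) ^+ x.1.+1 * x.1.+1%:R ^+ 2 *
   (if odd x.2 then - (2 * x.2.+1%:R) else 2 * x.2%:R) *
   wexp t (x.1.+1 * x.2.+1)) (r1 - s1).
  apply: eq_has_sum (has_sum_swap (has_sum_conv (has_sum_swap (has_sumB k1 h1)))).
  move=> -[a n] /=; rewrite -eisH_diag_a mulr_suml.
  apply: eq_bigr => i _.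
  have E : (i.+1 + (n - i) = n.+1)%N by rewrite addSn subnKC// ltnW.
  by rewrite /fH /fT /= /w (subnSK (ltn_ord i)) -mulnDr E -mulrBl.
(* The two splittings give s1 + 2 s2 = s1' + 2 s3', and 16 A T = r1 + 2 (s2 - s3'). Hence 16 A T =
   s1' + r1 - s1, which consists of boundary terms only. *)
have : s1' + (r1 - s1) = 2 * A - 2 * W.
  apply: has_sum_unique (has_sumD g1 g2) _.
  apply: eq_has_sum (has_sumB (has_sumZ 2 hA) (has_sumZ 2 hW)) => -[n k] /=.
  rewrite -[(-1) ^+ (n.+1 + k.+1)]signr_odd oddD -[(-1) ^+ n.+1]signr_odd /=.
  by rewrite -[k.+1%:R]natr1; case: (odd n); case: (odd k) => /=; ring.
move: rE sE sE'; rewrite -r23 -s23 -s23' r2E s23' => rE -> sE2; lra.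
Qed.

End eisenstein_product.

(** * The transformation formula 16 B(1/y) = y^2 (1 - 8 T(y)) *)

Section tannery.
Context {R : realType}.

Lemma has_sum_le_norm (T : choiceType) (f u : T -> R) s U :
  (forall i, `|f i| <= u i) -> has_sum f s -> nnsum u U -> `|s| <= U.
Proof.
move=> fu fs uU.
have h1 : 0 <= U - s.
  apply: nnsum_ge0 (has_sum_nnsum _ (has_sumB (nnsum_has_sum uU) fs)) => i.
  by rewrite subr_ge0 (le_trans (ler_norm _)).
have h2 : 0 <= U + s.
  apply: nnsum_ge0 (has_sum_nnsum _ (has_sumD (nnsum_has_sum uU) fs)) => i.
  by have := fu i; rewrite ler_norml => /andP[]; lra.
by rewrite ler_norml; apply/andP; split; lra.
Qed.

Lemma has_sum_tail (f u : nat -> R) s U K :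
  (forall i, `|f i| <= u i) -> has_sum f s -> nnsum u U ->
  `|s - \sum_(i < K) f i| <= U - \sum_(i < K) u i.
Proof.
have tail (h : nat -> R) v : has_sum h v ->
    has_sum (fun i => if (i < K)%N then 0 else h i) (v - \sum_(i < K) h i).
  move=> hv.
  have := @has_sum_fin R (fun i => if (i < K)%N then h i else 0) K.
  rewrite (eq_bigr (fun i : 'I_K => h i)); last by move=> i _; rewrite ltn_ord.
  move=> hf; apply: eq_has_sum (has_sumB hv (hf _)) => i.
    by case: ifP; rewrite ?subrr ?subr0.
  by rewrite ltnNge => ->.
move=> fu /tail fs /nnsum_has_sum/tail uU.
apply: has_sum_le_norm fs (has_sum_nnsum _ uU) => i; case: ifP => // _.
- by rewrite normr0.
- exact: le_trans (fu i).
Qed.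

(** Tannery's theorem. Both tails beyond K are at most the tail of the majorant, hence at most e/4,
    and the finite head eventually differs by at most e/2. *)
Lemma has_sum_cvg (G : nat -> nat -> R) (g u : nat -> R) (S : nat -> R) s U :
  (forall M k, `|G M k| <= u k) -> nnsum u U ->
  (forall k, G ^~ k @ \oo --> g k) ->
  (forall M, has_sum (G M) (S M)) -> has_sum g s -> S @ \oo --> s.
Proof.
move=> Gu uU Gg GS gs.
have gu k : `|g k| <= u k.
  have h : `|G M k| @[M --> \oo] --> `|g k| by apply: cvg_norm; exact: Gg.
  rewrite -(cvg_lim _ h)//; apply: limr_le; first by apply/cvg_ex; exists `|g k|.
  exact: nearW.
apply/cvgrPdist_le => e e0.
have e4 : 0 < e / 4 by rewrite divr_gt0.
have := nnsum_series uU => /cvgrPdist_le/(_ _ e4)[K _ /(_ K (leqnn _))].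
rewrite /series/= big_mkord => hK.
have fincvg : \sum_(i < K) (G M i - g i) @[M --> \oo] --> \sum_(i < K) (0 : R).
  apply: cvg_big => [|i _]; first exact: add_continuous.
  by rewrite -(subrr (g i)); apply: cvgB => //; exact: cvg_cst.
rewrite big1// in fincvg.
have e2 : 0 < e / 2 by rewrite divr_gt0.
move/cvgrPdist_le: fincvg => /(_ _ e2); apply: filterS => M.
rewrite sumrB sub0r normrN => hM.
have h1 := has_sum_tail K (Gu M) (GS M) uU.
have h2 := has_sum_tail K gu gs uU.
have h3 : U - \sum_(i < K) u i <= e / 4 by apply: le_trans (ler_norm _) hK.
move: h1 h2 h3 hM; rewrite !ler_norml.
move=> /andP[? ?] /andP[? ?] ? /andP[? ?]; apply/andP; split; lra.
Qed.

Lemma has_sum_parity (f : nat -> R) s : has_sum f s -> exists s0 s1,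
  [/\ has_sum (fun l => f l.*2) s0, has_sum (fun l => f l.*2.+1) s1 & s = s0 + s1].
Proof.
pose e (z : nat + nat) := match z with inl l => l.*2 | inr l => l.*2.+1 end.
have be : bijective e.
  exists (fun n => if odd n then inr n./2 else inl n./2).
    by case=> l /=; rewrite ?odd_double /= ?doubleK // uphalf_double.
  by move=> n; case: ifP => on /=; rewrite -[RHS](odd_double_half n) on.
by move=> /(has_sum_reindex be)/has_sum_sum[s0 [s1 [h0 h1 ->]]]; exists s0, s1.
Qed.

Lemma has_sum_shift (f : nat -> R) s : f 0%N = 0 -> has_sum f s ->
  has_sum (fun n => f n.+1) s.
Proof.
move=> f0.
pose e (z : unit + nat) := match z with inl _ => 0%N | inr l => l.+1 end.
have be : bijective e.
  exists (fun n => if n is m.+1 then inr m else inl tt); last by case.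
  by case=> [[]|].
move=> /(has_sum_reindex be)/has_sum_sum[s0 [s1 [h0 h1 ->]]].
have -> : s0 = 0.
  apply: has_sum_unique h0 _; apply: eq_has_sum (has_sum0 _) => i /=.
  by rewrite f0.
by rewrite add0r.
Qed.

Lemma has_sum_geometric (p : R) : `|p| < 1 -> has_sum (fun n => p ^+ n) (1 - p)^-1.
Proof.
have geo (q : R) : `|q| < 1 -> series (fun n => q ^+ n) @ \oo --> (1 - q)^-1.
  move=> q1; have := @cvg_geometric_series R 1 q q1; rewrite mul1r.
  by rewrite (_ : geometric 1 q = (fun n => q ^+ n))//; apply/funext => n; rewrite /= mul1r.
move=> p1.
have hn : nnsum (fun n => `|p| ^+ n) (1 - `|p|)^-1.
  by apply: series_nnsum; [move=> i; rewrite exprn_ge0|apply: geo; rewrite normr_id].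
have [s hs] : exists s, has_sum (fun n => p ^+ n) s.
  by apply: has_sum_dom hn => n; rewrite normrX.
by rewrite -(cvg_unique _ (has_sum_series hs) (geo _ p1)).
Qed.

(** The Cauchy square of the geometric series. The factor [unit] fits the form of [has_sum_conv],
    whose empty term n = 0 is shifted away. *)
Lemma has_sum_geometric2 (p : R) : `|p| < 1 ->
  has_sum (fun n => n.+1%:R * p ^+ n) ((1 - p) ^- 2).
Proof.
move=> /has_sum_geometric hp.
rewrite expr2 invfM.
pose e (z : (nat * nat) * unit) := z.1.
have be : bijective e by exists (fun z => (z, tt)); case=> // ? [].
have := has_sum_conv (has_sum_reindex be (has_sum_mul hp hp)).
pose e' (n : nat) := (n, tt).
have be' : bijective e' by exists (fun z => z.1) => [|[? []]].
move=> /(has_sum_reindex be')/has_sum_shift; rewrite /= big_ord0 => /(_ erefl).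
apply: eq_has_sum => n; rewrite (eq_bigr (fun=> p ^+ n)).
  by rewrite sumr_const card_ord mulr_natl.
by move=> i _; rewrite -exprD subSS subnKC// -ltnS.
Qed.

End tannery.

(** * Partial fractions of sech^2 by duplication *)

Section sine_fractions.
Context {R : realType}.
Implicit Types a b x w : R.

Definition sinh x : R := (expR x - expR (- x)) / 2.
Definition cosh x : R := (expR x + expR (- x)) / 2.

Lemma cosh2 x : cosh x ^+ 2 = 1 + sinh x ^+ 2.
Proof.
have := expRxMexpNx_1 x; rewrite /cosh /sinh; set u := expR x; set v := expR _.
by move=> uv; transitivity (u * v + ((u - v) / 2) ^+ 2); [field|rewrite uv].
Qed.

Lemma sinh_double x : sinh x = 2 * sinh (x / 2) * cosh (x / 2).
Proof.
rewrite /sinh /cosh (_ : expR x = expR (x / 2) ^+ 2); last first.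
  by rewrite -expRM_natl; congr expR; field.
rewrite (_ : expR (- x) = expR (- (x / 2)) ^+ 2); first by field.
by rewrite -expRM_natl; congr expR; field.
Qed.

Lemma cosh_gt0 x : 0 < cosh x.
Proof. by rewrite divr_gt0// addr_gt0// expR_gt0. Qed.

Lemma sinh_gt0 x : 0 < x -> 0 < sinh x.
Proof. by move=> x0; rewrite divr_gt0// subr_gt0 ltr_expR gtrN. Qed.

(* The real part of 1 / sin^2 (a + i b). *)
Definition csc2 a b : R :=
  (sin a ^+ 2 - sinh b ^+ 2 + 2 * sin a ^+ 2 * sinh b ^+ 2) /
  (sin a ^+ 2 + sinh b ^+ 2) ^+ 2.

Lemma sin_double a : sin a = 2 * sin (a / 2) * cos (a / 2).
Proof.
have {1}-> : a = (a / 2) *+ 2 by rewrite -mulr_natr divfK.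
by rewrite sin_mulr2n -mulr_natl; ring.
Qed.

(** Real part of 1/sin^2 z = (1/sin^2 (z/2) + 1/cos^2 (z/2)) / 4, reduced to P = sin^2 (a/2) and Q =
    sinh^2 (b/2); [sin a != 0] means 0 < P < 1. *)
Lemma csc2_half a b : sin a != 0 ->
  csc2 a b = (csc2 (a / 2) (b / 2) + csc2 ((a + pi) / 2) (b / 2)) / 4.
Proof.
move=> sa; rewrite /csc2 [(a + pi) / 2]mulrDl sinDpihalf.
have e1 : sin a ^+ 2 = 4 * sin (a / 2) ^+ 2 * (1 - sin (a / 2) ^+ 2).
  by rewrite -cos2sin2 sin_double; ring.
have e2 : sinh b ^+ 2 = 4 * sinh (b / 2) ^+ 2 * (1 + sinh (b / 2) ^+ 2).
  by rewrite -cosh2 sinh_double; ring.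
have sa2 : 0 < sin a ^+ 2 by rewrite exprn_even_gt0.
rewrite e2 cos2sin2 e1.
move: (sinh (b / 2)) e1 => q e1; move: sa2; rewrite e1.
have := sin2cos2 (a / 2); have := sqr_ge0 (cos (a / 2)).
move: (sin (a / 2)) (cos (a / 2)) => p c c0 pc p0.
have p20 : 0 < p ^+ 2 by rewrite lt_neqAle sqr_ge0 andbT; apply/eqP => h; move: p0; rewrite -h; lra.
have p21 : 0 < 1 - p ^+ 2.
  by rewrite lt_neqAle; apply/andP; split; [apply/eqP => h; move: p0; rewrite -h|]; lra.
have q0 := sqr_ge0 q.
move: (p ^+ 2) (q ^+ 2) p20 p21 q0 => P Q P0 P1 Q0.
field; rewrite ?gt_eqF//; [|lra|lra].
by have := mulr_gt0 P0 P1; have := sqr_ge0 Q; lra.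
Qed.

Lemma csc2_multiple a b (n : nat) : 0 < a < pi ->
  csc2 a b = 4 ^- n *
    \sum_(k < 2 ^ n) csc2 ((a + k%:R * pi) / 2 ^+ n) (b / 2 ^+ n).
Proof.
move=> /andP[a0 api]; elim: n => [|n ->].
  by rewrite big_ord_recl big_ord0 expr0 !divr1 mul0r !addr0 invr1 mul1r.
rewrite exprSr invfM -mulrA; congr (_ * _).
rewrite (eq_bigr (fun k : 'I_(2 ^ n) =>
    (csc2 ((a + k%:R * pi) / 2 ^+ n.+1) (b / 2 ^+ n.+1) +
     csc2 ((a + (2 ^ n + k)%:R * pi) / 2 ^+ n.+1) (b / 2 ^+ n.+1)) / 4)); last first.
  move=> k _; rewrite csc2_half.
    have E (c : R) : c / 2 ^+ n / 2 = c / 2 ^+ n.+1 by rewrite exprSr invfM mulrA.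
    rewrite !E (_ : (_ / 2 ^+ n + pi) / 2 = (a + (2 ^ n + k)%:R * pi) / 2 ^+ n.+1)//.
    by rewrite exprSr natrD natrX; field; rewrite expf_neq0.
  (* As k + 1 <= 2^n, every argument lies strictly between 0 and pi, where the sine does not
     vanish. *)
  rewrite gt_eqF//; apply: sin_gt0_pi.
  have n0 : 0 < 2 ^+ n :> R by rewrite exprn_gt0.
  have pi0 := pi_gt0 R.
  rewrite divr_gt0//=; last by rewrite ltr_wpDr// mulr_ge0// ltW.
  rewrite ltr_pdivrMr//.
  apply: (@lt_le_trans _ _ (k.+1%:R * pi)); first by rewrite -natr1; lra.
  by rewrite mulrC ler_pM2l// -natrX ler_nat.
rewrite -mulr_suml big_split/= [RHS]mulrC; congr (_ * _).
by rewrite expnS mul2n -addnn big_split_ord.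
Qed.

Lemma csc2_pi a b : csc2 (pi - a) b = csc2 a b.
Proof. by rewrite /csc2 [pi - a]addrC sinDpi sinN opprK. Qed.

Lemma csc2_pihalf b : csc2 (pi / 2) b = (cosh b ^+ 2)^-1.
Proof.
rewrite /csc2 sin_pihalf cosh2 expr1n; have := sqr_ge0 (sinh b).
move: (sinh b ^+ 2) => q q0; field.
by rewrite gt_eqF//; lra.
Qed.

(** At a = pi/2 [csc2] is sech^2 b. The 2^(n+1) terms are symmetric under a -> pi - a; only those
    with argument below pi/2 are kept, where the sine has a linear lower bound. *)
Lemma sech2_sum b (n : nat) : (cosh b ^+ 2)^-1 = 2 * 4 ^- n.+1 *
    \sum_(k < 2 ^ n) csc2 (k.*2.+1%:R * pi / 2 / 2 ^+ n.+1) (b / 2 ^+ n.+1).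
Proof.
have pi0 := pi_gt0 R.
rewrite -csc2_pihalf (@csc2_multiple _ _ n.+1); last by apply/andP; split; lra.
rewrite [2 * _]mulrC -mulrA; congr (_ * _).
pose F (k : nat) := csc2 (k.*2.+1%:R * pi / 2 / 2 ^+ n.+1) (b / 2 ^+ n.+1).
have EF k : csc2 ((pi / 2 + k%:R * pi) / 2 ^+ n.+1) (b / 2 ^+ n.+1) = F k.
  by rewrite /F; congr (csc2 (_ / _) _); rewrite -[k.*2.+1]addn1 -muln2 natrD natrM; field.
under eq_bigr do rewrite EF.
rewrite expnS mul2n -addnn big_split_ord /= mulr_natl mulr2n; congr (_ + _).
rewrite [RHS](reindex_inj rev_ord_inj)/=; apply: eq_bigr => k _.
rewrite -/(F _) /F -[LHS]csc2_pi; congr csc2.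
have n0 : 2 ^+ n.+1 != 0 :> R by rewrite expf_neq0.
apply: (mulIf n0); rewrite mulrBl !divfK//.
have -> : ((2 ^ n + k).*2.+1)%:R = 2 ^+ n.+1 + k.*2.+1%:R :> R.
  by rewrite doubleD -mul2n -expnS -addnS natrD natrX.
have -> : (2 ^ n - k.+1).*2.+1%:R = 2 ^+ n.+1 - k.*2.+1%:R :> R.
  rewrite -natrX -natrB; last by rewrite expnS mul2n ltn_double.
  by rewrite expnS mul2n doubleB doubleS subnSK// -doubleS leq_double.
by field.
Qed.

(** The modulus of 1/sin^2 (a + i b) is 1/(sin^2 a + sinh^2 b). *)
Lemma norm_csc2_le a b : sin a != 0 -> `|csc2 a b| <= (sin a ^+ 2)^-1.
Proof.
move=> sa; have s0 : 0 < sin a ^+ 2 by rewrite exprn_even_gt0.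
have s1 : sin a ^+ 2 <= 1 by rewrite sin2cos2 gerBl sqr_ge0.
rewrite /csc2; have := sqr_ge0 (sinh b).
move: (sin a ^+ 2) (sinh b ^+ 2) s0 s1 => P Q P0 P1 Q0.
have PQ0 : 0 < P + Q by lra.
have PQ : P * Q <= Q by rewrite ler_piMl.
have PQ' : 0 <= P * Q by rewrite mulr_ge0// ltW.
rewrite normrM normfV [`|_ ^+ 2|]ger0_norm ?sqr_ge0//.
apply: (@le_trans _ _ (P + Q)^-1); last by rewrite lef_pV2 ?posrE//; lra.
rewrite ler_pdivrMr ?exprn_gt0// expr2 mulrA mulVf ?gt_eqF// mul1r -mulrA.
by rewrite ler_norml; apply/andP; split; lra.
Qed.

(** A weak Jordan inequality: sin a = 2 sin (a/2) cos (a/2), the mean value theorem gives sin (a/2)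
    = (a/2) cos x, and the squares of both cosines are at least 1/2 on [0, pi/4]. *)
Lemma sin_ge_half a : 0 <= a <= pi / 2 -> a / 2 <= sin a.
Proof.
move=> /andP[a0 api]; have pi0 := pi_gt0 R.
have [->|an0] := eqVneq a 0; first by rewrite mul0r sin0.
have {}a0 : 0 < a / 2 by rewrite divr_gt0// lt_neqAle eq_sym an0.
have [] := @MVT R sin cos 0 (a / 2) a0 (fun x _ => is_derive_sin x).
  by apply: continuous_subspaceT => x; exact: continuous_sin.
move=> x; rewrite in_itv/= sin0 !subr0 => /andP[x0 xa] sx.
have cosge y : 0 <= y <= pi / 4 -> 2^-1 <= cos y ^+ 2.
  move=> /andP[y0 y4].
  have h : cos (y *+ 2) >= 0 by apply: cos_ge0_pihalf; rewrite -mulr_natr; apply/andP; split; lra.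
  by move: h; rewrite cos_mulr2n -mulr_natr; lra.
have c1 : 0 <= cos (a / 2) by apply: cos_ge0_pihalf; apply/andP; split; lra.
have c2 : 0 <= cos x by apply: cos_ge0_pihalf; apply/andP; split; lra.
have h1 : 2^-1 <= cos (a / 2) ^+ 2 by apply: cosge; apply/andP; split; lra.
have h2 : 2^-1 <= cos x ^+ 2 by apply: cosge; apply/andP; split; lra.
have h3 : 2^-1 <= cos x * cos (a / 2).
  rewrite -(@ler_pXn2r _ 2)// ?nnegrE ?mulr_ge0//.
  rewrite exprMn [_^-1 ^+ 2]expr2; apply: ler_pM => //; by rewrite invr_ge0.
rewrite sin_double sx.
have := ler_wpM2l (ltW a0) h3; lra.
Qed.

Lemma cvgn_mull (c l : R) (u : nat -> R) :
  u n @[n --> \oo] --> l -> c * u n @[n --> \oo] --> c * l.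
Proof. by move=> ul; apply: cvgM => //; exact: cvg_cst. Qed.

Lemma cvg_div_exp2 w : w / 2 ^+ n @[n --> \oo] --> (0 : R).
Proof.
have h : `|2^-1 : R| < 1 by rewrite ger0_norm ?invr_ge0// invf_lt1// ltr1n.
have := @cvg_geometric R w 2^-1 h.
by under eq_cvg do rewrite /geometric/= exprVn.
Qed.

Lemma dyadic_derivative (f : R -> R) d w : f 0 = 0 -> is_derive (0 : R) (1 : R) f d ->
  2 ^+ n * f (w / 2 ^+ n) @[n --> \oo] --> w * d.
Proof.
move=> f0 fd; have [->|w0] := eqVneq w 0.
  rewrite mul0r; under eq_cvg do rewrite mul0r f0 mulr0.
  exact: cvg_cst.
have h : h^-1 *: ((f \o shift (0 : R)) (h *: (1 : R)) - f 0) @[h --> (0 : R)^'] --> d.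
  by have [df <-] := fd; exact: df.
move/cvgr_dnbhsP: h => /(_ (fun n => w / 2 ^+ n)) h.
have /h : (forall n, w / 2 ^+ n != 0) /\ (w / 2 ^+ n @[n --> \oo] --> (0 : R)).
  by split=> [n|]; [rewrite mulf_neq0// invr_neq0// expf_neq0|exact: cvg_div_exp2].
move/(@cvgn_mull w d); apply: cvg_trans; apply: near_eq_cvg; apply: nearW => n.
rewrite /= f0 subr0 addr0 [_ *: 1]mulr1 invf_div /GRing.scale/=.
by rewrite mulrA [w * _]mulrC divfK.
Qed.

(** The limit is Re 1/(w + i b)^2. After scaling by 2^n the mixed term of [csc2] keeps a factor 4^-n
    and disappears. *)
Lemma csc2_limit w b : w != 0 ->
  4 ^- n * csc2 (w / 2 ^+ n) (b / 2 ^+ n) @[n --> \oo] -->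
  (w ^+ 2 - b ^+ 2) / (w ^+ 2 + b ^+ 2) ^+ 2.
Proof.
move=> w0.
have hw : 2 ^+ n * sin (w / 2 ^+ n) @[n --> \oo] --> w.
  by have := @dyadic_derivative sin _ w (sin0 R) (is_derive_sin 0); rewrite cos0 mulr1.
have hb : 2 ^+ n * sinh (b / 2 ^+ n) @[n --> \oo] --> b.
  rewrite -[X in _ --> X]mulr1; apply: (@dyadic_derivative sinh 1).
    by rewrite /sinh oppr0 subrr mul0r.
  rewrite /sinh; by apply: is_derive_eq; rewrite oppr0 expR0 /GRing.scale/=; field.
have h4 : (4 : R) ^- n @[n --> \oo] --> (0 : R).
  have h : `|4^-1 : R| < 1 by rewrite ger0_norm ?invr_ge0// invf_lt1// ltr1n.
  have := @cvg_geometric R 1 4^-1 h.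
  by under eq_cvg do rewrite /geometric/= mul1r exprVn.
have w2b : (w ^+ 2 + b ^+ 2) != 0.
  by rewrite gt_eqF// ltr_pwDl ?sqr_ge0// exprn_even_gt0.
pose p n := (2 ^+ n * sin (w / 2 ^+ n)) ^+ 2.
pose q n := (2 ^+ n * sinh (b / 2 ^+ n)) ^+ 2.
have hp : p n @[n --> \oo] --> w ^+ 2 by apply: cvgM.
have hq : q n @[n --> \oo] --> b ^+ 2 by apply: cvgM.
have main : (p n - q n + 2 * p n * q n * 4 ^- n) / (p n + q n) ^+ 2 @[n --> \oo]
    --> (w ^+ 2 - b ^+ 2 + 2 * w ^+ 2 * b ^+ 2 * 0) / (w ^+ 2 + b ^+ 2) ^+ 2.
  apply: cvgM.
    apply: cvgD; first exact: cvgB.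
    by apply: cvgM => //; apply: cvgM => //; exact: cvgn_mull.
  by apply: cvgV; [rewrite expf_neq0|apply: cvgM; exact: cvgD].
rewrite mulr0 addr0 in main; apply: cvg_trans main; apply: near_eq_cvg.
apply: nearW => n; rewrite /p /q /csc2.
move: (sin (w / 2 ^+ n)) (sinh (b / 2 ^+ n)) => S1 S2; rewrite !exprMn.
have -> : (2 ^+ n) ^+ 2 = 4 ^+ n :> R by rewrite exprAC -natrX.
set P := S1 ^+ 2; set Q := S2 ^+ 2.
have f4 : 4 ^+ n != 0 :> R by rewrite expf_neq0.
move: (4 ^+ n) f4 => F f4.
(* Should the denominator vanish for some n, both sides are 0, the inverse of 0 being 0. *)
have [PQ|PQ] := eqVneq (P + Q) 0.
  by rewrite PQ -mulrDr PQ mulr0 expr0n/= invr0 !mulr0.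
field; by rewrite ?f4 ?PQ// -mulrDr mulf_neq0.
Qed.

(** The real part of 1/(k + i x)^2. *)
Definition rfrac (x : R) (k : nat) : R :=
  (k%:R ^+ 2 - x ^+ 2) / (k%:R ^+ 2 + x ^+ 2) ^+ 2.

Lemma norm_rfrac_le x k : `|rfrac x k.+1| <= (k.+1%:R ^+ 2 + x ^+ 2)^-1.
Proof.
rewrite /rfrac; have k0 : 0 < k.+1%:R ^+ 2 :> R by rewrite exprn_gt0.
have := sqr_ge0 x; move: (_ ^+ 2) (x ^+ 2) k0 => u v u0 v0.
have uv : 0 < u + v by lra.
rewrite normrM normfV [`|_ ^+ 2|]ger0_norm ?sqr_ge0// ler_pdivrMr ?exprn_gt0//.
rewrite expr2 mulrA mulVf ?gt_eqF// mul1r.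
by rewrite ler_norml; apply/andP; split; lra.
Qed.

Lemma norm_rfrac_le2 x k : `|rfrac x k.+1| <= (k.+1%:R ^+ 2)^-1.
Proof.
apply: le_trans (norm_rfrac_le _ _) _.
by rewrite lef_pV2 ?posrE ?ltr_pwDl ?exprn_gt0 ?sqr_ge0// lerDl sqr_ge0.
Qed.

Lemma sech2_fractions x :
  has_sum (fun k => rfrac x k.*2.+1) (pi ^+ 2 / 8 / cosh (pi * x / 2) ^+ 2).
Proof.
have pi0 := pi_gt0 R; have pi2 := pi_ge2 R.
have [z hz] := @nnsum_inv2 R.
have odd_le k : (k.*2.+1%:R ^+ 2)^-1 <= (k.+1%:R ^+ 2)^-1 :> R.
  rewrite lef_pV2 ?posrE ?exprn_gt0// lerXn2r ?nnegrE// ler_nat ltnS -addnn.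
  exact: leq_addr.
have [s hs] : exists s, has_sum (fun k => rfrac x k.*2.+1) s.
  apply: has_sum_dom hz => k; exact: le_trans (norm_rfrac_le2 _ _) (odd_le _).
suff <- : s = pi ^+ 2 / 8 / cosh (pi * x / 2) ^+ 2 by [].
pose b := pi * x / 2.
pose w (k : nat) : R := k.*2.+1%:R * pi / 2.
(* The k-th term of [sech2_sum] at level M, extended by zero: its sum over k does not depend on M,
   while each term converges as M grows. *)
pose G M k := if (k < 2 ^ M)%N then
  2 * (4 ^- M.+1 * csc2 (w k / 2 ^+ M.+1) (b / 2 ^+ M.+1)) else 0.
have hG M : has_sum (G M) (cosh b ^+ 2)^-1.
  have := @has_sum_fin R (G M) (2 ^ M).
  rewrite (sech2_sum b M) mulr_sumr; under eq_bigr do rewrite /G ltn_ord mulrA.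
  by apply=> k; rewrite /G ltnNge => ->.
have w0 k : 0 < w k by rewrite divr_gt0// mulr_gt0.
have boundG M k : `|G M k| <= 8 * (k.+1%:R ^+ 2)^-1.
  rewrite /G; case: ltnP => [kM|_]; last by rewrite normr0 mulr_ge0// invr_ge0 exprn_ge0.
  have M0 : 0 < 2 ^+ M.+1 :> R by rewrite exprn_gt0.
  have a0 : 0 < w k / 2 ^+ M.+1 by rewrite divr_gt0.
  have a1 : w k / 2 ^+ M.+1 <= pi / 2.
    rewrite ler_pdivrMr// /w -mulrA [leLHS]mulrC ler_wpM2l ?divr_ge0// ?(ltW pi0)//.
    by rewrite -natrX ler_nat expnS mul2n ltn_double.
  have h1 : w k / 2 ^+ M.+1 / 2 <= sin (w k / 2 ^+ M.+1).
    by apply: sin_ge_half; rewrite (ltW a0).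
  have s0 : 0 < sin (w k / 2 ^+ M.+1) by apply: lt_le_trans h1; rewrite divr_gt0.
  have := @norm_csc2_le (w k / 2 ^+ M.+1) (b / 2 ^+ M.+1).
  rewrite gt_eqF// => /(_ isT); move: (csc2 _ _) => C hC.
  rewrite !normrM normfV normr_nat [`|4 ^+ _|]ger0_norm ?exprn_ge0//.
  apply: (@le_trans _ _ (2 * (4 ^- M.+1 * (sin (w k / 2 ^+ M.+1) ^+ 2)^-1))).
    apply: ler_wpM2l => //; apply: ler_wpM2l; first by rewrite invr_ge0 exprn_ge0.
    exact: hC.
  apply: (@le_trans _ _ (2 * (4 ^- M.+1 * ((w k / 2 ^+ M.+1 / 2) ^+ 2)^-1))).
    apply: ler_wpM2l => //; apply: ler_wpM2l; first by rewrite invr_ge0 exprn_ge0.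
    have a2 : 0 < w k / 2 ^+ M.+1 / 2 by rewrite divr_gt0.
    rewrite lef_pV2 ?posrE; [|exact: exprn_gt0|exact: exprn_gt0].
    by rewrite lerXn2r ?nnegrE ?(ltW s0) ?(ltW a2).
  (* Here 8 = 2 * 2^2: the factor of [sech2_sum] and the square of the 2 from [sin_ge_half]. *)
  rewrite [leLHS](_ : _ = 8 * (w k ^+ 2)^-1); last first.
    have <- : (2 ^+ M.+1) ^+ 2 = 4 ^+ M.+1 :> R by rewrite exprAC -natrX.
    move: (w0 k) M0; move: (w k) (2 ^+ M.+1) => c d c0 d0; field.
    by rewrite (gt_eqF c0) (gt_eqF d0).
  rewrite ler_pM2l// (le_trans _ (odd_le k))// lef_pV2 ?posrE ?exprn_gt0//.
  rewrite lerXn2r ?nnegrE ?(ltW (w0 k))// /w -mulrA ler_peMr//; lra.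
have Gg k : G ^~ k @ \oo --> 8 / pi ^+ 2 * rfrac x k.*2.+1.
  have := @csc2_limit (w k) b; rewrite gt_eqF// => /(_ isT) h.
  have h2 : 2 * (4 ^- M.+1 * csc2 (w k / 2 ^+ M.+1) (b / 2 ^+ M.+1)) @[M --> \oo]
    --> 2 * ((w k ^+ 2 - b ^+ 2) / (w k ^+ 2 + b ^+ 2) ^+ 2).
    apply: cvgn_mull; rewrite -cvg_shiftS in h; exact: h.
  rewrite [X in _ --> X](_ : _ = 2 * ((w k ^+ 2 - b ^+ 2) / (w k ^+ 2 + b ^+ 2) ^+ 2)).
    apply: cvg_trans h2; apply: near_eq_cvg; near=> M.
    rewrite /G ifT//; apply: (@leq_ltn_trans M); last exact: ltn_expl.
    by near: M; exact: nbhs_infty_ge.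
  rewrite /rfrac /w /b; have : 0 < k.*2.+1%:R :> R by [].
  move: (k.*2.+1%:R : R) (pi : R) pi0 => c p p0 c0.
  have c2 : 0 < c ^+ 2 by rewrite exprn_gt0.
  have p2 : 0 < p ^+ 2 by rewrite exprn_gt0.
  have h1 : 0 < c ^+ 2 + x ^+ 2 by rewrite ltr_pwDl// sqr_ge0.
  by field; rewrite !exprMn mulrC -mulrDr mulf_neq0 ?(gt_eqF h1) ?(gt_eqF p2) ?(gt_eqF p0).
have h := has_sum_cvg boundG (nnsumZ (ler0n R 8) hz) Gg hG (has_sumZ (8 / pi ^+ 2) hs).
have h' : (fun _ : nat => (cosh b ^+ 2)^-1) @ \oo --> (cosh b ^+ 2)^-1 by exact: cvg_cst.
have := cvg_unique _ h h'; rewrite -/b.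
have := cosh_gt0 b; move: (cosh b) => ch ch0 E.
have -> : s = pi ^+ 2 / 8 * (8 / pi ^+ 2 * s).
  by move: (pi : R) pi0 => p p0; field; rewrite gt_eqF.
by rewrite E.
Unshelve. all: by end_near. Qed.

End sine_fractions.

(** * Hyperbolic functions as partial fractions and as Lambert series *)

Section lambert_transformation.
Context {R : realType}.
Implicit Types x y z : R.

Lemma has_sum_evens (f : nat -> R) s : (forall l, f l.*2.+1 = 0) ->
  has_sum f s -> has_sum (fun l => f l.*2) s.
Proof.
move=> f0 /has_sum_parity[s0 [s1 [h0 h1 ->]]].
have -> : s1 = 0 by apply: has_sum_unique h1 _; apply: eq_has_sum (has_sum0 _).
by rewrite addr0.
Qed.

Lemma rfrac_half x n : rfrac x n.+1.*2 = rfrac (x / 2) n.+1 / 4.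
Proof.
rewrite /rfrac -muln2 natrM; have : 0 < n.+1%:R :> R by [].
move: (n.+1%:R : R) => k k0; have k2 : 0 < k ^+ 2 by rewrite exprn_gt0.
by field; rewrite !gt_eqF//; have := sqr_ge0 x; lra.
Qed.

(** Since k + i n y = i y (n - i k/y), exchanging the roles of k and n turns y into 1/y; the
    inversion of the transformation formula enters here. *)
Lemma rfrac_scale y n k : y != 0 ->
  rfrac (n.+1%:R * y) k.+1 = - (y ^- 2) * rfrac (k.+1%:R / y) n.+1.
Proof.
move=> y0; rewrite /rfrac; have : 0 < n.+1%:R :> R by [].
have : 0 < k.+1%:R :> R by [].
move: (n.+1%:R : R) (k.+1%:R : R) => a b b0 a0.
have h : 0 < b ^+ 2 + a ^+ 2 * y ^+ 2.
  by rewrite ltr_pwDl ?exprn_gt0// mulr_ge0// sqr_ge0.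
by field; rewrite y0 exprMn addrC gt_eqF.
Qed.

(** Separating odd from even n expresses the sum at x by the sech^2 series and the same sum at x/2.
    The closed form obeys the same recursion, so the difference satisfies D(x) = 4^-n D(x/2^n),
    which tends to 0. *)
Lemma csch2_fractions x : 0 < x -> has_sum (fun n => rfrac x n.+1)
  ((x ^- 2 - pi ^+ 2 / sinh (pi * x) ^+ 2) / 2).
Proof.
have pi0 := pi_gt0 R.
have [z hz] := @nnsum_inv2 R.
have ex (u : R) : exists s : R, has_sum (fun n => rfrac u n.+1) s.
  exact: (has_sum_dom (fun k => norm_rfrac_le2 u k) hz).
have [G hG] := choice ex.
have Gz u : `|G u| <= z.
  exact: (has_sum_le_norm (fun k => norm_rfrac_le2 u k) (hG u) hz).
have Gstep u : G u = pi ^+ 2 / 8 / cosh (pi * u / 2) ^+ 2 + G (u / 2) / 4.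
  have [s0 [s1 [h0 h1 ->]]] := has_sum_parity (hG u).
  congr (_ + _); first by apply: has_sum_unique h0 (sech2_fractions u).
  apply: has_sum_unique h1 _; rewrite mulrC.
  apply: eq_has_sum (has_sumZ 4^-1 (hG (u / 2))) => n.
  by rewrite -doubleS rfrac_half mulrC.
pose D u := G u - (u ^- 2 - pi ^+ 2 / sinh (pi * u) ^+ 2) / 2.
have Dstep u : 0 < u -> D u = D (u / 2) / 4.
  move=> u0; rewrite /D Gstep; have -> : pi * (u / 2) = pi * u / 2 by rewrite mulrA.
  have h0 : 0 < sinh (pi * u / 2) by rewrite sinh_gt0// divr_gt0// mulr_gt0.
  move: (cosh2 (pi * u / 2)) (cosh_gt0 (pi * u / 2)) h0 (sinh_double (pi * u)).
  move: (sinh (pi * u / 2)) (cosh (pi * u / 2)) (sinh (pi * u)) (G (u / 2)).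
  move=> s c S g c2 c0 s0 ->; rewrite !exprMn c2.
  have c20 : 0 < 1 + s ^+ 2 by rewrite ltr_wpDr// sqr_ge0.
  by move: (pi : R) => p; field; rewrite !gt_eqF.
have Dn n u : 0 < u -> D u = 4 ^- n * D (u / 2 ^+ n).
  move=> u0; elim: n => [|n ->]; first by rewrite !expr0 !invr1 mul1r mulr1.
  rewrite [in LHS]Dstep ?divr_gt0 ?exprn_gt0// !exprSr !invfM -!mulrA.
  by congr (_ * _); rewrite mulrC.
move=> x0; suff : D x = 0 by move/eqP; rewrite subr_eq0 => /eqP <-.
have h4 : (4 : R) ^- n @[n --> \oo] --> (0 : R).
  have h : `|4^-1 : R| < 1 by rewrite ger0_norm ?invr_ge0// invf_lt1// ltr1n.
  have := @cvg_geometric R 1 4^-1 h.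
  by under eq_cvg do rewrite /geometric/= mul1r exprVn.
have lim1 : 4 ^- n * G (x / 2 ^+ n) @[n --> \oo] --> (0 : R).
  apply: (@squeeze_cvgr _ _ _ _ (fun n => - (z * 4 ^- n)) (fun n => z * 4 ^- n)).
  - apply: nearW => n; rewrite -ler_norml normrM normfV [`|4 ^+ _|]ger0_norm ?exprn_ge0//.
    by rewrite mulrC ler_wpM2r// invr_ge0 exprn_ge0.
  - by rewrite -oppr0 -(mulr0 z); apply: cvgN; exact: cvgn_mull.
  - by rewrite -(mulr0 z); exact: cvgn_mull.
have lim2 : 2 ^+ n * sinh (pi * x / 2 ^+ n) @[n --> \oo] --> pi * x.
  rewrite -[X in _ --> X]mulr1; apply: (@dyadic_derivative _ sinh 1).
    by rewrite /sinh oppr0 subrr mul0r.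
  by rewrite /sinh; apply: is_derive_eq; rewrite oppr0 expR0 /GRing.scale/=; field.
(* [G] is bounded, so its share dies out; the scaled double poles of x^-2 and pi^2/sinh^2 (pi x)
   cancel in the limit. *)
have lim3 : 4 ^- n * G (x / 2 ^+ n) - (x ^- 2 -
    pi ^+ 2 / (2 ^+ n * sinh (pi * x / 2 ^+ n)) ^+ 2) / 2 @[n --> \oo] -->
    0 - (x ^- 2 - pi ^+ 2 / (pi * x) ^+ 2) / 2.
  apply: cvgB => //; apply: cvgM; last exact: cvg_cst.
  apply: cvgB; first exact: cvg_cst.
  apply: cvgM; first exact: cvg_cst.
  by apply: cvgV; [rewrite expf_neq0// mulf_neq0 ?gt_eqF|apply: cvgM].
have lim4 : (fun _ : nat => D x) @ \oo --> D x by exact: cvg_cst.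
rewrite (_ : 0 - _ = 0) in lim3; last first.
  by move: (pi : R) pi0 => p p0; field; rewrite !gt_eqF.
suff lim5 : (fun _ : nat => D x) @ \oo --> (0 : R) by exact: cvg_unique lim4 lim5.
apply: cvg_trans lim3; apply: near_eq_cvg; apply: nearW => n; rewrite (Dn n x x0) /D [pi * (x / _)]mulrA.
have f2 : 0 < 2 ^+ n :> R by rewrite exprn_gt0.
have <- : (2 ^+ n) ^+ 2 = 4 ^+ n :> R by rewrite exprAC -natrX.
have : 0 < sinh (pi * x / 2 ^+ n) by rewrite sinh_gt0// divr_gt0// mulr_gt0.
move: (sinh (pi * x / 2 ^+ n)) => s s0; move: (G (x / 2 ^+ n)) => g.
move: (2 ^+ n : R) f2 (pi : R) => F F0 p.
by field; rewrite !gt_eqF.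
Qed.

(** Odd terms come from [sech2_fractions] at x, even ones from [csch2_fractions] at x/2; half-angle
    formulas merge the difference into cosh/sinh^2. *)
Lemma alternating_fractions x : 0 < x ->
  has_sum (fun l => rfrac x l.*2.+1 - rfrac x l.*2.+2)
    (pi ^+ 2 / 2 * (cosh (pi * x) / sinh (pi * x) ^+ 2) - (2 * x ^+ 2)^-1).
Proof.
move=> x0; have pi0 := pi_gt0 R.
have x20 : 0 < x / 2 by rewrite divr_gt0.
have h1 := sech2_fractions x.
have h2 := has_sumZ 4^-1 (csch2_fractions x20).
have := has_sumB h1 h2.
rewrite (_ : _ - _ = pi ^+ 2 / 2 * (cosh (pi * x) / sinh (pi * x) ^+ 2) - (2 * x ^+ 2)^-1).
  by apply: eq_has_sum => n; rewrite -doubleS rfrac_half [_ / 4]mulrC.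
have cd : cosh (pi * x) = 1 + 2 * sinh (pi * x / 2) ^+ 2.
  rewrite /cosh /sinh (_ : expR (pi * x) = expR (pi * x / 2) ^+ 2); last first.
    by rewrite -expRM_natl; congr expR; field.
  rewrite (_ : expR (- (pi * x)) = expR (- (pi * x / 2)) ^+ 2); last first.
    by rewrite -expRM_natl; congr expR; field.
  have := expRxMexpNx_1 (pi * x / 2); move: (expR _) (expR (- _)) => u v uv.
  transitivity (u * v + 2 * ((u - v) / 2) ^+ 2); [by field|by rewrite uv].
have h0 : 0 < sinh (pi * x / 2) by rewrite sinh_gt0// divr_gt0// mulr_gt0.
have -> : pi * (x / 2) = pi * x / 2 by rewrite mulrA.
move: (cosh2 (pi * x / 2)) (cosh_gt0 (pi * x / 2)) h0 (sinh_double (pi * x)) cd.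
move: (sinh (pi * x / 2)) (cosh (pi * x / 2)) (sinh (pi * x)) (cosh (pi * x)).
move=> s c S C c2 c0 s0 -> ->; rewrite !exprMn c2.
have c20 : 0 < 1 + s ^+ 2 by rewrite ltr_wpDr// sqr_ge0.
by move: (pi : R) => p; field; rewrite !gt_eqF.
Qed.

Lemma expR_gt_lt1 z : 0 < z -> `|expR (- z)| < 1.
Proof. by move=> z0; rewrite ger0_norm ?expR_ge0// expR_lt1 oppr_lt0. Qed.

(** With q = e^(-z) and 2 r + 1 = 2 (r + 1) - 1, the series combines the two geometric series in
    q^2. *)
Lemma csch2_lambert z : 0 < z ->
  has_sum (fun r => r.*2.+1%:R * expR (- (z * r.*2.+1%:R)))
    (cosh z / (2 * sinh z ^+ 2)).
Proof.
move=> z0; have q1 := expR_gt_lt1 z0; have s0 := sinh_gt0 z0.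
have q0 := expR_gt0 (- z).
have q21 : `|expR (- z) ^+ 2| < 1 by rewrite normrX exprn_ilt1.
have h1 := has_sumZ (2 * expR (- z)) (has_sum_geometric2 q21).
have h2 := has_sumZ (expR (- z)) (has_sum_geometric q21).
have := has_sumB h1 h2.
rewrite (_ : _ - _ = cosh z / (2 * sinh z ^+ 2)).
  apply: eq_has_sum => r.
  have -> : expR (- (z * r.*2.+1%:R)) = expR (- z) ^+ r.*2.+1.
    by rewrite -expRM_natr mulNr.
  rewrite [_ ^+ r.*2.+1]exprS -mul2n exprM.
  by rewrite -[(2 * r).+1%:R]natr1 natrM -[r.+1%:R]natr1; ring.
have s1 : expR (- z) ^+ 2 < 1 by move: q21; rewrite ger0_norm// sqr_ge0.
have E : expR z = (expR (- z))^-1 by rewrite -expRN opprK.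
move: s0; rewrite /cosh /sinh E; move: (expR (- z)) q0 s1 => q q0 s1 s0.
have h3 : 0 < 1 - q ^+ 2 by rewrite subr_gt0.
by field; rewrite mulNr -expr2 (gt_eqF q0) (gt_eqF h3).
Qed.

Lemma sech2_lambert z : 0 < z ->
  has_sum (fun b => (-1) ^+ b * b.+1%:R * expR (- (2 * z * b.+1%:R)))
    (4 * cosh z ^+ 2)^-1.
Proof.
move=> z0; have p1 : `|- (expR (- z) ^+ 2)| < 1.
  by rewrite normrN normrX exprn_ilt1// expR_gt_lt1.
have := has_sumZ (expR (- z) ^+ 2) (has_sum_geometric2 p1).
rewrite (_ : _ * _ = (4 * cosh z ^+ 2)^-1).
  apply: eq_has_sum => b.
  have -> : expR (- (2 * z * b.+1%:R)) = (expR (- z) ^+ 2) ^+ b.+1.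
    by rewrite -expRM_natl -expRM_natr; congr expR; ring.
  rewrite [_ ^+ b.+1]exprS [(- (expR (- z) ^+ 2)) ^+ b]exprNn.
  move: (expR (- z) ^+ 2) ((-1) ^+ b : R) => Q S; ring.
have E : expR z = (expR (- z))^-1 by rewrite -expRN opprK.
rewrite /cosh E; have := expR_gt0 (- z).
move: (expR _) => q q0.
have h3 : 0 < 1 + q ^+ 2 by rewrite ltr_wpDr// sqr_ge0.
by field; rewrite -expr2 (gt_eqF h3) (gt_eqF q0).
Qed.

End lambert_transformation.

(** * The paired double sum and its two evaluations *)

Section theta_transformation.
Context {R : realType}.
Implicit Types x y z : R.

(** With D = K^2 + x^2 a term is 2 K^2/D^2 - 1/D, so the difference is (1/D - 1/D') times a factor
    of modulus at most 1 + 4; the inequality 2 K (x + y) <= D' bounds the first factor by y/(K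
    D). *)
Lemma rfrac_diff_le x y k : 0 < x -> 0 < y ->
  `|rfrac (x + y) k.+1 - rfrac x k.+1| <=
  5 * y / (k.+1%:R * (k.+1%:R ^+ 2 + x ^+ 2)).
Proof.
move=> x0 y0; rewrite /rfrac.
have : 0 < k.+1%:R :> R by []. move: (k.+1%:R : R) => K K0.
have u0 : 0 < K ^+ 2 by rewrite exprn_gt0.
pose D := K ^+ 2 + x ^+ 2; pose D' := K ^+ 2 + (x + y) ^+ 2.
have D0 : 0 < D by rewrite /D ltr_pwDl// sqr_ge0.
have DD' : D <= D'.
  by rewrite /D /D' lerD2l lerXn2r ?nnegrE ?addr_ge0 ?(ltW x0) ?(ltW y0)// lerDl ltW.
have D'0 : 0 < D' by apply: lt_le_trans DD'.
have uD : K ^+ 2 <= D by rewrite lerDl sqr_ge0.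
have amgm : 2 * K * (x + y) <= D'.
  by have := sqr_ge0 (K - (x + y)); rewrite /D' sqrrB -mulr_natl; lra.
have -> : (K ^+ 2 - (x + y) ^+ 2) / (K ^+ 2 + (x + y) ^+ 2) ^+ 2 -
    (K ^+ 2 - x ^+ 2) / (K ^+ 2 + x ^+ 2) ^+ 2 =
    (D' - D) / (D * D') * (1 - 2 * K ^+ 2 * (D + D') / (D * D')).
  rewrite (_ : K ^+ 2 - (x + y) ^+ 2 = 2 * K ^+ 2 - D'); last by rewrite /D'; ring.
  rewrite (_ : K ^+ 2 - x ^+ 2 = 2 * K ^+ 2 - D); last by rewrite /D; ring.
  rewrite -/D -/D'; clearbody D D'.
  by field; rewrite !gt_eqF.
have b1 : (D' - D) / (D * D') <= y / (K * D).
  rewrite ler_pdivrMr ?mulr_gt0// [leRHS](_ : _ = y * D' / K); last first.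
    by clearbody D D'; field; rewrite !gt_eqF.
  rewrite ler_pdivlMr//; have -> : D' - D = y * (2 * x + y) by rewrite /D' /D; ring.
  rewrite -mulrA ler_pM2l//; have := mulr_gt0 y0 K0; lra.
have b0 : 0 <= (D' - D) / (D * D').
  by rewrite divr_ge0 ?subr_ge0// mulr_ge0// ltW.
have b2 : `|1 - 2 * K ^+ 2 * (D + D') / (D * D')| <= 5.
  have h1 : 2 * K ^+ 2 * (D + D') / (D * D') <= 4.
    rewrite ler_pdivrMr ?mulr_gt0//.
    have := ler_wpM2l (ltW D'0) uD; have := ler_pM (ltW u0) (ltW D0) uD DD'; lra.
  have h2 : 0 <= 2 * K ^+ 2 * (D + D') / (D * D').
    by apply/ltW/divr_gt0; rewrite !mulr_gt0// addr_gt0.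
  by rewrite ler_norml; apply/andP; split; lra.
rewrite normrM [`|_ / (D * D')|]ger0_norm//.
rewrite [leRHS](_ : _ = y / (K * D) * 5); last by rewrite [RHS]mulrC mulrA.
exact: ler_pM.
Qed.

(** The exponents 1/2 and 3/2 are chosen so that, together with the factor K of [rfrac_diff_le],
    both indices of the double sum get the summable exponent 3/2. *)
Lemma sqr_sum_ge K x : 0 < K -> 0 < x ->
  expR (2^-1 * ln K + 3 / 2 * ln x) <= K ^+ 2 + x ^+ 2.
Proof.
move=> K0 x0; have [Kx|/ltW xK] := leP K x.
  apply: (@le_trans _ _ (x ^+ 2)); last by rewrite lerDr sqr_ge0.
  rewrite -{2}(@lnK _ x)// -expRM_natl ler_expR.
  have : ln K <= ln x by rewrite ler_ln.
  lra.
apply: (@le_trans _ _ (K ^+ 2)); last by rewrite lerDl sqr_ge0.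
rewrite -{2}(@lnK _ K)// -expRM_natl ler_expR.
have : ln x <= ln K by rewrite ler_ln.
lra.
Qed.

Lemma rfrac_pair_bound y l k : 0 < y ->
  `|rfrac (l.*2.+2%:R * y) k.*2.+1 - rfrac (l.*2.+1%:R * y) k.*2.+1| <=
  5 * y * expR (- (3 / 2) * ln y) *
  (expR (- (3 / 2) * ln l.+1%:R) * expR (- (3 / 2) * ln k.+1%:R)).
Proof.
move=> y0; have -> : l.*2.+2%:R * y = l.*2.+1%:R * y + y by rewrite -[l.*2.+2%:R]natr1; ring.
have x0 : 0 < l.*2.+1%:R * y by rewrite mulr_gt0.
apply: le_trans (rfrac_diff_le _ x0 y0) _.
have K0 : 0 < k.*2.+1%:R :> R by [].
rewrite -[leRHS]mulrA ler_pM2l ?mulr_gt0//.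
apply: (@le_trans _ _ (expR (- ln k.*2.+1%:R -
    (2^-1 * ln k.*2.+1%:R + 3 / 2 * ln (l.*2.+1%:R * y))))).
  rewrite expRD !expRN lnK ?posrE// -invfM lef_pV2 ?posrE ?mulr_gt0 ?expR_gt0//.
    by rewrite ler_pM2l// sqr_sum_ge.
  by rewrite ltr_pwDl ?exprn_gt0// sqr_ge0.
rewrite -!expRD ler_expR lnM ?posrE//.
have h (m : nat) : ln m.+1%:R <= ln m.*2.+1%:R :> R.
  by rewrite ler_ln ?posrE// ler_nat ltnS -addnn leq_addr.
have := h k; have := h l; lra.
Qed.

Lemma lambert_transform y (T B : R) : 0 < y ->
  has_sum (fun p : nat * nat => (-1) ^+ (p.1.+1 + p.2.+1) * p.1.+1%:R *
    wexp (pi * y) (p.1.+1 * p.2.+1)) T ->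
  has_sum (fun p : nat * nat => (odd p.1.+1)%:R * (odd p.2.+1)%:R * p.1.+1%:R *
    wexp (pi / y) (p.1.+1 * p.2.+1)) B ->
  16 * B = y ^+ 2 * (1 - 8 * T).
Proof.
move=> y0 hT hB; have pi0 := pi_gt0 R.
have yn0 : y != 0 by rewrite gt_eqF.
have piy z : 0 < z -> 0 < pi * z by move=> z0; rewrite mulr_gt0.
pose e (p : nat * nat) := rfrac (p.1.*2.+2%:R * y) p.2.*2.+1
  - rfrac (p.1.*2.+1%:R * y) p.2.*2.+1.
have [S hS] : exists S, has_sum e S.
  have lt32 : (1 : R) < 3 / 2 by lra.
  have [z hz] := zeta_summable lt32.
  have c0 : 0 <= 5 * y * expR (- (3 / 2) * ln y).
    by rewrite mulr_ge0 ?expR_ge0// mulr_ge0// ltW.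
  exact: (has_sum_dom (fun p => rfrac_pair_bound p.1 p.2 y0)
    (nnsumZ c0 (nnsum_mul hz hz))).
(* [rfrac_scale] turns a row into an alternating sum at x = (2k+1)/y; the pole term of
   [alternating_fractions] becomes half of [rfrac 0], free of y. *)
have rows k : has_sum (fun l => e (l, k)) (y ^- 2 *
   (pi ^+ 2 * (cosh (pi / y * k.*2.+1%:R) / (2 * sinh (pi / y * k.*2.+1%:R) ^+ 2)))
   - 2^-1 * rfrac 0 k.*2.+1).
  have x0 : 0 < k.*2.+1%:R / y by rewrite divr_gt0.
  have := has_sumZ (y ^- 2) (alternating_fractions x0).
  rewrite (_ : y ^- 2 * (_ - _) = y ^- 2 *
   (pi ^+ 2 * (cosh (pi / y * k.*2.+1%:R) / (2 * sinh (pi / y * k.*2.+1%:R) ^+ 2)))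
   - 2^-1 * rfrac 0 k.*2.+1); last first.
    have -> : pi / y * k.*2.+1%:R = pi * (k.*2.+1%:R / y) by rewrite mulrAC mulrA.
    have := sinh_gt0 (piy _ x0).
    move: (sinh (pi * (k.*2.+1%:R / y))) (cosh (pi * (k.*2.+1%:R / y))) => s c s0.
    rewrite /rfrac; have : 0 < k.*2.+1%:R :> R by [].
    move: (k.*2.+1%:R : R) (pi : R) => K p K0.
    by field; rewrite !gt_eqF// ?addr0 ?exprn_gt0.
  apply: eq_has_sum => l.
  rewrite /e (rfrac_scale l.*2.+1 k.*2 yn0) (rfrac_scale l.*2 k.*2 yn0).
  move: (rfrac (k.*2.+1%:R / y) l.*2.+2) (rfrac (k.*2.+1%:R / y) l.*2.+1) => u v.
  ring.
have cols l : has_sum (fun k => e (l, k))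
    (pi ^+ 2 / 2 * ((4 * cosh (pi * y * l.*2.+2%:R / 2) ^+ 2)^-1
      - (4 * cosh (pi * y * l.*2.+1%:R / 2) ^+ 2)^-1)).
  have := has_sumB (sech2_fractions (l.*2.+2%:R * y)) (sech2_fractions (l.*2.+1%:R * y)).
  rewrite (_ : _ - _ = pi ^+ 2 / 2 * ((4 * cosh (pi * y * l.*2.+2%:R / 2) ^+ 2)^-1
      - (4 * cosh (pi * y * l.*2.+1%:R / 2) ^+ 2)^-1))//.
  have E (c : R) : pi * (c * y) / 2 = pi * y * c / 2 by ring.
  rewrite !E.
  have := cosh_gt0 (pi * y * l.*2.+2%:R / 2); have := cosh_gt0 (pi * y * l.*2.+1%:R / 2).
  move: (cosh (pi * y * l.*2.+1%:R / 2)) (cosh (pi * y * l.*2.+2%:R / 2)) => c d c0 d0.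
  by move: (pi : R) => p; field; rewrite !gt_eqF.
have hcols := has_sum_fubini cols hS.
have hrows := has_sum_fubini rows (has_sum_swap hS).
have ST : S = - (pi ^+ 2 / 2 * T).
  have [r hr rT] := has_sum_pair (has_sum_swap hT).
  have rE n : r n = (-1) ^+ n * (4 * cosh (pi * y * n.+1%:R / 2) ^+ 2)^-1.
    have z0 : 0 < pi * y * n.+1%:R / 2 by rewrite divr_gt0// !mulr_gt0.
    apply: has_sum_unique (hr n) _.
    apply: eq_has_sum (has_sumZ ((-1) ^+ n) (sech2_lambert z0)) => b /=.
    rewrite addSn addnS [(-1) ^+ _.+2]exprS exprS exprD /wexp natrM.
    rewrite (_ : 2 * _ * _ = pi * y * (b.+1%:R * n.+1%:R)); last by field.
    ring.
  apply: has_sum_unique hcols _.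
  have [s0 [s1 [h0 h1 TE]]] := has_sum_parity rT.
  rewrite TE -mulrN opprD.
  apply: eq_has_sum (has_sumZ (pi ^+ 2 / 2) (has_sumD (has_sumN h0) (has_sumN h1))) => l.
  rewrite !rE -[(-1) ^+ l.*2]signr_odd -[(-1) ^+ l.*2.+1]signr_odd /= odd_double.
  by rewrite expr0 expr1 mul1r mulN1r opprK addrC.
have hB2 : has_sum (fun k => cosh (pi / y * k.*2.+1%:R) /
    (2 * sinh (pi / y * k.*2.+1%:R) ^+ 2)) B.
  have [r hr rB] := has_sum_pair (has_sum_swap hB).
  have rodd l : r l.*2.+1 = 0.
    apply: has_sum_unique (hr _) _; apply: eq_has_sum (has_sum0 _) => k.
    by rewrite /= odd_double /= mulr0 !mul0r.
  apply: eq_has_sum (has_sum_evens rodd rB) => k.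
  have z0 : 0 < pi / y * k.*2.+1%:R by rewrite mulr_gt0// divr_gt0.
  have heven : forall l, (odd l.*2.+1.+1)%:R * (odd k.*2.+1)%:R * l.*2.+1.+1%:R *
    wexp (pi / y) (l.*2.+1.+1 * k.*2.+1) = 0.
    by move=> l; rewrite /= odd_double /= !mul0r.
  apply: has_sum_unique (has_sum_evens heven (hr k.*2)) _.
  apply: eq_has_sum (csch2_lambert z0) => l.
  by rewrite /= !odd_double /= !mul1r /wexp natrM; congr (_ * expR (- _)); ring.
(* At x = 0 this says that the 1/(2k+1)^2 sum to pi^2/8; it supplies the constant 1 beside 8 T. *)
have hpi := sech2_fractions (0 : R).
have cosh0 : cosh (pi * 0 / 2) = 1 :> R.
  by rewrite mulr0 mul0r /cosh oppr0 expR0; lra.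
rewrite cosh0 expr1n divr1 in hpi.
have := has_sumB (has_sumZ (y ^- 2) (has_sumZ (pi ^+ 2) hB2)) (has_sumZ 2^-1 hpi).
move/(has_sum_unique hrows); rewrite ST => E.
have p2 : 0 < (pi : R) ^+ 2 by rewrite exprn_gt0.
move: E p2; move: (pi ^+ 2) => P E P0.
have -> : 16 * B = y ^+ 2 / P * 16 * (y ^- 2 * (P * B)) by field; rewrite yn0 gt_eqF.
have -> : y ^- 2 * (P * B) = P / 16 - P / 2 * T by move: E; set Z := y ^- 2 * _; lra.
by field; rewrite gt_eqF.
Qed.

End theta_transformation.

(** * The bilateral Laplace transform *)

Section substitution.
Context {R : realType}.
Local Notation mu := (@lebesgue_measure R).

(** The formula on each compact [F(-n), F n] passes to the limit on both sides by monotone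
    convergence. *)
Lemma ge0_substitution (F F' G : R -> R) (D : set R) :
  {homo F : x y / x < y} -> (forall x : R, is_derive x 1 F (F' x)) ->
  continuous F' -> (forall x, 0 <= F' x) ->
  D = \bigcup_(n : nat) `[F (- n%:R), F n%:R]%classic ->
  (forall y, D y -> {for y, continuous G}) -> (forall y, 0 <= G y) ->
  (\int[mu]_(x in D) (G x)%:E = \int[mu]_x (G (F x) * F' x)%:E)%E.
Proof.
move=> ndF dF cF' F'0 DE cG G0.
have cF : continuous F.
  move=> x; apply: differentiable_continuous; apply/derivable1_diffP.
  by have [] := dF x.
have dFE : derive1 F = F' by apply/funext => x; rewrite derive1E; have [_ ->] := dF x.
pose I (n : nat) := `[F (- n%:R), F n%:R]%classic.
pose J (n : nat) := `[- n%:R, n%:R]%classic : set R.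
have nN (n : nat) : - n%:R <= n%:R :> R by rewrite (@le_trans _ _ 0)// oppr_le0.
have ndset (H : R -> R) : {homo H : x y / x <= y} ->
    nondecreasing_seq (fun n : nat => `[H (- n%:R), H n%:R]%classic).
  move=> hH m n mn; apply/subsetPset => x /=; rewrite !in_itv/= => /andP[h1 h2].
  apply/andP; split; first by apply: le_trans h1; rewrite hH// lerN2 ler_nat.
  by apply: (le_trans h2); rewrite hH// ler_nat.
have sub (n : nat) : `[F (- n%:R), F n%:R]%classic `<=` D by rewrite DE => x xn; exists n.
have homF : {homo F : x y / x <= y} by move=> u v; rewrite le_eqVlt => /predU1P[->//|/ndF/ltW].
have cGn (n : nat) : {within `[F (- n%:R), F n%:R], continuous G}.
  by apply: continuous_in_subspaceT => x; rewrite inE => xn; apply: cG; exact: (sub n).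
have cGF : continuous (fun x => G (F x) * F' x).
  move=> x; apply: cvgM; last exact: cF'.
  apply: continuous_comp; first exact: cF.
  apply: cG; rewrite DE; have [n xn] : exists n : nat, `|x| <= n%:R.
    by exists (Num.truncn `|x|).+1; apply/ltW/Num.Theory.truncnS_gt.
  exists n => //=; move: xn; rewrite ler_norml in_itv/= => /andP[h1 h2].
  by rewrite !homF.
have c1 : (fun n : nat => \int[mu]_(x in I n) (G x)%:E)%E @ \oo -->
    (\int[mu]_(x in D) (G x)%:E)%E.
  rewrite DE; apply: ge0_nondecreasing_set_cvg_integral => //.
  - exact: ndset.
  - by move=> n; exact: measurable_itv.
  - move=> n; apply/measurable_EFinP; apply: subspace_continuous_measurable_fun; [exact: measurable_itv|exact: cGn].
  - by move=> n x _; rewrite lee_fin.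
have c2 : (fun n : nat =>
      \int[mu]_(x in J n) (G (F x) * F' x)%:E)%E @ \oo -->
    (\int[mu]_x (G (F x) * F' x)%:E)%E.
  rewrite (_ : setT = \bigcup_(n : nat) `[- n%:R, n%:R]%classic); last first.
    apply/seteqP; split => // x _; exists (Num.truncn `|x|).+1 => //=.
    by rewrite in_itv/= -ler_norml; apply/ltW/Num.Theory.truncnS_gt.
  apply: ge0_nondecreasing_set_cvg_integral => //.
  - exact: (ndset id).
  - by move=> n; exact: measurable_itv.
  - move=> n; apply/measurable_EFinP; apply: measurable_funTS.
    exact: continuous_measurable_fun.
  - by move=> n x _; rewrite lee_fin mulr_ge0.
suff E (n : nat) : (\int[mu]_(x in I n) (G x)%:E =
    \int[mu]_(x in J n) (G (F x) * F' x)%:E)%E.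
  rewrite (funext E) in c1; exact: (cvg_unique _ c1 c2).
rewrite /I /J (integration_by_substitution_increasing (nN n)).
- by rewrite dFE.
- by move=> x y _ _; exact: ndF.
- by rewrite dFE => x _; exact: cF'.
- by rewrite dFE; apply/cvg_ex; exists (F' (- n%:R)); apply: cvg_at_right_filter; exact: cF'.
- by rewrite dFE; apply/cvg_ex; exists (F' n%:R); apply: cvg_at_left_filter; exact: cF'.
- split; [by move=> x _; have [] := dF x| |].
  + by apply: cvg_at_right_filter; exact: cF.
  + by apply: cvg_at_left_filter; exact: cF.
- exact: cGn.
Qed.

(** Positive and negative parts are treated separately in the extended reals; as maxima they remain
    continuous. *)
Lemma substitution (F F' G : R -> R) (D : set R) :
  {homo F : x y / x < y} -> (forall x : R, is_derive x 1 F (F' x)) ->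
  continuous F' -> (forall x, 0 <= F' x) ->
  D = \bigcup_(n : nat) `[F (- n%:R), F n%:R]%classic ->
  (forall y, D y -> {for y, continuous G}) ->
  \int[mu]_(x in D) G x = \int[mu]_x (G (F x) * F' x).
Proof.
move=> ndF dF cF' F'0 DE cG; rewrite /Rintegral; congr fine.
pose Gp y := Num.max (G y) 0; pose Gn y := Num.max (- G y) 0.
have cp : (\int[mu]_(x in D) (Gp x)%:E = \int[mu]_x (Gp (F x) * F' x)%:E)%E.
  apply: ge0_substitution => //; last by move=> y; rewrite le_max lexx orbT.
  move=> y Dy; apply: continuous_max; first exact: cG.
  exact: cvg_cst.
have cn : (\int[mu]_(x in D) (Gn x)%:E = \int[mu]_x (Gn (F x) * F' x)%:E)%E.
  apply: ge0_substitution => //; last by move=> y; rewrite le_max lexx orbT.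
  move=> y Dy; apply: continuous_max; last exact: cvg_cst.
  by apply: cvgN; exact: cG.
rewrite [LHS]integralE [RHS]integralE; congr (_ - _)%E.
- transitivity (\int[mu]_(x in D) (Gp x)%:E)%E.
    by apply: eq_integral => x _; rewrite funeposE -EFin_max.
  rewrite cp; apply: eq_integral => x _.
  by rewrite funeposE -EFin_max /Gp maxr_pMl// mul0r.
- transitivity (\int[mu]_(x in D) (Gn x)%:E)%E.
    by apply: eq_integral => x _; rewrite funenegE -EFinN -EFin_max.
  rewrite cn; apply: eq_integral => x _.
  by rewrite funenegE -EFinN -EFin_max /Gn maxr_pMl// mul0r mulNr.
Qed.

Lemma bigcup_affine (c d : R) : 0 < c ->
  [set: R] = \bigcup_(n : nat) `[c * - n%:R + d, c * n%:R + d]%classic.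
Proof.
move=> c0; apply/seteqP; split => // y _.
exists (Num.truncn (`|y - d| / c)).+1 => //=; rewrite in_itv/=.
have := Num.Theory.truncnS_gt (`|y - d| / c).
rewrite ltr_pdivrMr// mulrC ltr_norml => /andP[h1 h2].
by apply/andP; split; lra.
Qed.

Lemma bigcup_expR :
  [set` `]0%R, +oo[ : interval R] = \bigcup_(n : nat) `[expR (- n%:R), expR n%:R]%classic.
Proof.
apply/seteqP; split => [y|y [n _]] /=; rewrite !in_itv/= ?andbT.
  move=> y0; exists (Num.truncn `|ln y|).+1 => //=; rewrite in_itv/=.
  have := Num.Theory.truncnS_gt `|ln y|.
  rewrite ltr_norml => /andP[/ltW h1 /ltW h2].
  rewrite -(ler_expR (- _)) lnK// in h1; rewrite -(ler_expR (ln y)) lnK// in h2.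
  by rewrite h1 h2.
by move=> /andP[h _]; apply: lt_le_trans h; exact: expR_gt0.
Qed.

Lemma affine_derive (c d x : R) : is_derive x 1 (fun x => c * x + d) c.
Proof. by apply: is_derive_eq; rewrite /GRing.scale/=; ring. Qed.

Lemma affine_homo (c d : R) : 0 < c -> {homo (fun x => c * x + d) : x y / x < y}.
Proof. by move=> c0 x y; rewrite ltrD2r ltr_pM2l. Qed.

Lemma affine_substitution (c d : R) (G : R -> R) : 0 < c -> continuous G ->
  \int[mu]_x G x = \int[mu]_x (G (c * x + d) * c).
Proof.
move=> c0 cG.
apply: (@substitution (fun x => c * x + d) (fun=> c) G setT) => //.
- exact: affine_homo.
- by move=> x; exact: affine_derive.
- by move=> x; exact: cvg_cst.
- by move=> x; exact: ltW.
- exact: bigcup_affine.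
- by move=> y _; exact: cG.
Qed.

Lemma ge0_affine_substitution (c d : R) (G : R -> R) : 0 < c -> continuous G ->
  (forall x, 0 <= G x) ->
  (\int[mu]_x (G x)%:E = \int[mu]_x (G (c * x + d) * c)%:E)%E.
Proof.
move=> c0 cG G0.
apply: (@ge0_substitution (fun x => c * x + d) (fun=> c) G setT) => //.
- exact: affine_homo.
- by move=> x; exact: affine_derive.
- by move=> x; exact: cvg_cst.
- by move=> x; exact: ltW.
- exact: bigcup_affine.
- by move=> y _; exact: cG.
Qed.

Lemma expR_substitution (G : R -> R) :
  (forall y, 0 < y -> {for y, continuous G}) ->
  \int[mu]_(u in `]0, +oo[) G u = \int[mu]_v (G (expR v) * expR v).
Proof.
move=> cG; apply: substitution => //.
- by move=> x y; rewrite ltr_expR.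
- exact: continuous_expR.
- exact: bigcup_expR.
- by move=> y; rewrite /= in_itv/= andbT; exact: cG.
Qed.

End substitution.

(** * Real and imaginary parts of the complex exponential *)

Section complex_exponential.
Context {R : realType}.
Implicit Types (s t z : R[i]) (v w : R).

Definition expcos s v : R := expR (complex.Re s * v) * cos (complex.Im s * v).
Definition expsin s v : R := expR (complex.Re s * v) * sin (complex.Im s * v).
Definition cexp s v : R[i] := expcos s v +i* expsin s v.

Lemma cpowE x s : cpow x s = cexp s (ln x).
Proof. by rewrite /cpow /cexp; simpc. Qed.

Lemma ReD s t : complex.Re (s + t) = complex.Re s + complex.Re t.
Proof. by case: s t => [? ?] [? ?]. Qed.

Lemma ImD s t : complex.Im (s + t) = complex.Im s + complex.Im t.
Proof. by case: s t => [? ?] [? ?]. Qed.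

Lemma ReN s : complex.Re (- s) = - complex.Re s.
Proof. by case: s. Qed.

Lemma ImN s : complex.Im (- s) = - complex.Im s.
Proof. by case: s. Qed.

Lemma eqC s t : complex.Re s = complex.Re t -> complex.Im s = complex.Im t -> s = t.
Proof. by case: s t => [? ?] [? ?] /= -> ->. Qed.

Lemma ReM s t : complex.Re (s * t) =
  complex.Re s * complex.Re t - complex.Im s * complex.Im t.
Proof. by case: s t => [? ?] [? ?]. Qed.

Lemma ImM s t : complex.Im (s * t) =
  complex.Re s * complex.Im t + complex.Im s * complex.Re t.
Proof. by case: s t => [? ?] [? ?]. Qed.

Lemma expcosDr s v w :
  expcos s (v + w) = expcos s v * expcos s w - expsin s v * expsin s w.
Proof. by rewrite /expcos /expsin !mulrDr expRD cosD; ring. Qed.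

Lemma expsinDr s v w :
  expsin s (v + w) = expcos s v * expsin s w + expsin s v * expcos s w.
Proof. by rewrite /expcos /expsin !mulrDr expRD sinD; ring. Qed.

Lemma cexpDr s v w : cexp s (v + w) = cexp s v * cexp s w.
Proof. by apply: eqC; rewrite ?ReM ?ImM /= ?expcosDr ?expsinDr. Qed.

Lemma cexpDl s t v : cexp (s + t) v = cexp s v * cexp t v.
Proof.
apply: eqC; rewrite ?ReM ?ImM /= /expcos /expsin ReD ImD !mulrDl expRD ?cosD ?sinD;
  ring.
Qed.

Lemma cexp0l v : cexp 0 v = 1.
Proof. by apply: eqC; rewrite /= /expcos /expsin !mul0r expR0 ?cos0 ?sin0 !mul1r. Qed.

Lemma cexpNl s v : cexp (- s) v = (cexp s v)^-1.
Proof.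
have h : cexp s v * cexp (- s) v = 1 by rewrite -cexpDl subrr cexp0l.
have h0 : cexp s v != 0.
  by apply/eqP => h0; move: h; rewrite h0 mul0r => /esym/eqP; rewrite oner_eq0.
by apply: (mulfI h0); rewrite h divff.
Qed.

Lemma cexp_neq0 s v : cexp s v != 0.
Proof.
apply/eqP => h0; have : cexp s v * cexp (- s) v = 1 by rewrite -cexpDl subrr cexp0l.
by rewrite h0 mul0r => /esym/eqP; rewrite oner_eq0.
Qed.

Lemma norm_expcos_le s v : `|expcos s v| <= expR (complex.Re s * v).
Proof. by rewrite normrM ger0_norm ?expR_ge0// ler_piMr ?expR_ge0// cos_max. Qed.

Lemma norm_expsin_le s v : `|expsin s v| <= expR (complex.Re s * v).
Proof. by rewrite normrM ger0_norm ?expR_ge0// ler_piMr ?expR_ge0// sin_max. Qed.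

Lemma continuous_linear (c : R) : continuous (fun v : R => c * v).
Proof. by move=> v; apply: cvgM => //; exact: cvg_cst. Qed.

Lemma continuous_expcos s : continuous (expcos s).
Proof.
move=> v; apply: cvgM.
  by apply: continuous_comp; [exact: continuous_linear|exact: continuous_expR].
by apply: continuous_comp; [exact: continuous_linear|exact: continuous_cos].
Qed.

Lemma continuous_expsin s : continuous (expsin s).
Proof.
move=> v; apply: cvgM.
  by apply: continuous_comp; [exact: continuous_linear|exact: continuous_expR].
by apply: continuous_comp; [exact: continuous_linear|exact: continuous_sin].
Qed.

Lemma norm_le_ReIm z (r : R) :
  `|complex.Re z| + `|complex.Im z| <= r -> `|z| <= r%:C.
Proof.
move=> h; apply: le_trans (_ : (`|complex.Re z| + `|complex.Im z|)%:C <= _); last first.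
  by rewrite lecR.
case: z h => a b _ /=; rewrite normc_def lecR /=.
rewrite -(@ler_pXn2r _ 2)// ?nnegrE ?addr_ge0// ?sqrtr_ge0//.
rewrite sqr_sqrtr ?addr_ge0 ?sqr_ge0// sqrrD -[a ^+ 2]real_normK ?num_real//.
rewrite -[b ^+ 2]real_normK ?num_real// -addrA lerD2l lerDr.
by rewrite mulrn_wge0// mulr_ge0.
Qed.

Lemma cvg_complex (u : nat -> R[i]) (l : R[i]) :
  (fun n => complex.Re (u n)) @ \oo --> complex.Re l ->
  (fun n => complex.Im (u n)) @ \oo --> complex.Im l ->
  (u : nat -> R[i]^o) @ \oo --> (l : R[i]^o).
Proof.
move=> /cvgrPdist_le hr /cvgrPdist_le hi; apply/cvgrPdist_le => /= e e0.
(* Positivity in [R[i]] forces e to be real, so the estimate can be made with its real part. *)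
have e0' : 0 < complex.Re e by move: e0; rewrite ltcE /= => /andP[].
have eE : (complex.Re e)%:C = e by apply: RRe_real; exact: gtr0_real.
have e2 : 0 < complex.Re e / 2 by rewrite divr_gt0.
near=> n; rewrite -eE; apply: norm_le_ReIm.
rewrite !(ReD, ImD, ReN, ImN) (splitr (complex.Re e)); apply: lerD.
  by near: n; exact: hr.
by near: n; exact: hi.
Unshelve. all: by end_near. Qed.

Lemma Re_series (u : nat -> R[i]) n :
  complex.Re (series u n) = series (fun k => complex.Re (u k)) n.
Proof.
rewrite /series/=; elim: n => [|n ih]; first by rewrite !big_geq.
by rewrite !big_nat_recr//= ReD ih.
Qed.

Lemma Im_series (u : nat -> R[i]) n :
  complex.Im (series u n) = series (fun k => complex.Im (u k)) n.
Proof.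
rewrite /series/=; elim: n => [|n ih]; first by rewrite !big_geq.
by rewrite !big_nat_recr//= ImD ih.
Qed.

End complex_exponential.

(** * The transform and dominated convergence *)

Section laplace.
Context {R : realType}.
Local Notation mu := (@lebesgue_measure R).
Implicit Types (s : R[i]) (f g : R -> R) (c : R).

(** The integral of f(v) e^(s v) dv over the line, that is, the Mellin transform in the variable
    e^v, assembled from two real integrals. *)
Definition laplace f s : R[i] :=
  (\int[mu]_v (f v * expcos s v)) +i* (\int[mu]_v (f v * expsin s v)).

(** Absolute convergence of [laplace f] on the line Re s = c, both real kernels being bounded by
    e^(c v). *)
Definition expintegrable c f : Prop := measurable_fun setT f /\
  mu.-integrable setT (EFin \o (fun v => f v * expR (c * v))).

Lemma measurable_expR_linear c : measurable_fun setT (fun v : R => expR (c * v)).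
Proof.
apply: continuous_measurable_fun => v.
by apply: continuous_comp; [exact: continuous_linear|exact: continuous_expR].
Qed.

Lemma integrable_kernel c f (k : R -> R) : measurable_fun setT k ->
  (forall v, `|k v| <= expR (c * v)) -> expintegrable c f ->
  mu.-integrable setT (EFin \o (fun v => f v * k v)).
Proof.
move=> mk kc [mf fi]; apply: le_integrable fi => //.
  by apply/measurable_EFinP; exact: measurable_funM.
move=> v _ /=; rewrite lee_fin !normrM ler_wpM2l// [leRHS]ger0_norm ?expR_ge0//.
Qed.

Lemma integrable_expcos s f : expintegrable (complex.Re s) f ->
  mu.-integrable setT (EFin \o (fun v => f v * expcos s v)).
Proof.
apply: integrable_kernel; last exact: norm_expcos_le.
by apply: continuous_measurable_fun; exact: continuous_expcos.
Qed.

Lemma integrable_expsin s f : expintegrable (complex.Re s) f ->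
  mu.-integrable setT (EFin \o (fun v => f v * expsin s v)).
Proof.
apply: integrable_kernel; last exact: norm_expsin_le.
by apply: continuous_measurable_fun; exact: continuous_expsin.
Qed.

Lemma expintegrableD c f g : expintegrable c f -> expintegrable c g ->
  expintegrable c (fun v => f v + g v).
Proof.
move=> [mf fi] [mg gi]; split; first exact: measurable_funD.
have := integrableD measurableT fi gi; congr (integrable _ _ _).
by apply/funext => v /=; rewrite mulrDl EFinD.
Qed.

Lemma expintegrableZ c (k : R) f : expintegrable c f ->
  expintegrable c (fun v => k * f v).
Proof.
move=> [mf fi]; split; first exact: measurable_funM.
have := integrableZl measurableT k fi; congr (integrable _ _ _).
by apply/funext => v /=; rewrite -mulrA EFinM.
Qed.

Lemma expintegrable0 c : expintegrable c (fun _ => 0).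
Proof.
split; first exact: measurable_cst.
have := @integrable0 _ _ _ mu setT; congr (integrable _ _ _).
by apply/funext => v /=; rewrite mul0r.
Qed.

Lemma expintegrable_sum c (I : Type) (r : seq I) (F : I -> R -> R) :
  (forall i, expintegrable c (F i)) ->
  expintegrable c (fun v => \sum_(i <- r) F i v).
Proof.
move=> hF; elim: r => [|i r ih].
  by under eq_fun do rewrite big_nil; exact: expintegrable0.
by under eq_fun do rewrite big_cons; exact: expintegrableD.
Qed.

Lemma laplaceD f g s : expintegrable (complex.Re s) f ->
  expintegrable (complex.Re s) g ->
  laplace (fun v => f v + g v) s = laplace f s + laplace g s.
Proof.
move=> fi gi; apply: eqC; rewrite ?ReD ?ImD /=.
  under eq_Rintegral do rewrite mulrDl.
  by rewrite RintegralD//; exact: integrable_expcos.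
under eq_Rintegral do rewrite mulrDl.
by rewrite RintegralD//; exact: integrable_expsin.
Qed.

Lemma laplaceZ (k : R) f s : expintegrable (complex.Re s) f ->
  laplace (fun v => k * f v) s = k%:C * laplace f s.
Proof.
move=> fi; apply: eqC; rewrite ?ReM ?ImM /= mul0r ?subr0 ?addr0.
  under eq_Rintegral do rewrite -mulrA.
  by rewrite RintegralZl//; exact: integrable_expcos.
under eq_Rintegral do rewrite -mulrA.
by rewrite RintegralZl//; exact: integrable_expsin.
Qed.

Lemma laplace0 s : laplace (fun _ => 0) s = 0.
Proof.
by apply: eqC => /=; under eq_Rintegral do rewrite mul0r;
  rewrite /Rintegral integral0.
Qed.

Lemma laplace_sum (I : Type) (r : seq I) (F : I -> R -> R) s :
  (forall i, expintegrable (complex.Re s) (F i)) ->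
  laplace (fun v => \sum_(i <- r) F i v) s = \sum_(i <- r) laplace (F i) s.
Proof.
move=> hF; elim: r => [|i r ih].
  by under eq_fun do rewrite big_nil; rewrite laplace0 big_nil.
under eq_fun do rewrite big_cons.
by rewrite laplaceD ?big_cons ?ih//; exact: expintegrable_sum.
Qed.

(** The kernel is general because three are needed: the two parts of e^(s v), and e^(Re s v), which
    makes the limit [expintegrable]. *)
Lemma dominated_kernel c (k : R -> R) (S : nat -> R -> R) (F g : R -> R) :
  measurable_fun setT k -> (forall v, `|k v| <= expR (c * v)) ->
  (forall n, measurable_fun setT (S n)) -> expintegrable c g ->
  (forall v n, `|S n v| <= g v) -> (forall v, S ^~ v @ \oo --> F v) ->
  mu.-integrable setT (EFin \o (fun v => F v * k v)) /\
  (\int[mu]_v (S n v * k v)) @[n --> \oo] --> \int[mu]_v (F v * k v).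
Proof.
move=> mk kc mS [mg gi] Sg SF.
have mF : measurable_fun setT F by apply: (measurable_fun_cvg (h := S)) => // x _; exact: SF.
have [|||||h1 _ h2] := @dominated_convergence _ _ R mu setT measurableT
  (fun n v => (S n v * k v)%:E) (fun v => (F v * k v)%:E)
  (fun v => (g v * expR (c * v))%:E).
- by move=> n; apply/measurable_EFinP; apply: (measurable_funM (mS n) mk).
- by apply/measurable_EFinP; exact: measurable_funM.
- apply: aeW => v _; apply/fine_cvgP; split; first exact: nearW.
  by apply: cvgM; [exact: SF|exact: cvg_cst].
- exact: gi.
- apply: aeW => v n _; rewrite lee_fin normrM; apply: ler_pM => //; exact: Sg.
split; first exact: h1.
have E : (\int[mu]_v (F v * k v)%:E)%E = (\int[mu]_v (F v * k v))%:E.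
  by rewrite /Rintegral fineK//; exact: integrable_fin_num.
by rewrite E in h2; move/fine_cvg: h2.
Qed.

Lemma laplace_series (f : nat -> R -> R) (F g : R -> R) s :
  (forall n, expintegrable (complex.Re s) (f n)) ->
  expintegrable (complex.Re s) g ->
  (forall v n, `|\sum_(i < n) f i v| <= g v) ->
  (forall v, series (fun n => f n v) @ \oo --> F v) ->
  expintegrable (complex.Re s) F /\
  (series (fun n => laplace (f n) s) : nat -> R[i]^o) @ \oo --> (laplace F s : R[i]^o).
Proof.
move=> fi gi fg fF.
pose S n v := \sum_(0 <= i < n) f i v.
have mS n : measurable_fun setT (S n).
  by have [] := @expintegrable_sum (complex.Re s) _ (index_iota 0 n) _ fi.
have Sg v n : `|S n v| <= g v by rewrite /S big_mkord.
have SF v : S ^~ v @ \oo --> F v by exact: fF.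
have mc : measurable_fun setT (expcos s).
  by apply: continuous_measurable_fun; exact: continuous_expcos.
have ms : measurable_fun setT (expsin s).
  by apply: continuous_measurable_fun; exact: continuous_expsin.
have [_ h1] := dominated_kernel mc (norm_expcos_le s) mS gi Sg SF.
have [_ h2] := dominated_kernel ms (norm_expsin_le s) mS gi Sg SF.
have hexp v : `|expR (complex.Re s * v)| <= expR (complex.Re s * v).
  by rewrite ger0_norm// expR_ge0.
have [h3 _] := dominated_kernel (measurable_expR_linear _) hexp mS gi Sg SF.
split.
  by split; [apply: (measurable_fun_cvg (h := S)) => // x _; exact: SF|exact: h3].
have E n : series (fun n => laplace (f n) s) n = laplace (S n) s.
  by rewrite /series/= -laplace_sum.
by apply: cvg_complex; under eq_fun do rewrite E.
Qed.

End laplace.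

(** * Gamma and Bessel kernels *)

Section gamma_kernel.
Context {R : realType}.
Local Notation mu := (@lebesgue_measure R).
Implicit Types (s : R[i]) (f g : R -> R) (c d : R).

Lemma continuous_expRN : continuous (fun v : R => expR (- v)).
Proof.
move=> v; apply: (@continuous_comp _ _ _ (fun v : R => - v) expR).
  by apply: cvgN; exact: cvg_id.
exact: continuous_expR.
Qed.

(** Under u = e^v this is the integral of 1/(1 + u^2) over the half-line. The integrand is the
    majorant used in [expintegrable_bound]. *)
Lemma integral_sech :
  (\int[mu]_v ((expR v + expR (- v))^-1)%:E < +oo)%E.
Proof.
have cG (y : R) : {for y, continuous (fun u : R => (1 + u ^+ 2)^-1)}.
  apply: cvgV; first by rewrite gt_eqF// ltr_pwDl// sqr_ge0.
  by apply: cvgD; [exact: cvg_cst|exact: exprn_continuous].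
have E : (\int[mu]_(x in `]0%R, +oo[) ((1 + x ^+ 2)^-1)%:E =
    \int[mu]_v ((expR v + expR (- v))^-1)%:E)%E.
  rewrite (@ge0_substitution R expR expR (fun u => (1 + u ^+ 2)^-1))//.
  - apply: eq_integral => v _; congr EFin; rewrite expRN.
    have := expR_gt0 v; move: (expR v) => x x0.
    have h : 0 < x ^+ 2 + 1 by rewrite ltr_wpDl// sqr_ge0.
    by field; rewrite -expr2 !gt_eqF.
  - by move=> x y; rewrite ltr_expR.
  - exact: continuous_expR.
  - exact: bigcup_expR.
  - by move=> y; rewrite invr_ge0 addr_ge0// sqr_ge0.
rewrite -E.
apply: (@le_lt_trans _ _ (\int[mu]_(x in `[0%R, +oo[) ((1 + x ^+ 2)^-1)%:E)%E).
  apply: ge0_subset_integral => //=.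
  - apply/measurable_EFinP; apply: measurable_funTS.
    by apply: continuous_measurable_fun => y; exact: cG.
  - by move=> x _; rewrite lee_fin invr_ge0 addr_ge0// sqr_ge0.
  - by move=> x; rewrite /= !in_itv/= !andbT => /ltW.
by have := @integral0y_oneDsqr R; rewrite /oneDsqr => ->; rewrite ltry.
Qed.

(** Adding the two bounds gives |f| e^(c v) <= 2 C / (e^(d v) + e^(-d v)). *)
Lemma expintegrable_bound c d (C : R) f : 0 < d -> measurable_fun setT f ->
  (forall v, `|f v| * expR ((c + d) * v) <= C) ->
  (forall v, `|f v| * expR ((c - d) * v) <= C) -> expintegrable c f.
Proof.
move=> d0 mf h1 h2; split=> //.
pose G (v : R) := (expR v + expR (- v))^-1.
have G0 v : 0 < G v by rewrite invr_gt0 addr_gt0 ?expR_gt0.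
have cG : continuous G.
  move=> v; apply: cvgV; first by rewrite gt_eqF// addr_gt0 ?expR_gt0.
  apply: cvgD; first exact: continuous_expR.
  exact: continuous_expRN.
have cGd : continuous (fun v => G (d * v + 0) * d).
  move=> v; apply: cvgM; last exact: cvg_cst.
  apply: (@continuous_comp _ _ _ (fun v => d * v + 0) G); last exact: cG.
  by apply: cvgD; [exact: continuous_linear|exact: cvg_cst].
have iG : mu.-integrable setT (EFin \o (fun v => 2 * C / d * (G (d * v + 0) * d))).
  have iG' : mu.-integrable setT (EFin \o (fun v => G (d * v + 0) * d)).
    apply/integrableP; split.
      by apply/measurable_EFinP; exact: continuous_measurable_fun.
    have E : (\int[mu]_v `|(G (d * v + 0) * d)%:E| = \int[mu]_v (G v)%:E)%E.
      rewrite (@ge0_affine_substitution _ d 0 G)//; last by move=> v; exact: ltW.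
      by apply: eq_integral => v _ /=; rewrite ger0_norm// mulr_ge0// ltW.
    by rewrite /comp E; exact: integral_sech.
  by apply: eq_integrable (integrableZl measurableT (2 * C / d) iG').
have C0 : 0 <= C by apply: le_trans (h1 0); rewrite mulr_ge0// expR_ge0.
apply: le_integrable iG => //.
  by apply/measurable_EFinP; apply: measurable_funM => //; exact: measurable_expR_linear.
move=> v _ /=; rewrite lee_fin normrM [`|expR _|]ger0_norm ?expR_ge0//.
rewrite [leRHS]ger0_norm; last first.
  by rewrite mulr_ge0 ?divr_ge0 ?mulr_ge0// ltW// mulr_gt0.
rewrite addr0 [leRHS](_ : _ = 2 * C * G (d * v)); last first.
  by move: (G _) => u; field; rewrite gt_eqF.
rewrite /G ler_pdivlMr ?addr_gt0 ?expR_gt0// -mulrA mulrDr -!expRD mulrDr.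
have -> : c * v + d * v = (c + d) * v by ring.
have -> : c * v + - (d * v) = (c - d) * v by ring.
by rewrite mulr_natl mulr2n lerD.
Qed.

Lemma expR_kernel_bound c (k : R) : 0 < c -> 0 <= k ->
  exists C, forall v, expR (- (c * expR v)) * expR (k * v) <= C.
Proof.
move=> c0 k0; pose K := (Num.truncn k).+1.
have kK : k <= K%:R by apply/ltW/Num.Theory.truncnS_gt.
have cK : 0 < c ^+ K by rewrite exprn_gt0.
exists (1 + K`!%:R / c ^+ K) => v.
have C0 : 0 <= K`!%:R / c ^+ K by rewrite divr_ge0// ltW.
have [v0|v0] := leP 0 v.
  apply: (@le_trans _ _ (K`!%:R / c ^+ K)); last by rewrite lerDr.
  apply: (@le_trans _ _ (K`!%:R / (c * expR v) ^+ K * expR (K%:R * v))).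
    apply: ler_pM; rewrite ?expR_ge0 ?ler_expR//.
      by apply: expR_le_pow; rewrite mulr_gt0// expR_gt0.
    by rewrite ler_wpM2r.
  by rewrite expRM_natl exprMn invfM -!mulrA mulVf ?mulr1// expf_neq0// gt_eqF// expR_gt0.
apply: (@le_trans _ _ (1 * 1)); last by rewrite mulr1 lerDl.
apply: ler_pM; rewrite ?expR_ge0// -expR0 ler_expR.
  by rewrite oppr_le0 mulr_ge0 ?expR_ge0// ltW.
by rewrite mulr_ge0_le0// ltW.
Qed.

(** Euler's factor e^(-c u) at u = e^v; in this variable scaling c becomes a translation. *)
Definition gamma_kernel c (v : R) : R := expR (- (c * expR v)).

Lemma continuous_gamma_kernel c : continuous (gamma_kernel c).
Proof.
move=> v; rewrite /gamma_kernel.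
apply: (@continuous_comp _ _ _ (fun v => - (c * expR v)) expR).
  by apply: cvgN; apply: cvgM; [exact: cvg_cst|exact: continuous_expR].
exact: continuous_expR.
Qed.

Lemma expintegrable_gamma_kernel c d : 0 < c -> 0 < d ->
  expintegrable d (gamma_kernel c).
Proof.
move=> c0 d0; have [C hC] := @expR_kernel_bound c (d + d) c0 (ltW (addr_gt0 d0 d0)).
apply: (@expintegrable_bound d d (Num.max C 1)) => //.
- by apply: continuous_measurable_fun; exact: continuous_gamma_kernel.
- by move=> v; rewrite ger0_norm ?expR_ge0// le_max hC.
- move=> v; rewrite subrr mul0r expR0 mulr1 ger0_norm ?expR_ge0// le_max.
  by apply/orP; right; rewrite -expR0 ler_expR oppr_le0 mulr_ge0 ?expR_ge0// ltW.
Qed.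

(** For c = pi n and d = pi m this is q^n at y = e^v times q^m at 1/y; equal parameters give the
    Bessel integrand. *)
Definition bessel_kernel c d (v : R) : R :=
  expR (- (c * expR v + d * expR (- v))).

Lemma continuous_bessel_kernel c d : continuous (bessel_kernel c d).
Proof.
move=> v; rewrite /bessel_kernel.
apply: (@continuous_comp _ _ _ (fun v => - (c * expR v + d * expR (- v))) expR);
  last exact: continuous_expR.
apply: cvgN; apply: cvgD; apply: cvgM; try exact: cvg_cst.
  exact: continuous_expR.
exact: continuous_expRN.
Qed.

Lemma expintegrable_bessel_kernel c d (x : R) : 0 < c -> 0 < d ->
  expintegrable x (bessel_kernel c d).
Proof.
move=> c0 d0.
have bound (k : R) : exists C, forall v, `|bessel_kernel c d v| * expR (k * v) <= C.
  have [k0|k0] := leP 0 k.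
    have [C hC] := expR_kernel_bound c0 k0; exists C => v.
    apply: le_trans (hC v); rewrite ger0_norm ?expR_ge0// ler_wpM2r ?expR_ge0//.
    by rewrite ler_expR lerN2 lerDl mulr_ge0 ?expR_ge0// ltW.
  (* For negative exponents the reflection v -> -v lets the term in e^(-v) provide the decay. *)
  have k0' : 0 <= - k by rewrite oppr_ge0 ltW.
  have [C hC] := expR_kernel_bound d0 k0'; exists C => v.
  apply: le_trans (hC (- v)); rewrite mulrNN ger0_norm ?expR_ge0//.
  rewrite ler_wpM2r ?expR_ge0//.
  by rewrite ler_expR lerN2 lerDr mulr_ge0 ?expR_ge0// ltW.
have [C1 h1] := bound (x + 1); have [C2 h2] := bound (x - 1).
apply: (@expintegrable_bound x 1 (Num.max C1 C2)) => //.
- by apply: continuous_measurable_fun; exact: continuous_bessel_kernel.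
- by move=> v; rewrite le_max h1.
- by move=> v; rewrite le_max h2 orbT.
Qed.

Lemma laplace_translate f (a : R) s : continuous f ->
  expintegrable (complex.Re s) f ->
  laplace (fun v => f (v + a)) s = cexp s (- a) * laplace f s.
Proof.
move=> cf fi.
have sub (k : R -> R) : continuous k ->
    \int[mu]_v (f (v + a) * k v) = \int[mu]_v (f v * k (v - a)).
  move=> ck; rewrite [RHS](@affine_substitution _ 1 a)//.
    by apply: eq_Rintegral => v _; rewrite mul1r addrK mulr1.
  move=> v; apply: cvgM; first exact: cf.
  apply: (@continuous_comp _ _ _ (fun v => v - a) k); last exact: ck.
  by apply: cvgD => //; exact: cvg_cst.
have ic := integrable_expcos fi; have is_ := integrable_expsin fi.
have Z (r : R) (h : R -> R) : mu.-integrable setT (EFin \o h) ->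
    mu.-integrable setT (EFin \o (fun v => r * h v)).
  by move=> ih; apply: eq_integrable (integrableZl measurableT r ih).
apply: eqC; rewrite ?ReM ?ImM /=.
  rewrite (sub _ (@continuous_expcos _ s)).
  rewrite (@eq_Rintegral _ _ _ mu setT (fun v => expcos s (- a) * (f v * expcos s v) +
    - expsin s (- a) * (f v * expsin s v))).
    by rewrite RintegralD ?RintegralZl// ?mulNr//; exact: Z.
  by move=> v _; rewrite expcosDr; ring.
rewrite (sub _ (@continuous_expsin _ s)).
rewrite (@eq_Rintegral _ _ _ mu setT (fun v => expcos s (- a) * (f v * expsin s v) +
    expsin s (- a) * (f v * expcos s v))).
  by rewrite RintegralD ?RintegralZl//; exact: Z.
by move=> v _; rewrite expsinDr; ring.
Qed.

Lemma laplace_half f s : continuous f ->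
  expintegrable (complex.Re s) (fun v => f (2 * v)) ->
  laplace f (s / 2) = 2 * laplace (fun v => f (2 * v)) s.
Proof.
move=> cf fi.
have Re2 : complex.Re (s / 2) * 2 = complex.Re s.
  by rewrite mulr_natr mulr2n -ReD -splitr.
have Im2 : complex.Im (s / 2) * 2 = complex.Im s.
  by rewrite mulr_natr mulr2n -ImD -splitr.
have -> : 2 * laplace (fun v => f (2 * v)) s =
    2%:C * laplace (fun v => f (2 * v)) s by rewrite rmorph_nat.
apply: eqC; rewrite ?ReM ?ImM /= mul0r ?subr0 ?addr0.
  rewrite (@affine_substitution _ 2 0)//; last first.
    by move=> v; apply: cvgM; [exact: cf|exact: continuous_expcos].
  rewrite -RintegralZl//; last exact: integrable_expcos.
  apply: eq_Rintegral => v _; rewrite addr0 /expcos !mulrA Re2 Im2; ring.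
rewrite (@affine_substitution _ 2 0)//; last first.
  by move=> v; apply: cvgM; [exact: cf|exact: continuous_expsin].
rewrite -RintegralZl//; last exact: integrable_expsin.
apply: eq_Rintegral => v _; rewrite addr0 /expsin !mulrA Re2 Im2; ring.
Qed.

Lemma laplace_expR f (k : R) s :
  laplace (fun v => expR (k * v) * f v) s = laplace f (s + k%:C).
Proof.
by apply: eqC => /=; apply: eq_Rintegral => v _;
  rewrite /expcos /expsin ReD ImD /= addr0 mulrDl expRD; ring.
Qed.

Lemma expintegrable_expR f (k c : R) : expintegrable (c + k) f ->
  expintegrable c (fun v => expR (k * v) * f v).
Proof.
move=> [mf fi]; split; first by apply: measurable_funM => //; exact: measurable_expR_linear.
move: fi; congr (integrable _ _ _); apply/funext => v /=.
by rewrite mulrDl expRD; congr EFin; ring.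
Qed.

(** Under u = e^v the Jacobian e^v absorbs the -1 of the exponent s - 1. *)
Lemma cintegral_laplace f s :
  (forall y, 0 < y -> {for y, continuous f}) ->
  cintegral `]0, +oo[%classic (fun u => cpow u (s - 1) * (f u)%:C) =
  laplace (f \o expR) s.
Proof.
move=> cf.
have cln (k : R -> R) (y : R) : continuous k -> 0 < y -> {for y, continuous (fun u : R => k (ln u) * f u)}.
  move=> ck y0; apply: cvgM; last exact: cf.
  by apply: (@continuous_comp _ _ _ (@ln R) k); [exact: continuous_ln|exact: ck].
rewrite /cintegral /laplace; congr (_ +i* _).
  rewrite (@eq_Rintegral _ _ _ mu _ (fun u => expcos (s - 1) (ln u) * f u)); last first.
    by move=> u _; rewrite cpowE ReM [X in _ - X](_ : _ = 0) ?subr0// mulr0.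
  rewrite expR_substitution; last first.
    by move=> y y0; apply: cln => //; exact: continuous_expcos.
  apply: eq_Rintegral => v _; rewrite expRK /expcos ReD ImD /= oppr0 addr0.
  by rewrite mulrBl mul1r expRB mulrAC mulrC; congr (_ * _); rewrite mulrAC divfK// gt_eqF// expR_gt0.
rewrite (@eq_Rintegral _ _ _ mu _ (fun u => expsin (s - 1) (ln u) * f u)); last first.
  by move=> u _; rewrite cpowE ImM [X in X + _](_ : _ = 0) ?add0r// mulr0.
rewrite expR_substitution; last first.
  by move=> y y0; apply: cln => //; exact: continuous_expsin.
apply: eq_Rintegral => v _; rewrite expRK /expsin ReD ImD /= oppr0 addr0.
by rewrite mulrBl mul1r expRB mulrAC mulrC; congr (_ * _); rewrite mulrAC divfK// gt_eqF// expR_gt0.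
Qed.

Lemma Gamma_laplace s : Gamma s = laplace (gamma_kernel 1) s.
Proof.
rewrite /Gamma (@cintegral_laplace (fun u => expR (- u))).
  suff -> : (fun u : R => expR (- u)) \o expR = gamma_kernel 1 by [].
  by apply/funext => v; rewrite /gamma_kernel /= mul1r.
by move=> y _; apply: continuous_comp; [exact: cvgN|exact: continuous_expR].
Qed.

Lemma besselK_laplace s (x : R) :
  2 * besselK s x = laplace (bessel_kernel (x / 2) (x / 2)) s.
Proof.
rewrite /besselK mulVKf ?pnatr_eq0//.
rewrite (@cintegral_laplace (fun u => expR (- (x / 2 * (u + u^-1))))).
  suff -> : (fun u : R => expR (- (x / 2 * (u + u^-1)))) \o expR =
    bessel_kernel (x / 2) (x / 2) by [].
  by apply/funext => v; rewrite /bessel_kernel /= -expRN mulrDr.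
move=> y y0; apply: (@continuous_comp _ _ _ (fun u : R => - (x / 2 * (u + u^-1))) expR);
  last exact: continuous_expR.
apply: cvgN; apply: cvgM; first exact: cvg_cst.
by apply: cvgD => //; apply: cvgV => //; rewrite gt_eqF.
Qed.

End gamma_kernel.

(** * The convolution theorem *)

Section convolution.
Context {R : realType}.
Local Notation mu := (@lebesgue_measure R).
Implicit Types (s : R[i]) (f g h k : R -> R) (c d : R).

Lemma continuous_shift g (a : R) : continuous g -> continuous (fun v => g (v + a)).
Proof.
move=> cg v; apply: (@continuous_comp _ _ _ (fun v => v + a) g); last exact: cg.
by apply: cvgD; [exact: cvg_id|exact: cvg_cst].
Qed.

Lemma ge0_integral_translate g c (a : R) : continuous g -> (forall v, 0 <= g v) ->
  (\int[mu]_v (g (v + a) * expR (c * v))%:E =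
   (expR (- (c * a)))%:E * \int[mu]_v (g v * expR (c * v))%:E)%E.
Proof.
move=> cg g0.
have cge : continuous (fun v => g v * expR (c * v)).
  move=> v; apply: cvgM; first exact: cg.
  by apply: continuous_comp; [exact: continuous_linear|exact: continuous_expR].
have cges : continuous (fun v : R => g (1 * v + a) * expR (c * (1 * v + a)) * 1).
  under eq_fun do rewrite mul1r mulr1.
  exact: (@continuous_shift _ a cge).
have ge0 v : 0 <= g v * expR (c * v) by rewrite mulr_ge0// expR_ge0.
rewrite (@ge0_affine_substitution _ 1 a _ ltr01 cge ge0).
rewrite -ge0_integralZl//.
- apply: eq_integral => v _; rewrite -EFinM; congr EFin.
  by rewrite mul1r mulr1 mulrDr expRD expRN; field; rewrite gt_eqF// expR_gt0.
- by apply/measurable_EFinP; exact: continuous_measurable_fun.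
- by move=> v _; rewrite lee_fin mulr1.
Qed.

Lemma expintegrable_translate g c (a : R) : continuous g -> (forall v, 0 <= g v) ->
  expintegrable c g -> expintegrable c (fun v => g (v + a)).
Proof.
move=> cg g0 [mg gi].
have mg' : measurable_fun setT (fun v : R => g (v + a)).
  by apply: continuous_measurable_fun; exact: continuous_shift.
split=> //; apply/integrableP; split.
  by apply/measurable_EFinP; apply: measurable_funM => //; exact: measurable_expR_linear.
have -> : (\int[mu]_x `|(EFin \o (fun v => (g (v + a) * expR (c * v))%R)) x| =
    \int[mu]_v (g (v + a) * expR (c * v))%:E)%E.
  by apply: eq_integral => v _ /=; rewrite ger0_norm// mulr_ge0// expR_ge0.
rewrite ge0_integral_translate// -(fineK (integrable_fin_num _ gi))//.
by rewrite -EFinM ltry.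
Qed.

(** Fubini for f(x) g(z - x) k(z). Integrability follows from Tonelli, since the inner integral of
    g(z - x) e^(c z) is e^(c x) times the constant [Gc]. *)
Lemma Rintegral_conv f g h k c : continuous f -> continuous g ->
  (forall v, 0 <= f v) -> (forall v, 0 <= g v) ->
  expintegrable c f -> expintegrable c g ->
  (forall z, \int[mu]_x (f x * g (z - x))%:E = (h z)%:E)%E ->
  continuous k -> (forall v, `|k v| <= expR (c * v)) ->
  \int[mu]_x (f x * \int[mu]_z (g (z - x) * k z)) = \int[mu]_z (h z * k z).
Proof.
move=> cf cg f0 g0 fi gi hE ck kc.
have mf := fi.1; have mg := gi.1.
have mk : measurable_fun setT k by exact: continuous_measurable_fun.
have gxi (x : R) : mu.-integrable setT (EFin \o (fun z => g (z - x) * k z)).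
  apply: integrable_kernel mk kc _; exact: expintegrable_translate.
pose phi (p : R * R) := (f p.1 * (g (p.2 - p.1) * k p.2))%:E.
have mphi : measurable_fun setT phi.
  apply/measurable_EFinP; apply: measurable_funM.
    exact: measurableT_comp mf measurable_fst.
  apply: measurable_funM; last exact: measurableT_comp mk measurable_snd.
  apply: (measurableT_comp mg).
  by apply: measurable_funB; [exact: measurable_snd|exact: measurable_fst].
have iphi : (mu \x mu)%E.-integrable setT phi.
  apply/integrable12ltyP => //.
  have mabs : measurable_fun setT (abse \o phi) by exact: measurableT_comp.
  have [gmf gfin] : (\int[mu]_v (g v * expR (c * v))%:E)%E \is a fin_num /\ True.
    by split=> //; exact: integrable_fin_num gi.2.
  pose Gc := fine (\int[mu]_v (g v * expR (c * v))%:E)%E.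
  apply: (@le_lt_trans _ _ (\int[mu]_x (Gc * (f x * expR (c * x)))%:E)%E).
    apply: ge0_le_integral => //.
    - by move=> x _; apply: integral_ge0.
    - exact: (measurable_fun_fubini_tonelli_F (m2 := mu) (abse \o phi) mabs (fun p => abse_ge0 _)).
    - apply/measurable_EFinP; apply: measurable_funM => //.
      by apply: measurable_funM => //; exact: measurable_expR_linear.
    move=> x _.
    apply: (@le_trans _ _ (\int[mu]_z ((f x)%:E * (g (z - x) * expR (c * z))%:E))%E).
      apply: ge0_le_integral => //.
      - by apply: measurableT_comp => //; exact: measurable_fun_pair2.
      - apply/measurable_EFinP; apply: measurable_funM => //; apply: measurable_funM.
          by apply: continuous_measurable_fun; exact: continuous_shift.
        exact: measurable_expR_linear.
      - move=> z _; rewrite /phi /= -EFinM lee_fin normrM ger0_norm// ler_wpM2l//.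
        by rewrite normrM ger0_norm// ler_wpM2l.
    rewrite ge0_integralZl//.
    - rewrite ge0_integral_translate// -(fineK gmf) -/Gc -!EFinM lee_fin mulrN opprK.
      by rewrite le_eqVlt; apply/orP; left; apply/eqP; ring.
    - apply/measurable_EFinP; apply: measurable_funM.
        by apply: continuous_measurable_fun; exact: continuous_shift.
      exact: measurable_expR_linear.
    - by move=> z _; rewrite lee_fin mulr_ge0// expR_ge0.
    - by rewrite lee_fin.
  have iG : mu.-integrable setT (EFin \o (fun x => Gc * (f x * expR (c * x)))).
    by apply: eq_integrable (integrableZl measurableT Gc fi.2).
  rewrite -ge0_fin_numE; first exact: integrable_fin_num iG.
  apply: integral_ge0 => x _; rewrite lee_fin !mulr_ge0 ?expR_ge0//.
  by apply: fine_ge0; apply: integral_ge0 => v _; rewrite lee_fin mulr_ge0// expR_ge0.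
have := Fubini iphi.
have -> : (\int[mu]_x \int[mu]_y phi (x, y) =
    \int[mu]_x (f x * \int[mu]_z (g (z - x) * k z))%:E)%E.
  apply: eq_integral => x _; rewrite /phi /= EFinM.
  rewrite /Rintegral fineK; last exact: integrable_fin_num (gxi x).
  rewrite -(integralZl measurableT (gxi x)).
  by apply: eq_integral => z _; rewrite -EFinM.
have -> : (\int[mu]_y \int[mu]_x phi (x, y) = \int[mu]_z (h z * k z)%:E)%E.
  apply: eq_integral => z _; rewrite EFinM -hE.
  have ifg : mu.-integrable setT (EFin \o (fun x => f x * g (z - x))).
    apply/integrableP; split.
      apply/measurable_EFinP; apply: measurable_funM => //; apply: (measurableT_comp mg).
      by apply: measurable_funB.
    have -> : (\int[mu]_x `|(EFin \o (fun v => (f v * g (z - v))%R)) x| = (h z)%:E)%E.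
      by rewrite -hE; apply: eq_integral => v _ /=; rewrite ger0_norm// mulr_ge0.
    by rewrite ltry.
  rewrite -(integralZr measurableT ifg); apply: eq_integral => x _; rewrite /phi /= -EFinM.
  by rewrite mulrA.
by rewrite /Rintegral => ->.
Qed.

Lemma laplace_conv f g h s : continuous f -> continuous g ->
  (forall v, 0 <= f v) -> (forall v, 0 <= g v) ->
  expintegrable (complex.Re s) f -> expintegrable (complex.Re s) g ->
  (forall z, \int[mu]_x (f x * g (z - x))%:E = (h z)%:E)%E ->
  laplace h s = laplace f s * laplace g s.
Proof.
move=> cf cg f0 g0 fi gi hE.
have Z (r : R) (u : R -> R) : mu.-integrable setT (EFin \o u) ->
    mu.-integrable setT (EFin \o (fun v => r * u v)).
  by move=> iu; apply: eq_integrable (integrableZl measurableT r iu).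
have ic := integrable_expcos fi; have is_ := integrable_expsin fi.
have inner x : laplace (fun z => g (z - x)) s = cexp s x * laplace g s.
  by rewrite laplace_translate// opprK.
have cc := @continuous_expcos _ s; have cs := @continuous_expsin _ s.
apply: eqC.
  rewrite [LHS]/= -(Rintegral_conv cf cg f0 g0 fi gi hE cc (norm_expcos_le s)).
  rewrite (@eq_Rintegral _ _ _ mu setT (fun x =>
    complex.Re (laplace g s) * (f x * expcos s x) +
    - complex.Im (laplace g s) * (f x * expsin s x))).
    by rewrite RintegralD ?RintegralZl ?ReM//=; [ring|exact: Z|exact: Z].
  move=> x _; have := congr1 (@complex.Re R) (inner x).
  by rewrite ReM /= => ->; ring.
rewrite [LHS]/= -(Rintegral_conv cf cg f0 g0 fi gi hE cs (norm_expsin_le s)).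
rewrite (@eq_Rintegral _ _ _ mu setT (fun x =>
  complex.Im (laplace g s) * (f x * expcos s x) +
  complex.Re (laplace g s) * (f x * expsin s x))).
  by rewrite RintegralD ?RintegralZl ?ImM//=; [ring|exact: Z|exact: Z].
move=> x _; have := congr1 (@complex.Im R) (inner x).
by rewrite ImM /= => ->; ring.
Qed.

End convolution.

(** * Legendre's duplication formula *)

Section gamma_identities.
Context {R : realType}.
Local Notation mu := (@lebesgue_measure R).
Implicit Types (s : R[i]) (f g h k : R -> R) (c d : R).

Lemma ge0_integral_opp f : measurable_fun setT f -> (forall v, 0 <= f v) ->
  (\int[mu]_v (f v)%:E = \int[mu]_v (f (- v))%:E)%E.
Proof.
move=> mf f0.
rewrite [RHS](_ : _ = (\int[mu]_(v in (-%R : _ -> measurableTypeR R) @^-1` setT)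
  ((fun v => (f v)%:E) \o -%R) v)%E)//.
rewrite -ge0_integral_pushforward//=.
- by apply: eq_measure_integral => //= A mA AS; exact/esym/lebesgue_measureN.
- exact/measurable_EFinP.
- by move=> v _; rewrite lee_fin.
Qed.

Lemma sinh_derive (x : R) : is_derive x 1 sinh (cosh x).
Proof. by rewrite /sinh; apply: is_derive_eq; rewrite /GRing.scale/= /cosh; field. Qed.

Lemma continuous_cosh : continuous (@cosh R).
Proof.
move=> x; apply: cvgM; last exact: cvg_cst.
by apply: cvgD; [exact: continuous_expR|exact: continuous_expRN].
Qed.

Lemma sinh_homo : {homo @sinh R : x y / x < y}.
Proof.
move=> x y xy; rewrite /sinh ltr_pM2r ?invr_gt0//.
by apply: ltrB; rewrite ltr_expR// ltrN2.
Qed.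

Lemma bigcup_sinh (c : R) : 0 < c ->
  [set: R] = \bigcup_(n : nat) `[c * sinh (- n%:R), c * sinh n%:R]%classic.
Proof.
move=> c0; apply/seteqP; split => // y _.
exists (Num.truncn (2 * `|y| / c)).+1 => //=; rewrite in_itv/=.
set n : R := _.+1%:R; have n0 : 0 < n by [].
have := Num.Theory.truncnS_gt (2 * `|y| / c); rewrite -/n ltr_pdivrMr// => h.
have sn : n / 2 <= sinh n.
  rewrite /sinh ler_pM2r ?invr_gt0//.
  have := expR_ge1Dx n; have : expR (- n) <= 1 by rewrite expR_le1 oppr_le0 ltW.
  lra.
have sN : sinh (- n) = - sinh n by rewrite /sinh opprK; field.
have h2 : `|y| <= c * sinh n.
  have := ler_wpM2l (ltW c0) sn; lra.
by rewrite sN mulrN -ler_norml.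
Qed.

Lemma integral_cosh_gauss (c : R) : 0 < c ->
  (\int[mu]_x (expR (- (c * sinh x) ^+ 2) * (c * cosh x))%:E = (Num.sqrt pi)%:E)%E.
Proof.
move=> c0; rewrite -integralT_gauss /gauss_fun.
rewrite [RHS](@ge0_substitution R (fun x => c * sinh x) (fun x => c * cosh x)
  (fun y => expR (- y ^+ 2)))//.
- by move=> x y xy; rewrite ltr_pM2l// sinh_homo.
- move=> x; have h := sinh_derive x; apply: is_derive_eq.
  by rewrite /GRing.scale/=; ring.
- by move=> x; apply: cvgM; [exact: cvg_cst|exact: continuous_cosh].
- by move=> x; rewrite mulr_ge0// ltW// cosh_gt0.
- exact: bigcup_sinh.
- by move=> y _; exact: continuous_gauss_fun.
Qed.

(** After x -> x + z/2 the exponents add up to e^(z + 2x) + e^(z - 2x) = 2 e^z + (2 e^(z/2) sinh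
    x)^2. Averaging over x -> -x replaces e^(-x) by cosh x, the derivative that turns this into a
    Gaussian integral in 2 e^(z/2) sinh x. *)
Lemma gamma_convolution (z : R) :
  (\int[mu]_x (gamma_kernel 1 (2 * x) *
     (expR (1 * (z - x)) * gamma_kernel 1 (2 * (z - x))))%:E =
   (Num.sqrt pi / 2 * gamma_kernel 2 z)%:E)%E.
Proof.
pose F (x : R) := gamma_kernel 1 (2 * x) * (expR (1 * (z - x)) * gamma_kernel 1 (2 * (z - x))).
pose E0 (x : R) := expR (z / 2) * gamma_kernel 2 z * expR (- (2 * expR (z / 2) * sinh x) ^+ 2).
have c2 : 0 < 2 * expR (z / 2) by rewrite mulr_gt0// expR_gt0.
have cgk (a b : R) : continuous (fun x => gamma_kernel 1 (a * x + b)).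
  move=> x; apply: (@continuous_comp _ _ _ (fun x => a * x + b) (gamma_kernel 1)).
    by apply: cvgD; [exact: continuous_linear|exact: cvg_cst].
  exact: continuous_gamma_kernel.
have F0 x : 0 <= F x by rewrite !mulr_ge0// expR_ge0.
have cF : continuous F.
  move=> x; apply: cvgM.
    by have := @cgk 2 0 x; under eq_fun do rewrite addr0.
  apply: cvgM.
    apply: (@continuous_comp _ _ _ (fun x : R => 1 * (z - x)) expR); last exact: continuous_expR.
    by apply: cvgM; [exact: cvg_cst|apply: cvgB => //; exact: cvg_cst].
  have := @cgk (- 2) (2 * z) x; under eq_fun do rewrite mulNr addrC -mulrBr.
  exact.
have FE x : F (x + z / 2) = E0 x * expR (- x).
  rewrite /F /E0 /gamma_kernel !mul1r.
  have -> : 2 * (x + z / 2) = z + (x + x) by field.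
  have -> : z - (x + z / 2) = z / 2 - x by field.
  have -> : 2 * (z / 2 - x) = z + (- x + - x) by field.
  rewrite -!expRD; congr expR; rewrite !expRD.
  have -> : expR z = expR (z / 2) ^+ 2 by rewrite -expRM_natl; congr expR; field.
  rewrite /sinh; have := expRxMexpNx_1 x.
  move: (expR x) (expR (- x)) (expR (z / 2)) => u v e uv.
  have -> : - (2 * e ^+ 2) = - (2 * e ^+ 2 * (u * v)) by rewrite uv mulr1.
  by field.
pose a := expR (z / 2) * gamma_kernel 2 z.
have a0 : 0 <= a by rewrite mulr_ge0// expR_ge0.
have E00 x : 0 <= E0 x by rewrite mulr_ge0// expR_ge0.
have csinh : continuous (@sinh R).
  move=> x; apply: cvgM; last exact: cvg_cst.
  by apply: cvgB; [exact: continuous_expR|exact: continuous_expRN].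
have cE0 : continuous E0.
  move=> x; apply: cvgM; first exact: cvg_cst.
  apply: (@continuous_comp _ _ _ (fun x => - (2 * expR (z / 2) * sinh x) ^+ 2) expR);
    last exact: continuous_expR.
  by apply: cvgN; apply: cvgM; apply: cvgM; [exact: cvg_cst|exact: csinh|exact: cvg_cst|exact: csinh].
have m1 : measurable_fun setT (fun x => E0 x * expR (- x)).
  apply: continuous_measurable_fun => x; apply: cvgM; first exact: cE0.
  exact: continuous_expRN.
have m2 : measurable_fun setT (fun x => E0 x * expR x).
  apply: continuous_measurable_fun => x; apply: cvgM; first exact: cE0.
  exact: continuous_expR.
have step1 : (\int[mu]_x (F x)%:E = \int[mu]_x (E0 x * expR (- x))%:E)%E.
  rewrite (@ge0_affine_substitution _ 1 (z / 2) F)//.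
  by apply: eq_integral => x _; rewrite mulr1 mul1r FE.
have E0N x : E0 (- x) = E0 x.
  rewrite /E0 (_ : sinh (- x) = - sinh x); last by rewrite /sinh opprK; field.
  by rewrite mulrN sqrrN.
have ge01 x : (0 <= (E0 x * expR (- x))%:E)%E by rewrite lee_fin mulr_ge0// expR_ge0.
have step2 : (\int[mu]_x (E0 x * expR (- x))%:E = \int[mu]_x (E0 x * expR x)%:E)%E.
  rewrite (ge0_integral_opp m1); last by move=> x; exact: (ge01 x).
  by apply: eq_integral => x _; rewrite E0N opprK.
have ge02 x : (0 <= (E0 x * expR x)%:E)%E by rewrite lee_fin mulr_ge0// expR_ge0.
have step3 : (\int[mu]_x (E0 x * expR (- x))%:E + \int[mu]_x (E0 x * expR x)%:E =
    (gamma_kernel 2 z * Num.sqrt pi)%:E)%E.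
  rewrite -ge0_integralD//; [|exact/measurable_EFinP|exact/measurable_EFinP].
  rewrite EFinM -(integral_cosh_gauss c2) -ge0_integralZl//.
  - apply: eq_integral => x _; rewrite -EFinD -EFinM; congr EFin.
    by rewrite /E0 /cosh; field.
  - apply/measurable_EFinP; apply: continuous_measurable_fun => x.
    apply: cvgM; last by apply: cvgM; [exact: cvg_cst|exact: continuous_cosh].
    apply: (@continuous_comp _ _ _ (fun x => - (2 * expR (z / 2) * sinh x) ^+ 2) expR);
      last exact: continuous_expR.
    by apply: cvgN; apply: cvgM; apply: cvgM; [exact: cvg_cst|exact: csinh|exact: cvg_cst|exact: csinh].
  - by move=> x _; rewrite lee_fin !mulr_ge0 ?expR_ge0// ltW// cosh_gt0.
  - by rewrite lee_fin expR_ge0.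
etransitivity; first exact: step1.
move: step3; rewrite -step2.
case: (\int[mu]_x (E0 x * expR (- x))%:E)%E => [r| |]//=.
by rewrite -EFinD => -[] h; congr EFin; lra.
Qed.

Lemma gamma_kernel_scale c d v : 0 < d -> gamma_kernel c (v + ln d) = gamma_kernel (c * d) v.
Proof. by move=> d0; rewrite /gamma_kernel expRD lnK// -mulrA [d * _]mulrC. Qed.

Lemma laplace_gamma_kernel c s : 0 < c -> 0 < complex.Re s ->
  laplace (gamma_kernel c) s = cexp s (- ln c) * Gamma s.
Proof.
move=> c0 s0; rewrite Gamma_laplace -laplace_translate.
- suff -> : (fun v => gamma_kernel 1 (v + ln c)) = gamma_kernel c by [].
  by apply/funext => v; rewrite gamma_kernel_scale// mul1r.
- exact: continuous_gamma_kernel.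
- exact: expintegrable_gamma_kernel.
Qed.

(** Up to factors 2, both Gamma values are transforms at the same s, of e^(-e^(2v)) and of e^v
    e^(-e^(2v)), so their product is the transform of the convolution computed in
    [gamma_convolution]. *)
Lemma Gamma_duplication s : 0 < complex.Re s ->
  Gamma (s / 2) * Gamma ((s + 1) / 2) = 2 * (Num.sqrt pi)%:C * cexp s (- ln 2) * Gamma s.
Proof.
move=> s0.
pose f (v : R) := gamma_kernel 1 (2 * v).
pose g (v : R) := expR (1 * v) * gamma_kernel 1 (2 * v).
have cf : continuous f.
  move=> x; apply: (@continuous_comp _ _ _ (fun x : R => 2 * x) (gamma_kernel 1)).
    exact: continuous_linear.
  exact: continuous_gamma_kernel.
have cg : continuous g.
  move=> x; apply: cvgM; last exact: cf.
  by apply: continuous_comp; [exact: continuous_linear|exact: continuous_expR].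
have fi (c : R) : 0 < c -> expintegrable c f.
  move=> c0; have [C hC] := @expR_kernel_bound R 1 c ltr01 (ltW c0).
  apply: (@expintegrable_bound _ c c (Num.max C 1)) => //.
  - exact: continuous_measurable_fun.
  - move=> v; rewrite le_max; apply/orP; left.
    rewrite ger0_norm ?expR_ge0// (_ : (c + c) * v = c * (2 * v)); last by ring.
    exact: hC.
  - move=> v; rewrite subrr mul0r expR0 mulr1 ger0_norm ?expR_ge0// le_max.
    by apply/orP; right; rewrite -expR0 ler_expR mul1r oppr_le0 expR_ge0.
have ig : expintegrable (complex.Re s) g by apply: expintegrable_expR; apply: fi; lra.
have -> : Gamma (s / 2) = 2 * laplace f s.
  rewrite Gamma_laplace laplace_half//; [exact: continuous_gamma_kernel|exact: fi].
have -> : Gamma ((s + 1) / 2) = 2 * laplace g s.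
  rewrite Gamma_laplace laplace_half.
  - rewrite /g (laplace_expR f 1 s); by [].
  - exact: continuous_gamma_kernel.
  - by apply: fi; rewrite ReD /=; lra.
rewrite mulrACA -(laplace_conv cf cg _ _ (fi _ s0) ig gamma_convolution).
- rewrite laplaceZ ?laplace_gamma_kernel//; last exact: expintegrable_gamma_kernel.
  rewrite rmorphM/= fmorphV/= rmorph_nat; by field.
- by move=> v; exact: expR_ge0.
- by move=> v; rewrite mulr_ge0// expR_ge0.
Qed.

End gamma_identities.

(** * Integration by parts and the functional equation of Gamma *)

Section laplace_derivative.
Context {R : realType}.
Local Notation mu := (@lebesgue_measure R).
Implicit Types (s : R[i]) (f g h k : R -> R) (c d : R).

(** The fundamental theorem on symmetric intervals, then dominated convergence of the truncated
    integrands. *)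
Lemma Rintegral_derivative h h' : (forall x : R, is_derive x 1 h (h' x)) ->
  continuous h' -> mu.-integrable setT (EFin \o h') ->
  h n%:R @[n --> \oo] --> 0 -> h (- n%:R) @[n --> \oo] --> 0 ->
  \int[mu]_x h' x = 0.
Proof.
move=> dh ch' ih hp hn.
have ch : continuous h.
  move=> x; apply: differentiable_continuous; apply/derivable1_diffP.
  by have [] := dh x.
have mh' : measurable_fun setT h' by exact: continuous_measurable_fun.
pose J (n : nat) : set R := `[- n.+1%:R, n.+1%:R]%classic.
have mJ n : measurable (J n) by exact: measurable_itv.
have ftc n : (\int[mu]_(x in J n) (h' x)%:E = (h n.+1%:R - h (- n.+1%:R))%:E)%E.
  rewrite (@continuous_FTC2 _ h' h).
  - by rewrite EFinB.
  - by rewrite (@lt_trans _ _ 0)// oppr_lt0.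
  - by apply: continuous_subspaceT.
  - split; [by move=> x _; have [] := dh x| |].
    + by apply: cvg_at_right_filter; exact: ch.
    + by apply: cvg_at_left_filter; exact: ch.
  - by move=> x _; rewrite derive1E; have [_ ->] := dh x.
have [|||||_ _ lim] := @dominated_convergence _ _ R mu setT measurableT
  (fun n x => ((EFin \o h') \_ (J n)) x) (EFin \o h') (fun x => `|(h' x)%:E|%E).
- by move=> n; apply/(measurable_restrictT _ (mJ n)); apply: measurable_funTS; exact/measurable_EFinP.
- exact/measurable_EFinP.
- apply: aeW => x _.
  have c : (fun _ : nat => (h' x)%:E) @ \oo --> (h' x)%:E by exact: cvg_cst.
  apply: cvg_trans c; apply: near_eq_cvg; near=> n.
  rewrite patchE ifT// inE /J /= in_itv/= -ler_norml.
  apply: (@le_trans _ _ (Num.truncn `|x|).+1%:R); first exact/ltW/Num.Theory.truncnS_gt.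
  by rewrite ler_nat ltnS; near: n; exact: nbhs_infty_ge.
- exact: integrable_abse.
- apply: aeW => x n _; rewrite patchE; case: ifP => _; first exact: lexx.
  by rewrite abse0 abse_ge0.
have {}lim : (fun n => (h n.+1%:R - h (- n.+1%:R))%:E) @ \oo --> (\int[mu]_x (h' x)%:E)%E.
  apply: cvg_trans lim; apply: near_eq_cvg; apply: nearW => n.
  by rewrite /= -ftc [RHS]integral_mkcond.
have lim0 : (fun n : nat => (h n.+1%:R - h (- n.+1%:R))%:E) @ \oo --> (0 : R)%:E.
  apply/fine_cvgP; split; first exact: nearW.
  rewrite -(subr0 0); apply: cvgB.
    by have := hp; rewrite -cvg_shiftS.
  by have := hn; rewrite -(cvg_shiftS (fun n : nat => h (- n%:R))).
by rewrite /Rintegral (cvg_unique _ lim lim0).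
Unshelve. all: by end_near. Qed.

Lemma expcos_derive s (x : R) : is_derive x 1 (expcos s)
  (complex.Re s * expcos s x - complex.Im s * expsin s x).
Proof.
rewrite /expcos /expsin; apply: is_derive_eq; rewrite /GRing.scale/=; ring.
Qed.

Lemma expsin_derive s (x : R) : is_derive x 1 (expsin s)
  (complex.Re s * expsin s x + complex.Im s * expcos s x).
Proof.
rewrite /expcos /expsin; apply: is_derive_eq; rewrite /GRing.scale/=; ring.
Qed.

Lemma laplace_derivative f f' s :
  (forall x : R, is_derive x 1 f (f' x)) -> continuous f' ->
  expintegrable (complex.Re s) f -> expintegrable (complex.Re s) f' ->
  f n%:R * expR (complex.Re s * n%:R) @[n --> \oo] --> 0 ->
  f (- n%:R) * expR (complex.Re s * - n%:R) @[n --> \oo] --> 0 ->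
  laplace f' s = - s * laplace f s.
Proof.
move=> df cf' fi f'i lp ln.
have cf : continuous f.
  move=> x; apply: differentiable_continuous; apply/derivable1_diffP.
  by have [] := df x.
have lim (k : R -> R) (u : nat -> R) : (forall v, `|k v| <= expR (complex.Re s * v)) ->
    f (u n) * expR (complex.Re s * u n) @[n --> \oo] --> 0 ->
    f (u n) * k (u n) @[n --> \oo] --> 0.
  move=> kb /cvgr0_norm_le H; apply/cvgr0Pnorm_le => e e0.
  apply: filterS (H e e0) => n; apply: le_trans; rewrite !normrM ler_wpM2l//.
  by rewrite [leRHS]ger0_norm// expR_ge0.
have cc := @continuous_expcos _ s; have cs := @continuous_expsin _ s.
have ic := integrable_expcos fi; have is_ := integrable_expsin fi.
have ic' := integrable_expcos f'i; have is' := integrable_expsin f'i.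
have Z (r : R) (u : R -> R) : mu.-integrable setT (EFin \o u) ->
    mu.-integrable setT (EFin \o (fun v => r * u v)).
  by move=> iu; apply: eq_integrable (integrableZl measurableT r iu).
have D (u v : R -> R) : mu.-integrable setT (EFin \o u) ->
    mu.-integrable setT (EFin \o v) -> mu.-integrable setT (EFin \o (fun x => u x + v x)).
  by move=> iu iv; apply: eq_integrable (integrableD measurableT iu iv).
have i1 := D _ _ ic' (D _ _ (Z (complex.Re s) _ ic) (Z (- complex.Im s) _ is_)).
have i2 := D _ _ is' (D _ _ (Z (complex.Re s) _ is_) (Z (complex.Im s) _ ic)).
have E1 : \int[mu]_x (f' x * expcos s x + (complex.Re s * (f x * expcos s x) +
    - complex.Im s * (f x * expsin s x))) = 0.
  apply: (@Rintegral_derivative (fun x => f x * expcos s x)) i1 _ _.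
  - move=> x; have d1 := df x; have d2 := expcos_derive s x.
    by apply: is_derive_eq; rewrite /GRing.scale/=; ring.
  - move=> x; apply: cvgD; first by apply: cvgM; [exact: cf'|exact: cc].
    apply: cvgD; (apply: cvgM; first exact: cvg_cst); apply: cvgM;
      [exact: cf|exact: cc|exact: cf|exact: cs].
  - exact: lim (norm_expcos_le s) lp.
  - exact: lim (norm_expcos_le s) ln.
have E2 : \int[mu]_x (f' x * expsin s x + (complex.Re s * (f x * expsin s x) +
    complex.Im s * (f x * expcos s x))) = 0.
  apply: (@Rintegral_derivative (fun x => f x * expsin s x)) i2 _ _.
  - move=> x; have d1 := df x; have d2 := expsin_derive s x.
    by apply: is_derive_eq; rewrite /GRing.scale/=; ring.
  - move=> x; apply: cvgD; first by apply: cvgM; [exact: cf'|exact: cs].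
    apply: cvgD; (apply: cvgM; first exact: cvg_cst); apply: cvgM;
      [exact: cf|exact: cs|exact: cf|exact: cc].
  - exact: lim (norm_expsin_le s) lp.
  - exact: lim (norm_expsin_le s) ln.
move: E1 E2.
rewrite !RintegralD//; try by [exact: Z|apply: D; exact: Z].
rewrite !RintegralZl// => E1 E2.
by apply: eqC; rewrite ?ReM ?ImM ?ReN ?ImN /=; lra.
Qed.

Lemma Gamma_succ s : 0 < complex.Re s -> Gamma (s + 1) = s * Gamma s.
Proof.
move=> s0; rewrite !Gamma_laplace.
pose f' (v : R) := -1 * (expR (1 * v) * gamma_kernel 1 v).
have -> : laplace (gamma_kernel 1) (s + 1) = - laplace f' s.
  rewrite laplaceZ; last by apply/expintegrable_expR/expintegrable_gamma_kernel => //; lra.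
  by rewrite (laplace_expR (gamma_kernel 1) 1 s) rmorphN mulN1r opprK.
suff -> : laplace f' s = - s * laplace (gamma_kernel 1) s by rewrite mulNr opprK.
apply: laplace_derivative.
- move=> x; rewrite /gamma_kernel /f'; apply: is_derive_eq.
  by rewrite /GRing.scale/= /gamma_kernel; rewrite !mul1r; ring.
- move=> x; apply: cvgM; first exact: cvg_cst.
  apply: cvgM; last exact: continuous_gamma_kernel.
  by apply: continuous_comp; [exact: continuous_linear|exact: continuous_expR].
- exact: expintegrable_gamma_kernel.
- by apply/expintegrableZ/expintegrable_expR/expintegrable_gamma_kernel => //; lra.
- have [C hC] := @expR_kernel_bound R 1 (complex.Re s + 1) ltr01 (ltW (addr_gt0 s0 ltr01)).
  apply: (@squeeze_cvgr _ _ _ _ (fun=> 0) (fun n => C * expR (- n%:R))).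
  + apply: nearW => n; rewrite mulr_ge0 ?expR_ge0//=.
    have := hC n%:R; rewrite -/(gamma_kernel 1 _) => h.
    rewrite (_ : complex.Re s * n%:R = (complex.Re s + 1) * n%:R + - n%:R); last by ring.
    by rewrite expRD mulrA ler_wpM2r// expR_ge0.
  + exact: cvg_cst.
  + by rewrite -(mulr0 C); apply: cvgn_mull; exact: cvgn_expR.
- apply: (@squeeze_cvgr _ _ _ _ (fun=> 0) (fun n => expR (- (complex.Re s)) ^+ n)).
  + apply: nearW => n; rewrite mulr_ge0 ?expR_ge0//= -expRM_natr mulrN mulNr.
    rewrite ler_piMl ?expR_ge0// /gamma_kernel mul1r -expR0 ler_expR oppr_le0.
    exact: expR_ge0.
  + exact: cvg_cst.
  + have := @cvg_geometric R 1 (expR (- complex.Re s)) (expR_gt_lt1 s0).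
    rewrite (_ : geometric 1 _ = (fun n => expR (- complex.Re s) ^+ n))//.
    by apply/funext => n; rewrite /= mul1r.
Qed.

End laplace_derivative.

(** * Entire transforms *)

Section laplace_entire.
Context {R : realType}.
Local Notation mu := (@lebesgue_measure R).
Implicit Types (s h : R[i]) (f g k : R -> R) (c d x y v : R).

Lemma expR_sub1_le x : `|expR x - 1| <= `|x| * expR `|x|.
Proof.
have h1 := expR_ge1Dx x; have h2 := expR_ge1Dx (- x).
have h3 : 1 <= expR `|x| by rewrite -expR0 ler_expR.
have h4 : expR x * expR (- x) = 1 by exact: expRxMexpNx_1.
have [x0|x0] := leP 0 x.
  rewrite ger0_norm ?(le_trans _ h1)//; last by lra.
  have := ler_wpM2l (expR_ge0 x) h2; rewrite h4 (ger0_norm x0); lra.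
rewrite ler0_norm; last by rewrite subr_le0 -expR0 ler_expR ltW.
have := ler_wpM2l (normr_ge0 x) h3; rewrite (ltr0_norm x0); lra.
Qed.

Lemma expR_sub1x_le x : `|expR x - 1 - x| <= x ^+ 2 * expR `|x|.
Proof.
have h1 := expR_ge1Dx x; rewrite ger0_norm; last by lra.
have h2 := expR_ge1Dx (- x); have h4 : expR x * expR (- x) = 1 by exact: expRxMexpNx_1.
have h3 : expR x - 1 - x <= x * (expR x - 1).
  have := ler_wpM2l (expR_ge0 x) h2; rewrite h4; lra.
apply: (le_trans h3); apply: (le_trans (ler_norm _)); rewrite normrM.
rewrite -real_normK ?num_real// expr2 -mulrA ler_wpM2l//; exact: expR_sub1_le.
Qed.

Lemma norm_sin_le y : `|sin y| <= `|y|.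
Proof.
wlog y0 : y / 0 <= y.
  move=> H; have [/H//|/ltW y0] := leP 0 y.
  by rewrite -normrN -sinN -[leRHS]normrN; apply: H; rewrite oppr_ge0.
move: y0; rewrite le_eqVlt => /predU1P[<-|y0]; first by rewrite sin0.
have [] := @MVT R sin cos 0 y y0 (fun x _ => is_derive_sin x).
  by apply: continuous_subspaceT => x; exact: continuous_sin.
move=> x _; rewrite sin0 !subr0 => ->; rewrite normrM ler_piMl//; exact: cos_max.
Qed.

Lemma cos_half y : 1 - cos y = 2 * sin (y / 2) ^+ 2.
Proof.
have h := cos_mulr2n (y / 2); have e : (y / 2) *+ 2 = y by rewrite -mulr_natr divfK.
by rewrite e in h; rewrite h sin2cos2 -mulr_natr; ring.
Qed.

Lemma norm_cos_sub1_le y : `|1 - cos y| <= y ^+ 2.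
Proof.
rewrite cos_half ger0_norm; last by rewrite mulr_ge0// sqr_ge0.
have := norm_sin_le (y / 2) => h.
have : `|sin (y / 2)| ^+ 2 <= `|y / 2| ^+ 2 by rewrite lerXn2r ?nnegrE.
rewrite real_normK ?num_real// real_normK ?num_real// expr_div_n => h2.
have := sqr_ge0 y; lra.
Qed.

Lemma norm_sin_sub_le y : `|sin y - y| <= y ^+ 2.
Proof.
have c1 (z : R) : `|cos z - 1| <= `|z|.
  rewrite -normrN opprB (cos_half z) ger0_norm; last by rewrite mulr_ge0// sqr_ge0.
  have h1 := norm_sin_le (z / 2); have h2 := sin_max (z / 2).
  rewrite -real_normK ?num_real// expr2.
  have := ler_pM (normr_ge0 _) (normr_ge0 _) h1 h2.
  rewrite normrM [`|2^-1|]ger0_norm ?invr_ge0//; lra.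
wlog y0 : y / 0 <= y.
  move=> H; have [/H//|/ltW y0] := leP 0 y.
  have := H (- y); rewrite oppr_ge0 sqrrN sinN -opprD normrN => /(_ y0).
  by rewrite addrC.
move: y0; rewrite le_eqVlt => /predU1P[<-|y0]; first by rewrite sin0 subrr normr0 sqr_ge0.
have [] := @MVT R sin cos 0 y y0 (fun x _ => is_derive_sin x).
  by apply: continuous_subspaceT => x; exact: continuous_sin.
move=> x; rewrite in_itv/= sin0 !subr0 => /andP[x0 xy] ->.
rewrite -{2}[y]mul1r -mulrBl normrM expr2 [`|y|]ger0_norm ?(ltW y0)// ler_pM2r//.
by apply: le_trans (c1 x) _; rewrite ger0_norm ltW.
Qed.

Lemma sqr_le_expR v : v ^+ 2 <= 2 * expR `|v|.
Proof.
have := @expR_ge1Dxn R `|v| 1 (normr_ge0 v).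
rewrite real_normK ?num_real// (_ : 2`! = 2)%N//; lra.
Qed.

(** Absorbs v^2 e^|v| into exponentials, so that integrability at Re s + 2 and Re s - 2 controls the
    Taylor remainder. *)
Definition majorant v : R := 2 * (expR (2 * v) + expR (- 2 * v)).

Lemma majorant_ge v : v ^+ 2 * expR `|v| <= majorant v.
Proof.
apply: (@le_trans _ _ (2 * expR (2 * `|v|))).
  rewrite (_ : 2 * `|v| = `|v| + `|v|); last by ring.
  by rewrite expRD mulrA ler_wpM2r ?expR_ge0// sqr_le_expR.
rewrite /majorant ler_pM2l//; have [v0|v0] := leP 0 v.
  by rewrite ger0_norm// lerDl expR_ge0.
by rewrite ltr0_norm// mulrN -mulNr lerDr expR_ge0.
Qed.

(** The remainder of e^(h v) after its linear term in h, by real and imaginary parts. The bound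
    separates |h|^2 from a function of v, so that it can be integrated in v. *)
Lemma expcos_taylor h v : `|complex.Re h| <= 1 -> `|complex.Im h| <= 1 ->
  `|expcos h v - 1 - complex.Re h * v| <=
    (complex.Re h ^+ 2 + complex.Im h ^+ 2) * (2 * majorant v) /\
  `|expsin h v - complex.Im h * v| <=
    (complex.Re h ^+ 2 + complex.Im h ^+ 2) * (2 * majorant v).
Proof.
rewrite /expcos /expsin; move: (complex.Re h) (complex.Im h) => p q p1 q1.
set x := p * v; set y := q * v.
have xv : `|x| <= `|v| by rewrite /x normrM ler_piMl.
have ex : expR `|x| <= expR `|v| by rewrite ler_expR.
have ev : 1 <= expR `|v| by rewrite -expR0 ler_expR.
have exx : expR x <= expR `|v| by rewrite ler_expR (le_trans (ler_norm _)).
have x2 : x ^+ 2 = p ^+ 2 * v ^+ 2 by rewrite exprMn.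
have y2 : y ^+ 2 = q ^+ 2 * v ^+ 2 by rewrite exprMn.
have M := majorant_ge v.
have p2 := sqr_ge0 p; have q2 := sqr_ge0 q; have v2 := sqr_ge0 v.
have pM := ler_wpM2l p2 M; have qM := ler_wpM2l q2 M.
have pv2 : 0 <= p ^+ 2 * v ^+ 2 by rewrite mulr_ge0.
have qv2 : 0 <= q ^+ 2 * v ^+ 2 by rewrite mulr_ge0.
have hp : p ^+ 2 * v ^+ 2 * expR `|v| <= p ^+ 2 * majorant v by rewrite -mulrA.
have hq : q ^+ 2 * v ^+ 2 * expR `|v| <= q ^+ 2 * majorant v by rewrite -mulrA.
have hp0 : 0 <= p ^+ 2 * v ^+ 2 * expR `|v| by rewrite mulr_ge0// expR_ge0.
have hq0 : 0 <= q ^+ 2 * v ^+ 2 * expR `|v| by rewrite mulr_ge0// expR_ge0.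
split.
  have -> : expR x * cos y - 1 - x = (expR x - 1 - x) - expR x * (1 - cos y) by ring.
  apply: le_trans (ler_normB _ _) _.
  have h1 : `|expR x - 1 - x| <= p ^+ 2 * v ^+ 2 * expR `|v|.
    apply: le_trans (expR_sub1x_le x) _; rewrite x2 ler_wpM2l//.
  have h2 : `|expR x * (1 - cos y)| <= q ^+ 2 * v ^+ 2 * expR `|v|.
    rewrite normrM ger0_norm ?expR_ge0// mulrC -y2.
    by apply: ler_pM; rewrite ?expR_ge0// norm_cos_sub1_le.
  lra.
have -> : expR x * sin y - y = (expR x - 1) * sin y + (sin y - y) by ring.
apply: le_trans (ler_normD _ _) _.
have h1 : `|(expR x - 1) * sin y| <= `|x| * `|y| * expR `|v|.
  rewrite normrM mulrAC; apply: ler_pM => //; last exact: norm_sin_le.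
  by apply: le_trans (expR_sub1_le x) _; rewrite ler_wpM2l.
have h2 : `|sin y - y| <= q ^+ 2 * v ^+ 2 * expR `|v|.
  apply: le_trans (norm_sin_sub_le y) _; rewrite y2 ler_peMr//.
have xy : 2 * (`|x| * `|y|) <= p ^+ 2 * v ^+ 2 + q ^+ 2 * v ^+ 2.
  rewrite -x2 -y2 -[x ^+ 2]real_normK ?num_real// -[y ^+ 2]real_normK ?num_real//.
  have := sqr_ge0 (`|x| - `|y|); rewrite sqrrB -mulr_natl; lra.
have := ler_wpM2r (expR_ge0 `|v|) xy; lra.
Qed.

Lemma expintegrable_mulv c f : (forall d, expintegrable d f) ->
  expintegrable c (fun v => v * f v).
Proof.
move=> fi; split; first by apply: measurable_funM => //; exact: (fi 0).1.
have [_ /integrable_norm i1] := fi (c + 1); have [_ /integrable_norm i2] := fi (c - 1).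
apply: le_integrable (integrableD measurableT i1 i2) => //.
  apply/measurable_EFinP; apply: measurable_funM; last exact: measurable_expR_linear.
  by apply: measurable_funM => //; exact: (fi 0).1.
move=> v _ /=; rewrite lee_fin [leRHS]ger0_norm ?addr_ge0// !normrM.
rewrite ![`|expR _|]ger0_norm ?expR_ge0// -mulrDr [`|v| * _]mulrC -mulrA ler_wpM2l//.
rewrite (_ : (c + 1) * v = v + c * v); last by ring.
rewrite (_ : (c - 1) * v = - v + c * v); last by ring.
rewrite !expRD -mulrDl ler_wpM2r ?expR_ge0//.
have h1 := expR_ge1Dx v; have h2 := expR_ge1Dx (- v).
have h3 := expR_ge0 v; have h4 := expR_ge0 (- v).
by rewrite ler_norml; apply/andP; split; lra.
Qed.

(** Integrating the remainder of e^(h v) against f(v) e^(s v) exhibits the transform of v f(v) as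
    the derivative, with an error quadratic in h. *)
Lemma laplace_taylor f s : (forall d, expintegrable d f) ->
  exists2 M : R, 0 <= M & forall h, `|complex.Re h| <= 1 -> `|complex.Im h| <= 1 ->
  `|laplace f (s + h) - laplace f s - h * laplace (fun v => v * f v) s| <=
  ((complex.Re h ^+ 2 + complex.Im h ^+ 2) * M)%:C.
Proof.
move=> fi; pose sg := complex.Re s.
pose W v := `|f v| * expR (sg * v) * (2 * majorant v).
have W0 v : 0 <= W v.
  by rewrite /W mulr_ge0 ?mulr_ge0 ?expR_ge0// addr_ge0// expR_ge0.
have iW : mu.-integrable setT (EFin \o W).
  have [_ /integrable_norm i1] := fi (sg + 2); have [_ /integrable_norm i2] := fi (sg - 2).
  apply: eq_integrable (integrableZl measurableT 4 (integrableD measurableT i1 i2)) => //.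
  move=> v _ /=; rewrite -EFinD -EFinM; congr EFin; rewrite !normrM /W /majorant.
  rewrite ![`|expR _|]ger0_norm ?expR_ge0//.
  rewrite (_ : (sg + 2) * v = sg * v + 2 * v); last by ring.
  rewrite (_ : (sg - 2) * v = sg * v + - 2 * v); last by ring.
  by rewrite !expRD; ring.
pose M := \int[mu]_v W v.
have M0 : 0 <= M by apply: Rintegral_ge0.
exists (4 * M) => [|h p1 q1]; first by rewrite mulr_ge0.
set N := complex.Re h ^+ 2 + complex.Im h ^+ 2.
have N0 : 0 <= N by rewrite addr_ge0// sqr_ge0.
have Z (r : R) (u : R -> R) : mu.-integrable setT (EFin \o u) ->
    mu.-integrable setT (EFin \o (fun v => r * u v)).
  by move=> iu; apply: eq_integrable (integrableZl measurableT r iu).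
have D (u v : R -> R) : mu.-integrable setT (EFin \o u) ->
    mu.-integrable setT (EFin \o v) -> mu.-integrable setT (EFin \o (fun x => u x + v x)).
  by move=> iu iv; apply: eq_integrable (integrableD measurableT iu iv).
have vfi := expintegrable_mulv sg fi.
have a1 := integrable_expcos (fi (complex.Re (s + h))).
have a2 := integrable_expcos (fi sg : expintegrable (complex.Re s) f).
have a3 := integrable_expcos (vfi : expintegrable (complex.Re s) _).
have b1 := integrable_expsin (fi (complex.Re (s + h))).
have b2 := integrable_expsin (fi sg : expintegrable (complex.Re s) f).
have b3 := integrable_expsin (vfi : expintegrable (complex.Re s) _).
have mW u : mu.-integrable setT (EFin \o u) ->
    (forall v, `|u v| <= N * (2 * W v)) -> `|\int[mu]_v u v| <= N * (2 * M).
  move=> iu uW; apply: le_trans (le_normr_Rintegral measurableT iu) _.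
  rewrite /M -RintegralZl// -RintegralZl//; last exact: Z.
  apply: le_Rintegral => //; [exact: integrable_norm|exact/Z/Z].
have split_cos v : expcos (s + h) v = expcos s v * expcos h v - expsin s v * expsin h v.
  by rewrite /expcos /expsin ReD ImD !mulrDl expRD cosD; ring.
have split_sin v : expsin (s + h) v = expcos s v * expsin h v + expsin s v * expcos h v.
  by rewrite /expcos /expsin ReD ImD !mulrDl expRD sinD; ring.
have comb (u1 u2 e1 e2 : R) v : `|u1| <= expR (sg * v) -> `|u2| <= expR (sg * v) ->
    `|e1| <= N * (2 * majorant v) -> `|e2| <= N * (2 * majorant v) ->
    `|f v * (u1 * e1 + u2 * e2)| <= N * (2 * W v).
  move=> h1 h2 h3 h4; rewrite normrM.
  rewrite (_ : N * (2 * W v) = `|f v| * (expR (sg * v) * (N * (2 * majorant v)) +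
    expR (sg * v) * (N * (2 * majorant v)))); last by rewrite /W; ring.
  rewrite ler_wpM2l//; apply: le_trans (ler_normD _ _) _.
  by rewrite !normrM lerD// ler_pM.
have bound v := expcos_taylor v p1 q1.
apply: norm_le_ReIm; rewrite (_ : N * (4 * M) = N * (2 * M) + N * (2 * M)); last by ring.
apply: lerD.
  have -> : complex.Re (laplace f (s + h) - laplace f s - h * laplace (fun v => v * f v) s) =
    \int[mu]_v (f v * expcos (s + h) v + (-1 * (f v * expcos s v) +
     (- complex.Re h * (v * f v * expcos s v) + complex.Im h * (v * f v * expsin s v)))).
    rewrite !(ReD, ReN, ReM) /=.
    rewrite RintegralD//; last exact: D (Z _ _ a2) (D _ _ (Z _ _ a3) (Z _ _ b3)).
    rewrite RintegralD//; [|exact: Z|exact: D (Z _ _ a3) (Z _ _ b3)].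
    rewrite RintegralD//; [|exact: Z|exact: Z].
    by rewrite !RintegralZl//; ring.
  apply: mW.
    exact: D a1 (D _ _ (Z _ _ a2) (D _ _ (Z _ _ a3) (Z _ _ b3))).
  move=> v; have [h1 h2] := bound v.
  have -> : f v * expcos (s + h) v + (-1 * (f v * expcos s v) +
     (- complex.Re h * (v * f v * expcos s v) + complex.Im h * (v * f v * expsin s v))) =
     f v * (expcos s v * (expcos h v - 1 - complex.Re h * v) +
      (- expsin s v) * (expsin h v - complex.Im h * v)) by rewrite split_cos; ring.
  apply: comb => //; first exact: norm_expcos_le.
  by rewrite normrN; exact: norm_expsin_le.
have -> : complex.Im (laplace f (s + h) - laplace f s - h * laplace (fun v => v * f v) s) =
  \int[mu]_v (f v * expsin (s + h) v + (-1 * (f v * expsin s v) +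
   (- complex.Re h * (v * f v * expsin s v) + - complex.Im h * (v * f v * expcos s v)))).
  rewrite !(ImD, ImN, ImM) /=.
  rewrite RintegralD//; last exact: D (Z _ _ b2) (D _ _ (Z _ _ b3) (Z _ _ a3)).
  rewrite RintegralD//; [|exact: Z|exact: D (Z _ _ b3) (Z _ _ a3)].
  rewrite RintegralD//; [|exact: Z|exact: Z].
  by rewrite !RintegralZl//; ring.
apply: mW.
  exact: D b1 (D _ _ (Z _ _ b2) (D _ _ (Z _ _ b3) (Z _ _ a3))).
move=> v; have [h1 h2] := bound v.
have -> : f v * expsin (s + h) v + (-1 * (f v * expsin s v) +
   (- complex.Re h * (v * f v * expsin s v) + - complex.Im h * (v * f v * expcos s v))) =
   f v * (expcos s v * (expsin h v - complex.Im h * v) +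
    expsin s v * (expcos h v - 1 - complex.Re h * v)) by rewrite split_sin; ring.
by apply: comb => //; [exact: norm_expcos_le|exact: norm_expsin_le].
Qed.

(** With [R[i]] as scalar field, derivability in the direction 1 is complex differentiability. *)
Lemma laplace_entire f s : (forall d, expintegrable d f) ->
  derivable (laplace f : R[i]^o -> R[i]^o) s 1.
Proof.
move=> fi; have [M M0 HM] := laplace_taylor s fi.
set L := laplace (fun v => v * f v) s in HM.
apply/cvg_ex; exists L; apply/cvgrPdist_le => /= e e0.
have e0' : 0 < complex.Re e by move: e0; rewrite ltcE /= => /andP[].
have eE : (complex.Re e)%:C = e by apply: RRe_real; exact: gtr0_real.
(* The bound 1 serves [laplace_taylor]; dividing by M + 1 keeps the radius positive when M = 0. *)
have d0 : 0 < (Num.min 1 (complex.Re e / (M + 1)))%:C :> R[i].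
  by rewrite ltcR lt_min ltr01 divr_gt0// ltr_pwDr.
have near0 := @dnbhs0_le R[i] R[i]^o _ d0.
near=> h.
have h0 : h != 0 by near: h; exact: (@nbhs_dnbhs_neq R[i]^o 0).
have : `|h| <= (Num.min 1 (complex.Re e / (M + 1)))%:C.
  by near: h.
have [n n0 hn] : exists2 n : R, 0 <= n & `|h| = n%:C.
  by exists (Num.sqrt (complex.Re h ^+ 2 + complex.Im h ^+ 2)); rewrite ?sqrtr_ge0 ?normc_def.
rewrite hn lecR le_min => /andP[n1 ne].
have n2 : complex.Re h ^+ 2 + complex.Im h ^+ 2 = n ^+ 2.
  by apply: complexI; rewrite add_Re2_Im2 hn rmorphXn.
have p1 : `|complex.Re h| <= 1.
  rewrite (le_trans _ n1)// -(@ler_pXn2r _ 2)// ?nnegrE// real_normK ?num_real//.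
  by rewrite -n2 lerDl sqr_ge0.
have q1 : `|complex.Im h| <= 1.
  rewrite (le_trans _ n1)// -(@ler_pXn2r _ 2)// ?nnegrE// real_normK ?num_real//.
  by rewrite -n2 lerDr sqr_ge0.
have := HM h p1 q1; rewrite n2 => E.
have np : 0 < n.
  by rewrite lt_neqAle n0 andbT; apply: contra_neqN h0 => /eqP n00;
    apply/eqP; rewrite -normr_eq0 hn -n00.
rewrite [h *: 1]mulr1 /shift/= [h + s]addrC.
have -> : L - h^-1 *: (laplace f (s + h) - laplace f s) =
    - (h^-1 * (laplace f (s + h) - laplace f s - h * L)).
  by rewrite [h^-1 *: _]/(h^-1 * _) [in RHS]mulrBr mulKf// opprB.
rewrite normrN normrM normfV hn -eE.
apply: (@le_trans _ _ (n%:C^-1 * (n ^+ 2 * M)%:C)).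
  by rewrite ler_wpM2l// invr_ge0 ler0c.
rewrite -fmorphV -rmorphM lecR expr2 -mulrA mulKf ?gt_eqF//.
apply: (@le_trans _ _ (n * (M + 1))); first by rewrite ler_wpM2l// lerDl.
by rewrite -ler_pdivlMr// ltr_pwDr.
Unshelve. all: by end_near. Qed.

End laplace_entire.

(** * The Dirichlet series side *)

Section complex_sums.
Context {R : realType}.
Implicit Types (s z : R[i]).

Definition csum (T : choiceType) (f : T -> R[i]) z : Prop :=
  has_sum (fun i => complex.Re (f i)) (complex.Re z) /\
  has_sum (fun i => complex.Im (f i)) (complex.Im z).

Lemma csum_unique (T : choiceType) (f : T -> R[i]) z z' :
  csum f z -> csum f z' -> z = z'.
Proof. by move=> [h1 h2] [h3 h4]; apply: eqC; [exact: has_sum_unique h3|exact: has_sum_unique h4]. Qed.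

Lemma eq_csum (T : choiceType) (f g : T -> R[i]) z : f =1 g -> csum f z -> csum g z.
Proof. by move=> /funext ->. Qed.

Lemma csumZ (T : choiceType) (f : T -> R[i]) c z : csum f z ->
  csum (fun i => c * f i) (c * z).
Proof.
move=> [h1 h2]; split; rewrite ?ReM ?ImM.
  apply: eq_has_sum (has_sumB (has_sumZ (complex.Re c) h1) (has_sumZ (complex.Im c) h2)) => i.
  by rewrite ReM.
apply: eq_has_sum (has_sumD (has_sumZ (complex.Re c) h2) (has_sumZ (complex.Im c) h1)) => i.
by rewrite ImM.
Qed.

Lemma csum_mul (T1 T2 : choiceType) (f : T1 -> R[i]) (g : T2 -> R[i]) z z' :
  csum f z -> csum g z' -> csum (fun p : T1 * T2 => f p.1 * g p.2) (z * z').
Proof.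
move=> [h1 h2] [h3 h4]; split; rewrite ?ReM ?ImM.
  by apply: eq_has_sum (has_sumB (has_sum_mul h1 h3) (has_sum_mul h2 h4)) => i; rewrite ReM.
by apply: eq_has_sum (has_sumD (has_sum_mul h1 h4) (has_sum_mul h2 h3)) => i; rewrite ImM.
Qed.

Lemma csum_reindex (T T' : choiceType) (e : T -> T') (f : T' -> R[i]) z :
  bijective e -> csum f z -> csum (f \o e) z.
Proof. by move=> be [h1 h2]; split; [exact: (has_sum_reindex be h1)|exact: (has_sum_reindex be h2)]. Qed.

Lemma csum_series (f : nat -> R[i]) z : csum f z ->
  (series f : nat -> R[i]^o) @ \oo --> (z : R[i]^o).
Proof.
move=> [/has_sum_series h1 /has_sum_series h2]; apply: cvg_complex.
  by under eq_fun do rewrite Re_series.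
by under eq_fun do rewrite Im_series.
Qed.

Lemma csum_dom (T : choiceType) (f : T -> R[i]) (g : T -> R) t :
  (forall i, `|complex.Re (f i)| <= g i) -> (forall i, `|complex.Im (f i)| <= g i) ->
  nnsum g t -> exists z, csum f z.
Proof.
move=> h1 h2 gt; have [x hx] := has_sum_dom h1 gt; have [y hy] := has_sum_dom h2 gt.
by exists (x +i* y).
Qed.

Lemma csum_parity (f : nat -> R[i]) z : csum f z -> exists z0 z1,
  [/\ csum (fun l => f l.*2) z0, csum (fun l => f l.*2.+1) z1 & z = z0 + z1].
Proof.
move=> [/has_sum_parity[x0 [x1 [h1 h2 e1]]] /has_sum_parity[y0 [y1 [h3 h4 e2]]]].
by exists (x0 +i* y0), (x1 +i* y1); split => //; apply: eqC; rewrite ?ReD ?ImD.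
Qed.

Lemma csum_interleave (f : nat -> R[i]) z0 z1 :
  csum (fun l => f l.*2) z0 -> csum (fun l => f l.*2.+1) z1 ->
  (exists z, csum f z) -> csum f (z0 + z1).
Proof.
move=> h0 h1 [z hz]; have [y0 [y1 [g0 g1 e]]] := csum_parity hz.
by rewrite (csum_unique h0 g0) (csum_unique h1 g1) -e.
Qed.

Lemma cexp_bound s v : `|complex.Re (cexp s v)| <= expR (complex.Re s * v) /\
  `|complex.Im (cexp s v)| <= expR (complex.Re s * v).
Proof. by split; [exact: norm_expcos_le|exact: norm_expsin_le]. Qed.

Lemma zeta_sum s : 1 < complex.Re s ->
  csum (fun n => cexp (- s) (ln n.+1%:R)) (zeta s).
Proof.
move=> s1; have [t ht] := zeta_summable s1.
have [|i|z hz] := @csum_dom _ (fun n => cexp (- s) (ln n.+1%:R)) _ _ _ _ ht.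
- by move=> i; have [h _] := cexp_bound (- s) (ln i.+1%:R); rewrite -ReN.
- by have [_ h] := cexp_bound (- s) (ln i.+1%:R); rewrite -ReN.
suff -> : zeta s = z by [].
rewrite /zeta; apply: (@cvg_lim R[i]^o) => //.
by under eq_fun do rewrite cpowE; exact: csum_series.
Qed.

(** The sum of (-1)^m m^(-s) is twice its even part minus zeta(s), and the even part is 2^(-s)
    zeta(s). Index n stands for m = n + 1, so odd n carry the even m. *)
Lemma alternating_zeta s : 1 < complex.Re s ->
  csum (fun n => (-1) ^+ n.+1 * cexp (- s) (ln n.+1%:R))
    ((2 * cexp (- s) (ln 2) - 1) * zeta s).
Proof.
move=> s1; have hz := zeta_sum s1.
have [z0 [z1 [h0 h1 e]]] := csum_parity hz.
have z1E : z1 = cexp (- s) (ln 2) * zeta s.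
  apply: csum_unique h1 _; apply: eq_csum (csumZ (cexp (- s) (ln 2)) hz) => n.
  rewrite -cexpDr -lnM ?posrE// -natrM; congr (cexp _ (ln _%:R)).
  by rewrite mul2n doubleS.
have -> : (2 * cexp (- s) (ln 2) - 1) * zeta s = -1 * z0 + z1.
  by rewrite mulrBl mul1r {2}e z1E; ring.
apply: csum_interleave.
- apply: eq_csum (csumZ (-1) h0) => n.
  by rewrite exprS -mul2n exprM sqrrN expr1n expr1n mulr1.
- apply: eq_csum h1 => n.
  by rewrite -doubleS -mul2n exprM sqrrN expr1n expr1n mul1r.
have [t ht] := zeta_summable s1.
apply: csum_dom ht => i.
  rewrite -ReN; have [h _] := cexp_bound (- s) (ln i.+1%:R); move: h.
  by rewrite -signr_odd; case: odd => /=; rewrite ?expr0 ?expr1 ?mulN1r ?mul1r ?mul0r ?oppr0 ?mul0r ?subr0 ?addr0 ?normrN.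
rewrite -ReN; have [_ h] := cexp_bound (- s) (ln i.+1%:R); move: h.
by rewrite -signr_odd; case: odd => /=; rewrite ?expr0 ?expr1 ?mulN1r ?mul1r ?mul0r ?oppr0 ?mul0r ?subr0 ?addr0 ?normrN.
Qed.

End complex_sums.

(** * Termwise transforms of unconditional series *)

Section laplace_sums.
Context {R : realType}.
Local Notation mu := (@lebesgue_measure R).
Implicit Types (s : R[i]) (c : R).

Lemma nnsum_partial_le (f : nat -> R) S n : nnsum f S -> \sum_(i < n) f i <= S.
Proof.
move=> fS; have hs : nondecreasing_seq (series f).
  by apply: nondecreasing_series => i _ _; have [] := fS.
have hc := nnsum_series fS.
rewrite -(big_mkord xpredT f) -(cvg_lim _ hc)//.
by apply: (nondecreasing_cvgn_le hs); apply/cvg_ex; exists S.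
Qed.

Lemma expintegrable_Rintegral c (h : R -> R) : expintegrable c h ->
  (\int[mu]_v (h v * expR (c * v))%:E = (\int[mu]_v (h v * expR (c * v)))%:E)%E.
Proof. by move=> [_ hi]; rewrite /Rintegral fineK//; exact: integrable_fin_num. Qed.

Lemma norm_laplace_le (f h : R -> R) s : (forall v, `|f v| <= h v) ->
  expintegrable (complex.Re s) f -> expintegrable (complex.Re s) h ->
  `|complex.Re (laplace f s)| <= \int[mu]_v (h v * expR (complex.Re s * v)) /\
  `|complex.Im (laplace f s)| <= \int[mu]_v (h v * expR (complex.Re s * v)).
Proof.
move=> fh fi [_ hi].
have le (k : R -> R) : (forall v, `|k v| <= expR (complex.Re s * v)) ->
    mu.-integrable setT (EFin \o (fun v => f v * k v)) ->
    `|\int[mu]_v (f v * k v)| <= \int[mu]_v (h v * expR (complex.Re s * v)).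
  move=> hk ik; apply: le_trans (le_normr_Rintegral measurableT ik) _.
  apply: le_Rintegral => //; first exact: integrable_norm.
  by move=> v _ /=; rewrite normrM ler_pM.
split; apply: le.
- exact: norm_expcos_le.
- exact: integrable_expcos.
- exact: norm_expsin_le.
- exact: integrable_expsin.
Qed.

(** Tonelli for series: the integral of the sum is the finite sum of the integrals. *)
Lemma expintegrable_nnsum c (h : nat -> R -> R) (g : R -> R) S :
  (forall n, expintegrable c (h n)) -> (forall v, nnsum (fun n => h n v) (g v)) ->
  nnsum (fun n => \int[mu]_v (h n v * expR (c * v))) S -> expintegrable c g.
Proof.
move=> hi hg hS; have h0 n v : 0 <= h n v by have [] := hg v.
have g0 v : 0 <= g v by exact: nnsum_ge0 (hg v).
have mh n : measurable_fun setT (h n) by have [] := hi n.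
have mg : measurable_fun setT g.
  apply: (measurable_fun_cvg (h := fun n v => \sum_(0 <= i < n) h i v)) => //.
    by move=> n; have [] := @expintegrable_sum _ c _ (index_iota 0 n) _ hi.
  by move=> v _; exact: nnsum_series (hg v).
split => //; apply/integrableP; split.
  by apply/measurable_EFinP; apply: measurable_funM => //; exact: measurable_expR_linear.
have hE0 n v : (0 <= (h n v * expR (c * v))%:E)%E by rewrite lee_fin mulr_ge0 ?expR_ge0.
have -> : (\int[mu]_v `|(EFin \o (fun v => (g v * expR (c * v))%R)) v|)%E =
    (\int[mu]_v (\sum_(n <oo) (h n v * expR (c * v))%:E))%E.
  apply: eq_integral => v _ /=.
  rewrite ger0_norm ?mulr_ge0 ?expR_ge0//; apply/esym; rewrite nneseries_esumT//.
  rewrite [g v * _]mulrC; have [_ <-] := nnsumZ (expR_ge0 (c * v)) (hg v).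
  by apply: eq_esum => n _; rewrite mulrC.
rewrite integral_nneseries//; last first.
  by move=> n; apply/measurable_EFinP; apply: measurable_funM; [exact: mh|exact: measurable_expR_linear].
rewrite nneseries_esumT; last by move=> n; exact: integral_ge0.
under eq_esum do rewrite expintegrable_Rintegral//.
by have [_ ->] := hS; rewrite ltry.
Qed.

(** Domination of the integrals yields an unconditional sum z; dominated convergence identifies the
    limit of its ordered partial sums with [laplace F s]. *)
Lemma laplace_csum_nat (f h : nat -> R -> R) (F g : R -> R) S s :
  (forall n v, `|f n v| <= h n v) ->
  (forall n, expintegrable (complex.Re s) (f n)) ->
  (forall n, expintegrable (complex.Re s) (h n)) ->
  (forall v, nnsum (fun n => h n v) (g v)) ->
  nnsum (fun n => \int[mu]_v (h n v * expR (complex.Re s * v))) S ->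
  (forall v, has_sum (fun n => f n v) (F v)) ->
  csum (fun n => laplace (f n) s) (laplace F s).
Proof.
move=> fh fi hi hg hS fF.
have [z hz] : exists z, csum (fun n => laplace (f n) s) z.
  by apply: csum_dom hS => i; have [] := norm_laplace_le (fh i) (fi i) (hi i).
suff -> : laplace F s = z by [].
have gi := expintegrable_nnsum hi hg hS.
have [|_ hF] := laplace_series fi gi _ (fun v => has_sum_series (fF v)).
  move=> v n; apply: le_trans (ler_norm_sum _ _ _) _.
  apply: (@le_trans _ _ (\sum_(i < n) h i v)); first by apply: ler_sum => i _; exact: fh.
  exact: (nnsum_partial_le n (hg v)).
exact: (cvg_unique _ hF (csum_series hz)).
Qed.

(** Transport along an enumeration of the pairs, since dominated convergence runs over sequences. *)
Lemma laplace_csum (f h : nat * nat -> R -> R) (F g : R -> R) S s :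
  (forall n v, `|f n v| <= h n v) ->
  (forall n, expintegrable (complex.Re s) (f n)) ->
  (forall n, expintegrable (complex.Re s) (h n)) ->
  (forall v, nnsum (fun n => h n v) (g v)) ->
  nnsum (fun n => \int[mu]_v (h n v * expR (complex.Re s * v))) S ->
  (forall v, has_sum (fun n => f n v) (F v)) ->
  csum (fun n => laplace (f n) s) (laplace F s).
Proof.
move=> fh fi hi hg hS fF.
have [e [d ed de]] : exists e : nat -> nat * nat, bijective e.
  have /card_esym/ppcard_eqP[e] := card_nat2.
  by exists e; rewrite -setTT_bijective.
have be : bijective e by exists d.
have : csum (fun n => laplace (f (e n)) s) (laplace F s).
  apply: (@laplace_csum_nat (f \o e) (h \o e) F g S) => [n v|n|n|v||v].
  - exact: fh.
  - exact: fi.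
  - exact: hi.
  - exact: (nnsum_reindex be (hg v)).
  - exact: (nnsum_reindex be hS).
  - exact: (has_sum_reindex be (fF v)).
move=> /(csum_reindex (Bijective de ed)); apply: eq_csum => p /=.
by rewrite de.
Qed.

End laplace_sums.

(** * The Mellin transform of y^2 W *)

Section mellin_lambert.
Context {R : realType}.
Local Notation mu := (@lebesgue_measure R).
Implicit Types (s : R[i]) (c : R).

Lemma cexp_natmul n (x : R) : 0 < x -> cexp n%:R (ln x) = (x ^+ n)%:C.
Proof.
move=> x0; have hn : (n%:R : R[i]) = (n%:R : R)%:C by rewrite rmorph_nat.
rewrite hn; apply: eqC; rewrite /= /expcos /expsin /= !mul0r ?cos0 ?sin0 ?mulr0// mulr1.
by rewrite expRM_natl lnK.
Qed.

Lemma cexp_real (x v : R) : cexp x%:C v = (expR (x * v))%:C.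
Proof. by apply: eqC; rewrite /= /expcos /expsin /= mul0r ?cos0 ?sin0 ?mulr1 ?mulr0. Qed.

Lemma cexpNr s (v : R) : cexp s (- v) = cexp (- s) v.
Proof. by rewrite /cexp /expcos /expsin ReN ImN !mulrN !mulNr. Qed.

Lemma laplace_gamma_kernel2 c s : 0 < c -> 0 < complex.Re s ->
  laplace (fun v => expR (2 * v) * gamma_kernel c v) s =
  cexp (s + 2) (- ln c) * Gamma (s + 2).
Proof.
move=> c0 s0; rewrite laplace_expR.
have -> : (2 : R)%:C = 2 :> R[i] by rewrite rmorph_nat.
by rewrite laplace_gamma_kernel// ReD /= addr_gt0.
Qed.

(** Up to sign and weight, the term (b, x) has transform (pi b x)^(-s-2) Gamma(s+2). The weight b^2
    x leaves b^(-s) x^(-s-1), and the sign splits as well, so the double sum is a product of two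
    series. *)
Lemma laplace_lambert (W : R -> R) s : 1 < complex.Re s ->
  (forall v, has_sum (fun p : nat * nat =>
    (-1) ^+ (p.1.+1 + p.2.+1) * p.1.+1%:R ^+ 2 * p.2.+1%:R *
    wexp (pi * expR v) (p.1.+1 * p.2.+1)) (W v)) ->
  laplace (fun v => expR (2 * v) * W v) s =
  cexp (s + 2) (- ln pi) * Gamma (s + 2) *
  (((2 * cexp (- s) (ln 2) - 1) * zeta s) *
   ((2 * cexp (- (s + 1)) (ln 2) - 1) * zeta (s + 1))).
Proof.
move=> s1 hW; have s0 : 0 < complex.Re s by rewrite (lt_trans ltr01).
have pi0 := pi_gt0 R.
pose K (p : nat * nat) : R := pi * (p.1.+1%:R * p.2.+1%:R).
pose co (p : nat * nat) : R := p.1.+1%:R ^+ 2 * p.2.+1%:R.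
pose sg (p : nat * nat) : R := (-1) ^+ (p.1.+1 + p.2.+1).
pose k (p : nat * nat) v := expR (2 * v) * gamma_kernel (K p) v.
have K0 p : 0 < K p by rewrite /K !mulr_gt0.
have co0 p : 0 <= co p by rewrite /co mulr_ge0// exprn_ge0.
have sg1 p : `|sg p| = 1 by rewrite /sg normrX normrN1 expr1n.
have k0 p v : 0 <= k p v by rewrite /k mulr_ge0 ?expR_ge0.
have kE p v : expR (2 * v) * wexp (pi * expR v) (p.1.+1 * p.2.+1) = k p v.
  rewrite /k /gamma_kernel /wexp /K natrM; congr (_ * expR (- _)); ring.
have lnK p : ln (K p) = ln pi + (ln p.1.+1%:R + ln p.2.+1%:R).
  by rewrite /K !lnM ?posrE// mulr_gt0.
have ki p d : - 2 < d -> expintegrable d (k p).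
  by move=> d2; apply: expintegrable_expR; apply: expintegrable_gamma_kernel => //; lra.
have ki' p : expintegrable (complex.Re s) (k p) by apply: ki; lra.
have coE z p : (co p)%:C * cexp (z + 2) (- ln (K p)) = cexp (z + 2) (- ln pi) *
    (cexp (- z) (ln p.1.+1%:R) * cexp (- (z + 1)) (ln p.2.+1%:R)).
  rewrite /co rmorphM /= -cexp_natmul// -[_%:C](@cexp_natmul 1) ?expr1//.
  rewrite lnK [- (ln pi + _)]opprD [- (ln _ + _)]opprD !cexpDr !(cexpNr (z + 2)).
  rewrite (_ : - z = 2 + - (z + 2)); last by ring.
  rewrite (_ : - (z + 1) = 1 + - (z + 2)); last by ring.
  by rewrite !(cexpDl _ (- (z + 2))); ring.
have [r1 hr1] := zeta_summable s1.
have s2 : 1 < complex.Re s + 1 by lra.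
have [r2 hr2] := zeta_summable s2.
(* The same computation at the real point Re s evaluates the integrals of the absolute values; their
   sum is a product of two convergent zeta series. *)
pose c := complex.Re s.
have cE : (c%:C : R[i]) + 2 = (c + 2)%:C by rewrite rmorphD /= rmorph_nat.
have cE1 : - (c%:C + 1) = (- (c + 1))%:C :> R[i] by rewrite rmorphN rmorphD.
have coR p : co p * expR ((c + 2) * - ln (K p)) = expR ((c + 2) * - ln pi) *
    (expR (- c * ln p.1.+1%:R) * expR (- (c + 1) * ln p.2.+1%:R)).
  have := coE c%:C p; rewrite cE cE1 -(rmorphN (real_complex R)) !cexp_real -!rmorphM.
  exact: complexI.
pose G := complex.Re (Gamma (c + 2)%:C).
have G0 : 0 <= G.
  rewrite /G Gamma_laplace; apply: Rintegral_ge0 => // v _.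
  by rewrite mulr_ge0 ?expR_ge0// /expcos /= mul0r cos0 mulr1 expR_ge0.
have intE p : \int[mu]_v (co p * k p v * expR (c * v)) =
    G * expR ((c + 2) * - ln pi) *
    (expR (- c * ln p.1.+1%:R) * expR (- (c + 1) * ln p.2.+1%:R)).
  have E : complex.Re (laplace (k p) c%:C) = \int[mu]_v (k p v * expR (c * v)).
    by apply: eq_Rintegral => v _; rewrite /expcos /= mul0r cos0 mulr1.
  rewrite (@eq_Rintegral _ _ _ mu setT (fun v => co p * (k p v * expR (c * v)))).
    rewrite RintegralZl//; last by have [] := ki' p.
    rewrite -E laplace_gamma_kernel2// cE cexp_real ReM [complex.Im _%:C]/= mul0r subr0 -/G.
    by rewrite mulrA coR; ring.
  by move=> v _; rewrite mulrA.
have h : csum (fun p => laplace (fun v => sg p * (co p * k p v)) s)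
    (laplace (fun v => expR (2 * v) * W v) s).
  have [r hr] : exists r, nnsum (fun p => \int[mu]_v (co p * k p v * expR (complex.Re s * v))) r.
    eexists; apply: eq_nnsum (nnsumZ _ (nnsum_mul hr1 hr2)) => [p|].
      by rewrite intE.
    by rewrite mulr_ge0 ?expR_ge0.
  have gE v : exists t, nnsum (fun p => co p * k p v) t.
    have t0 : 0 < pi * expR v by rewrite mulr_gt0 ?expR_gt0.
    have [t ht] := lambert_summable 2 1 t0.
    eexists; apply: eq_nnsum (nnsumZ (expR_ge0 (2 * v)) ht) => p.
    by rewrite -kE /co expr1; ring.
  have [g hg] := choice gE.
  apply: (@laplace_csum _ _ (fun p v => co p * k p v) _ g r) => //.
  - by move=> p v; rewrite normrM sg1 mul1r ger0_norm// mulr_ge0.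
  - by move=> p; exact/expintegrableZ/expintegrableZ.
  - by move=> p; exact: expintegrableZ.
  move=> v; apply: eq_has_sum (has_sumZ (expR (2 * v)) (hW v)) => p.
  rewrite -kE /co /sg; ring.
apply: (csum_unique h).
have := csumZ (cexp (s + 2) (- ln pi) * Gamma (s + 2))
  (csum_mul (alternating_zeta s1) (@alternating_zeta _ (s + 1) _)).
move=> hz; apply: eq_csum (hz _) => [p|]; last by rewrite ReD.
rewrite laplaceZ; last exact: expintegrableZ.
rewrite laplaceZ// laplace_gamma_kernel2// [(co p)%:C * _]mulrA coE /=.
by rewrite /sg rmorphXn rmorphN1 exprD /=; ring.
Qed.

End mellin_lambert.

(** * Comparison with the completed zeta function *)

Section completed_zeta.
Context {R : realType}.
Implicit Types s : R[i].

Lemma cexp_half (x : R) : 0 < x -> cexp (1 / 2) (ln x) = (Num.sqrt x)%:C.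
Proof.
move=> x0; have -> : (1 / 2 : R[i]) = (1 / 2 : R)%:C by rewrite rmorphM fmorphV rmorph1 rmorph_nat.
rewrite cexp_real; congr (_%:C).
rewrite -[LHS]ger0_norm ?expR_ge0// -sqrtr_sqr -expRM_natl; congr Num.sqrt.
by rewrite mulrA mul1r divff ?pnatr_eq0// mul1r lnK.
Qed.

(** In terms of u = 2^(s/2), w = pi^(s/2) and the roots of 2 and pi every exponential is a monomial.
    Duplication and Gamma(s+2) = (s+1) s Gamma(s) then leave a rational identity. *)
Lemma completed_zeta_product s : 1 < complex.Re s ->
  s * (s + 1) / (32 * pi ^+ 2 * Num.sqrt 2)%:C *
    (cpow 2 (s / 2) - cpow 2 (- (s / 2))) *
    (cpow 2 ((s - 1) / 2) - cpow 2 (- ((s - 1) / 2))) *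
    zeta_star s * zeta_star (s + 1) =
  32^-1 * (cexp (s + 2) (- ln pi) * Gamma (s + 2) *
    (((2 * cexp (- s) (ln 2) - 1) * zeta s) *
     ((2 * cexp (- (s + 1)) (ln 2) - 1) * zeta (s + 1)))).
Proof.
move=> s1; have s0 : 0 < complex.Re s by rewrite (lt_trans ltr01).
have pi0 := pi_gt0 R.
have s10 : 0 < complex.Re (s + 1) by rewrite ReD /= addr_gt0.
have dup := Gamma_duplication s0.
have -> : s + 2 = s + 1 + 1 by ring.
rewrite !Gamma_succ//.
rewrite /zeta_star !cpowE.
set u := cexp (s / 2) (ln 2); set w := cexp (s / 2) (ln pi).
set r2 := (Num.sqrt 2 : R)%:C; set rp := (Num.sqrt (pi : R))%:C.
have r22 : r2 ^+ 2 = 2 by rewrite /r2 -rmorphXn /= sqr_sqrtr// rmorph_nat.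
have rp2 : rp ^+ 2 = (pi : R)%:C by rewrite /rp -rmorphXn /= sqr_sqrtr// ltW.
have h2 : cexp (1 / 2) (ln 2) = r2 by rewrite cexp_half.
have hp : cexp (1 / 2) (ln pi) = rp by rewrite cexp_half.
have u0 : u != 0 := cexp_neq0 _ _.
have w0 : w != 0 := cexp_neq0 _ _.
have r20 : r2 != 0 by rewrite -h2 cexp_neq0.
have rp0 : rp != 0 by rewrite -hp cexp_neq0.
have Es2 : cexp s (ln 2) = u ^+ 2 by rewrite expr2 -cexpDl -splitr.
have Esp : cexp s (ln pi) = w ^+ 2 by rewrite expr2 -cexpDl -splitr.
have E1 : cexp (- (s / 2)) (ln 2) = u^-1 by rewrite cexpNl.
have E2 : cexp ((s - 1) / 2) (ln 2) = u / r2.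
  by rewrite mulrBl cexpDl cexpNl h2.
have E3 : cexp (- ((s - 1) / 2)) (ln 2) = r2 / u by rewrite cexpNl E2 invf_div.
have E4 : cexp (- (s / 2)) (ln pi) = w^-1 by rewrite cexpNl.
have E5 : cexp (- ((s + 1) / 2)) (ln pi) = (w * rp)^-1.
  by rewrite cexpNl mulrDl cexpDl hp.
have E6 : cexp (- s) (ln 2) = (u ^+ 2)^-1 by rewrite cexpNl Es2.
have E7 : cexp (- (s + 1)) (ln 2) = (u ^+ 2 * 2)^-1.
  rewrite cexpNl cexpDl Es2; congr (_ * _)^-1.
  by rewrite -[1]/(1%:R) cexp_natmul// expr1 rmorph_nat.
have E8 : cexp (s + 1 + 1) (- ln pi) = (w ^+ 2 * rp ^+ 4)^-1.
  rewrite cexpNr cexpNl !cexpDl Esp -mulrA -expr2 -[1]/(1%:R) cexp_natmul// expr1.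
  by rewrite -rp2 -exprM.
have E9 : cexp s (- ln 2) = (u ^+ 2)^-1 by rewrite cexpNr E6.
have E10 : (32 * pi ^+ 2 * Num.sqrt 2)%:C = 32 * rp ^+ 4 * r2 :> R[i].
  by rewrite !rmorphM /= rmorph_nat -/r2 -rp2; ring.
rewrite E9 in dup.
rewrite E1 E2 E3 E4 E5 E6 E7 E8 E10.
transitivity (s * (s + 1) / (32 * rp ^+ 4 * r2) * (u - u^-1) * (u / r2 - r2 / u) *
  w^-1 * (w * rp)^-1 * (Gamma (s / 2) * Gamma ((s + 1) / 2)) * (zeta s * zeta (s + 1))).
  by ring.
rewrite dup -/rp.
(* The roots of 2 are gathered into [r2 ^+ 2], so that [r22] can remove them before the last
   [field]. *)
transitivity (s * (s + 1) / (32 * rp ^+ 4) * (u - u^-1) * (u / r2 ^+ 2 - u^-1) *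
  w^-1 * (w * rp)^-1 * (2 * rp / u ^+ 2 * Gamma s) * (zeta s * zeta (s + 1))).
  by field; rewrite u0 w0 rp0 r20.
rewrite r22.
by field; rewrite u0 w0 rp0.
Qed.

End completed_zeta.

(** * Arithmetic of the coefficients *)

Lemma mem_divisors n d : (0 < n)%N -> (d \in divisors n) = (d %| n)%N.
Proof. by move=> n0; rewrite -dvdn_divisors. Qed.

(** Divisors of m n are products d e in a unique way: the gcds with m and n recover the factors. *)
Lemma sigma1M m n : (0 < m)%N -> (0 < n)%N -> coprime m n ->
  sigma1 (m * n) = (sigma1 m * sigma1 n)%N.
Proof.
move=> m0 n0 co; rewrite /sigma1.
have mn0 : (0 < m * n)%N by rewrite muln_gt0 m0.
rewrite (perm_big [seq (d * e)%N | d <- divisors m, e <- divisors n]); last first.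
  apply: uniq_perm; first exact: divisors_uniq.
    apply: allpairs_uniq; [exact: divisors_uniq|exact: divisors_uniq|].
    have key d e : (d %| m)%N -> (e %| n)%N -> gcdn m (d * e) = d.
      move=> dm en; rewrite Gauss_gcdl; first exact/gcdn_idPr.
      exact: coprime_dvdr en co.
    have key' d e : (d %| m)%N -> (e %| n)%N -> gcdn n (d * e) = e.
      move=> dm en; rewrite Gauss_gcdr; first exact/gcdn_idPr.
      by apply: coprime_dvdr dm _; rewrite coprime_sym.
    move=> x y /allpairsP[[d e] /= [dm en ->]] /allpairsP[[d' e'] /= [dm' en' ->]] /= E.
    rewrite !mem_divisors// in dm en dm' en'.
    by rewrite -(key d e)// -{2}(key' d e)// E key// key'.
  move=> x; rewrite mem_divisors//; apply/idP/allpairsP => [xmn|[[d e] /= [dm en ->]]].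
    exists (gcdn x m, gcdn x n) => /=; rewrite !mem_divisors// !dvdn_gcdr; split => //.
    apply/eqP; rewrite eqn_dvd; apply/andP; split; last first.
      rewrite Gauss_dvd ?dvdn_gcdl//.
      exact: coprime_dvdl (dvdn_gcdr _ _) (coprime_dvdr (dvdn_gcdr _ _) co).
    rewrite muln_gcdl !muln_gcdr !dvdn_gcd xmn andbT dvdn_mulr//= dvdn_mulr//=.
    by rewrite dvdn_mull.
  by rewrite dvdn_mul// -mem_divisors.
by rewrite big_allpairs_dep big_distrlr.
Qed.

(** Strong induction, splitting off the full power of the least prime factor. *)
Lemma odd_multiplicative_sigma1 f m : arith_multiplicative f ->
  (forall p k : nat, prime p -> odd p -> f (p ^ k)%N = sigma1 (p ^ k)%N) ->
  odd m -> f m = sigma1 m.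
Proof.
move=> [f1 fM] fp; elim/ltn_ind: m => m ih om.
have [->|m1] := eqVneq m 1%N; first by rewrite f1 /sigma1 /= big_seq1.
have m0 : (0 < m)%N by case: m om {ih m1}.
have pp : prime (pdiv m) by apply: pdiv_prime; case: m om m1 {ih m0} => [|[]].
have op : odd (pdiv m) by exact: dvdn_odd (pdiv_dvd m) om.
have [m' co E] := pfactor_coprime pp m0.
set k := logn _ _ in E.
have k0 : (0 < k)%N by rewrite logn_gt0 mem_primes pp m0 pdiv_dvd.
have m'0 : (0 < m')%N by move: m0; rewrite E muln_gt0 => /andP[].
have cop : coprime m' (pdiv m ^ k)%N by rewrite coprime_sym coprimeXl.
have pk0 : (0 < pdiv m ^ k)%N by rewrite expn_gt0 prime_gt0.
have fE : f m = (f m' * f (pdiv m ^ k))%N by rewrite -fM// -E.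
have sE : sigma1 m = (sigma1 m' * sigma1 (pdiv m ^ k))%N by rewrite -sigma1M// -E.
have om' : odd m' by apply: dvdn_odd om; rewrite E dvdn_mulr.
rewrite fE sE (fp _ _ pp op) ih// [ltnRHS]E ltn_Pmulr//.
by rewrite -(expn0 (pdiv m)) ltn_exp2l// prime_gt1.
Qed.

Lemma odd_part n : (0 < n)%N -> exists k m, odd m /\ n = (2 ^ k * m)%N.
Proof.
move=> n0; have [m co ->] := @pfactor_coprime 2 n isT n0.
by exists (logn 2 n), m; rewrite mulnC -coprime2n.
Qed.

(** An odd codivisor forces d to contain all of 2^k, so d = 2^k e with e dividing m. *)
Lemma odd_codivisor_sum k m : odd m ->
  (\sum_(d <- divisors (2 ^ k * m) | odd ((2 ^ k * m) %/ d)) d = 2 ^ k * sigma1 m)%N.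
Proof.
move=> om; have m0 : (0 < m)%N by case: m om.
have k0 : (0 < 2 ^ k)%N by rewrite expn_gt0.
have N0 : (0 < 2 ^ k * m)%N by rewrite muln_gt0 k0.
rewrite /sigma1 big_distrr -big_filter /=.
rewrite -(big_map (fun d => 2 ^ k * d)%N xpredT id) /=.
apply: perm_big; apply: uniq_perm.
- by rewrite filter_uniq// divisors_uniq.
- rewrite map_inj_uniq ?divisors_uniq// => x y /eqP.
  by rewrite eqn_pmul2l// => /eqP.
move=> d; rewrite mem_filter mem_divisors//; apply/andP/mapP => [[]|[e]].
  move=> ox dN; have E := divnK dN; set x := (_ %/ d)%N in ox E.
  have : (2 ^ k %| x * d)%N by rewrite E dvdn_mulr.
  rewrite Gauss_dvdr; last by rewrite coprimeXl// coprime2n.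
  move=> /dvdnP[e de]; exists e; last by rewrite mulnC.
  rewrite mem_divisors//; apply/dvdnP; exists x; apply/eqP.
  by rewrite -(eqn_pmul2l k0) -E de; apply/eqP; ring.
rewrite mem_divisors// => em ->; split; last by rewrite dvdn_pmul2l.
by rewrite divnMl// (dvdn_odd _ om)// dvdn_div.
Qed.

Section arithmetic_coefficients.
Variables a b : nat -> nat.
Hypothesis a_mult : arith_multiplicative a.
Hypothesis a_odd : forall p f : nat, prime p -> odd p -> a (p ^ f)%N = sigma1 (p ^ f)%N.
Hypothesis a_two : forall f : nat, a (2 ^ f)%N = (2 ^ f)%N.
Hypothesis b_mult : arith_multiplicative b.
Hypothesis b_odd : forall p f : nat, prime p -> odd p -> b (p ^ f)%N = sigma1 (p ^ f)%N.
Hypothesis b_two : forall f : nat, (1 <= f)%N -> b (2 ^ f)%N = 0%N.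

(** The right side is the coefficient of q^n in A: pairs d x = n with x odd, weighted by d. *)
Lemma a_divisor_sum n : (0 < n)%N ->
  a n = (\sum_(d <- divisors n | odd (n %/ d)) d)%N.
Proof.
move=> /odd_part[k [m [om ->]]]; rewrite odd_codivisor_sum//.
have m0 : (0 < m)%N by case: m om.
rewrite a_mult.2 ?expn_gt0// ?coprimeXl ?coprime2n// a_two.
by rewrite (odd_multiplicative_sigma1 a_mult).
Qed.

(** The right side is the coefficient of q^n in B. For d dividing n, both d and n/d are odd exactly
    when n is, so the sum is complete for odd n and empty for even n. *)
Lemma b_divisor_sum n : (0 < n)%N ->
  b n = (\sum_(d <- divisors n | odd d && odd (n %/ d)) d)%N.
Proof.
move=> n0; have odds d : d \in divisors n -> odd d && odd (n %/ d) = odd n.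
  by rewrite mem_divisors// => /divnK {2}<-; rewrite oddM andbC.
rewrite big_seq_cond; have [on|en] := boolP (odd n).
  rewrite (odd_multiplicative_sigma1 b_mult)// /sigma1 big_seq.
  by apply: eq_bigl => d; have [/odds ->|//] := boolP (d \in _).
rewrite big_pred0; last by move=> d; have [/odds ->|//] := boolP (d \in _); exact: negbTE.
have [k [m [om nE]]] := odd_part n0; have m0 : (0 < m)%N by case: m om {nE}.
have k0 : (0 < k)%N.
  by rewrite lt0n; apply: contra en => /eqP k0; rewrite nE k0 mul1n.
by rewrite nE b_mult.2 ?expn_gt0// ?coprimeXl ?coprime2n// b_two.
Qed.

End arithmetic_coefficients.

(** Regrouping by the product of the two positive integers; the fibre over n + 1 sits in a finite
    square, and its rows that are not divisors vanish. *)
Lemma has_sum_divisors (R : realType) (f : nat -> nat -> R) s :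
  has_sum (fun p : nat * nat => f p.1.+1 p.2.+1) s ->
  has_sum (fun n => \sum_(d <- divisors n.+1) f d (n.+1 %/ d)%N) s.
Proof.
move=> /(has_sum_regroup (fun p => (p.1.+1 * p.2.+1).-1))[r hr rs].
apply: eq_has_sum rs => n; apply: has_sum_unique (hr n) _.
pose g (p : nat * nat) := if (p.1.+1 * p.2.+1).-1 == n then f p.1.+1 p.2.+1 else 0.
have g0 i j : (n.+1 <= i)%N || (n.+1 <= j)%N -> g (i, j) = 0.
  rewrite /g /= => h; case: eqP => // E; exfalso; move: h; rewrite -E; nia.
rewrite (_ : (\sum_(d <- _) _) = \sum_(i < n.+1) \sum_(j < n.+1) g (val i, val j)).
  exact: has_sum_fin2.
have gE (i : nat) : (i < n.+1)%N -> \sum_(j < n.+1) g (i, val j) =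
    if (i.+1 %| n.+1)%N then f i.+1 (n.+1 %/ i.+1)%N else 0.
  move=> lin; case: ifPn => [dv|ndv]; last first.
    apply: big1 => j _; rewrite /g /=; case: eqP => // E; case/negP: ndv.
    by apply/dvdnP; exists j.+1; rewrite mulnC; lia.
  have E := divnK dv; have q0 : (0 < n.+1 %/ i.+1)%N by rewrite divn_gt0.
  have ql : ((n.+1 %/ i.+1).-1 < n.+1)%N by rewrite prednK// leq_div.
  rewrite (bigD1 (Ordinal ql))//= big1 ?addr0 => [|j nj].
    rewrite /g [X in X == n](_ : _ = n); first by rewrite eqxx /= prednK.
    by rewrite [(_, _).2]/= prednK// [X in X.-1]mulnC E.
  rewrite /g /=; case: eqP => // F; case/eqP: nj; apply: val_inj => /=.
  have -> : (n.+1 %/ i.+1 = j.+1)%N by rewrite -(@mulKn j.+1 i.+1)//; congr divn; lia.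
  by [].
rewrite [RHS](eq_bigr _ (fun (i : 'I_n.+1) _ => gE i (ltn_ord i))).
rewrite -big_mkcond/=.
rewrite (perm_big [seq i <- index_iota 1 n.+2 | (i %| n.+1)%N]); last first.
  apply: uniq_perm; [exact: divisors_uniq|by rewrite filter_uniq// iota_uniq|].
  move=> d; rewrite mem_divisors// mem_filter mem_index_iota.
  by case: (boolP (d %| _)%N) => // dv; rewrite (dvdn_gt0 _ dv)//= ltnS dvdn_leq.
rewrite big_filter big_add1 /= big_mkord.
by [].
Qed.

(** * The Bessel series side *)

Section theta_product.
Context {R : realType}.
Implicit Types s : R[i].

(** Translating v by (ln D - ln C)/2 balances both coefficients to sqrt (C D). The resulting factor
    (D/C)^(s/2) is the source of (j/d^2)^(s/2) in c_j. *)
Lemma laplace_bessel_kernel (C D : R) s : 0 < C -> 0 < D ->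
  laplace (bessel_kernel C D) s =
  cexp s ((ln D - ln C) / 2) * (2 * besselK s (2 * Num.sqrt (C * D))).
Proof.
move=> C0 D0; rewrite besselK_laplace [2 * _]mulrC mulfK ?pnatr_eq0//.
set c := Num.sqrt (C * D).
have c0 : 0 < c by rewrite sqrtr_gt0 mulr_gt0.
have cE : c = expR ((ln C + ln D) / 2).
  rewrite /c -{1}[C]lnK ?posrE// -{1}[D]lnK ?posrE// -expRD.
  rewrite [X in expR X](_ : _ = 2%:R * ((ln C + ln D) / 2)); last by field.
  by rewrite expRM_natl sqrtr_sqr ger0_norm ?expR_ge0.
rewrite -[(ln D - ln C) / 2]opprK -laplace_translate.
- suff -> : (fun v => bessel_kernel c c (v + - ((ln D - ln C) / 2))) = bessel_kernel C D by [].
  apply/funext => v; rewrite /bessel_kernel cE -!expRD.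
  have C1 : C = expR (ln C) by rewrite lnK.
  have D1 : D = expR (ln D) by rewrite lnK.
  rewrite [in RHS]C1 [in RHS]D1 -!expRD.
  set x := ln C; set y := ln D.
  have -> : (x + y) / 2 + (v + - ((y - x) / 2)) = x + v by field.
  by have -> : (x + y) / 2 + - (v + - ((y - x) / 2)) = y - v by field.
- exact: continuous_bessel_kernel.
- exact: expintegrable_bessel_kernel.
Qed.

(** The exponents l - k take arbitrarily negative values, used for v >= 0, and arbitrarily positive
    ones, used for v < 0. *)
Lemma expintegrable_power_bound (G : R -> R) : measurable_fun setT G ->
  (forall k l : nat, exists C, forall v, `|G v| <= C * expR ((l%:R - k%:R) * v)) ->
  forall d, expintegrable d G.
Proof.
move=> mG hG.
have bound (x : R) : exists2 C, 0 <= C & forall v, `|G v| * expR (x * v) <= C.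
  pose K := (Num.truncn `|x|).+1.
  have xK : `|x| <= K%:R by apply/ltW/Num.Theory.truncnS_gt.
  move: xK; rewrite ler_norml => /andP[xK1 xK2].
  have [C1 h1] := hG K 0%N; have [C2 h2] := hG 0%N K.
  have ge0 C z : (forall v, `|G v| <= C * expR (z * v)) -> 0 <= C.
    by move=> /(_ 0); rewrite mulr0 expR0 mulr1; exact: le_trans.
  have C10 := ge0 _ _ h1; have C20 := ge0 _ _ h2.
  exists (C1 + C2); first exact: addr_ge0.
  have key C z v : 0 <= C -> `|G v| <= C * expR (z * v) -> (z + x) * v <= 0 ->
      `|G v| * expR (x * v) <= C.
    move=> C0 h zx; apply: (@le_trans _ _ (C * expR (z * v) * expR (x * v))).
      by rewrite ler_wpM2r ?expR_ge0.
    by rewrite -mulrA -expRD -mulrDl ler_piMr// -expR0 ler_expR.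
  move=> v; have [v0|v0] := leP 0 v.
    apply: (@le_trans _ _ C1); last by rewrite lerDl.
    by apply: key (h1 v) _ => //; rewrite mulr_le0_ge0//; lra.
  apply: (@le_trans _ _ C2); last by rewrite lerDr.
  by apply: key (h2 v) _ => //; rewrite mulr_ge0_le0 ?(ltW v0)//; lra.
move=> d; have [C1 C10 h1] := bound (d + 1); have [C2 C20 h2] := bound (d - 1).
apply: (@expintegrable_bound R d 1 (C1 + C2)) => // v.
  by rewrite (le_trans (h1 v))// lerDl.
by rewrite (le_trans (h2 v))// lerDr.
Qed.

(** The constant is uniform in t and h, so t = pi y may vary; it serves both A and B. *)
Lemma lambert_sum_bound k : exists C : R, forall (t S : R) (h : nat * nat -> R), 0 < t ->
  (forall p, 0 <= h p <= p.1.+1%:R * wexp t (p.1.+1 * p.2.+1)) -> nnsum h S ->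
  S <= C / t ^+ (3 + k).
Proof.
have [z hz] := @nnsum_inv2 R; have hzz := nnsum_mul hz hz.
exists ((3 + k)`!%:R * (z * z)) => t S h t0 hh hS.
have c0 : 0 <= (3 + k)`!%:R / t ^+ (3 + k) :> R by rewrite divr_ge0// exprn_ge0// ltW.
have := has_sum_le_norm _ (nnsum_has_sum hS) (nnsumZ c0 hzz).
rewrite [_ * (z * z) / _]mulrAC => H; apply: le_trans (ler_norm _) (H _) => p.
have /andP[h0 h1] := hh p; rewrite ger0_norm//; apply: le_trans h1 _.
have := lambert_bound 1 0 k p.1 p.2 t0; rewrite expr1 expr0 mulr1.
exact.
Qed.

End theta_product.

Lemma cexp_half_arg (R : realType) (s : R[i]) (v : R) : cexp (s / 2) v = cexp s (v / 2).
Proof.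
rewrite {2}[s]splitr cexpDl -cexpDr.
by congr cexp; rewrite -splitr.
Qed.

(** * The Bessel terms as transforms *)

Section coefficient_series.
Context {R : realType}.
Variables a b : nat -> nat.
Hypothesis a_sum : forall n, (0 < n)%N ->
  a n = (\sum_(d <- divisors n | odd (n %/ d)) d)%N.
Hypothesis b_sum : forall n, (0 < n)%N ->
  b n = (\sum_(d <- divisors n | odd d && odd (n %/ d)) d)%N.
Implicit Types t A B : R.

Lemma a_lambert t A :
  has_sum (fun p : nat * nat =>
    (odd p.2.+1)%:R * p.1.+1%:R * wexp t (p.1.+1 * p.2.+1)) A ->
  has_sum (fun n => (a n.+1)%:R * wexp t n.+1) A.
Proof.
move=> /(has_sum_divisors (f := fun d x => (odd x)%:R * d%:R * wexp t (d * x))).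
apply: eq_has_sum => n; rewrite a_sum// natr_sum [in RHS]big_mkcond mulr_suml.
apply: eq_big_seq => d; rewrite mem_divisors// => /divnK E.
by rewrite mulnC E; case: odd; rewrite ?mul1r ?mul0r.
Qed.

Lemma b_lambert t B :
  has_sum (fun p : nat * nat =>
    (odd p.1.+1)%:R * (odd p.2.+1)%:R * p.1.+1%:R * wexp t (p.1.+1 * p.2.+1)) B ->
  has_sum (fun n => (b n.+1)%:R * wexp t n.+1) B.
Proof.
move=> /(has_sum_divisors
  (f := fun d x => (odd d)%:R * (odd x)%:R * d%:R * wexp t (d * x))).
apply: eq_has_sum => n; rewrite b_sum// natr_sum [in RHS]big_mkcond mulr_suml.
apply: eq_big_seq => d; rewrite mem_divisors// => /divnK E.
by rewrite [(d * _)%N]mulnC E; do 2 case: odd; rewrite ?mul1r ?mul0r.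
Qed.

(** The part of A(y) B(1/y) with d m = n, at y = e^v. *)
Definition bessel_term n (v : R) : R := \sum_(d <- divisors n)
  (a d)%:R * (b (n %/ d))%:R * bessel_kernel (pi * d%:R) (pi * (n %/ d)%:R) v.

Lemma bessel_term_ge0 n v : 0 <= bessel_term n v.
Proof. by apply: sumr_ge0 => d _; rewrite mulr_ge0 ?expR_ge0. Qed.

Lemma bessel_term_in n d : (0 < n)%N -> d \in divisors n ->
  0 < pi * d%:R :> R /\ 0 < pi * (n %/ d)%:R :> R.
Proof.
move=> n0; rewrite mem_divisors// => dn; have d0 := dvdn_gt0 n0 dn.
by split; rewrite mulr_gt0 ?pi_gt0 ?ltr0n// divn_gt0// dvdn_leq.
Qed.

Lemma laplace_bessel_term n s : (0 < n)%N ->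
  (forall c, expintegrable c (bessel_term n)) /\
  laplace (bessel_term n) s = 2 * (cj a b n s * besselK s (2 * pi * Num.sqrt n%:R)).
Proof.
move=> n0.
(* Off the divisors the summand is set to 0: there d or [n %/ d] may be 0 and the kernel not
   integrable, whereas [expintegrable_sum] ranges over all indices. *)
pose F d v : R := if d \in divisors n then (a d)%:R * (b (n %/ d))%:R *
  bessel_kernel (pi * d%:R) (pi * (n %/ d)%:R) v else 0.
have E : bessel_term n = fun v => \sum_(d <- divisors n) F d v.
  by apply/funext => v; apply: eq_big_seq => d dn; rewrite /F dn.
have Fi d c : expintegrable c (F d).
  have [dn|dn] := boolP (d \in divisors n); rewrite /F ?dn ?(negbTE dn); last exact: expintegrable0.
  have [h1 h2] := bessel_term_in n0 dn.
  exact/expintegrableZ/expintegrable_bessel_kernel.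
split=> [c|]; first by rewrite E; exact: expintegrable_sum.
rewrite E laplace_sum// /cj mulr_suml mulr_sumr; apply: eq_big_seq => d dn.
have [h1 h2] := bessel_term_in n0 dn.
rewrite /F dn laplaceZ; last exact: expintegrable_bessel_kernel.
rewrite laplace_bessel_kernel// cpowE.
have pi0 := pi_gt0 R.
have d0 : 0 < d%:R :> R by rewrite -(pmulr_rgt0 _ pi0).
have m0 : 0 < (n %/ d)%:R :> R by rewrite -(pmulr_rgt0 _ pi0).
have nE : (n%:R : R) = (n %/ d)%:R * d%:R.
  by rewrite -natrM divnK// -mem_divisors.
have -> : 2 * Num.sqrt (pi * d%:R * (pi * (n %/ d)%:R)) = 2 * pi * Num.sqrt (n%:R) :> R.
  rewrite mulrACA -expr2 [_%:R * _%:R]mulrC -nE sqrtrM ?sqr_ge0// sqrtr_sqr gtr0_norm//.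
  by rewrite mulrA.
have -> : ln (n%:R / (d ^ 2)%:R) = ln (pi * (n %/ d)%:R) - ln (pi * d%:R) :> R.
  rewrite [in RHS]lnM ?posrE// [ln (pi * d%:R)]lnM ?posrE// opprD addrACA subrr add0r.
  by rewrite nE natrX expr2 invfM mulrA mulfK ?gt_eqF// ln_div.
rewrite cexp_half_arg rmorphM /= !rmorph_nat; ring.
Qed.

End coefficient_series.

(** * The product A(y) B(1/y) *)

Section theta_function_product.
Context {R : realType}.
Variables a b : nat -> nat.
Hypothesis a_sum : forall n, (0 < n)%N ->
  a n = (\sum_(d <- divisors n | odd (n %/ d)) d)%N.
Hypothesis b_sum : forall n, (0 < n)%N ->
  b n = (\sum_(d <- divisors n | odd d && odd (n %/ d)) d)%N.

Lemma bessel_term_sum : exists G W : R -> R,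
  [/\ forall v, nnsum (fun n => bessel_term a b n.+1 v) (G v),
      forall v, has_sum (fun p : nat * nat =>
        (-1) ^+ (p.1.+1 + p.2.+1) * p.1.+1%:R ^+ 2 * p.2.+1%:R *
        wexp (pi * expR v) (p.1.+1 * p.2.+1)) (W v),
      forall v, 16 * G v = expR (2 * v) * W v &
      forall d, expintegrable d G].
Proof.
have pi0 := pi_gt0 R.
have y0 (v : R) : 0 < pi * expR v by rewrite mulr_gt0 ?expR_gt0.
pose fA (v : R) (p : nat * nat) : R :=
  (odd p.2.+1)%:R * p.1.+1%:R * wexp (pi * expR v) (p.1.+1 * p.2.+1).
pose fB (v : R) (p : nat * nat) : R := (odd p.1.+1)%:R * (odd p.2.+1)%:R *
  p.1.+1%:R * wexp (pi * expR v) (p.1.+1 * p.2.+1).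
have lb (v : R) p : 0 <= p.1.+1%:R * wexp (pi * expR v) (p.1.+1 * p.2.+1).
  by rewrite mulr_ge0 ?wexp_ge0.
have fAb v p : 0 <= fA v p <= p.1.+1%:R * wexp (pi * expR v) (p.1.+1 * p.2.+1).
  rewrite /fA; case: odd; rewrite ?mul1r ?mul0r ?lexx ?andbT ?lb//.
have fBb v p : 0 <= fB v p <= p.1.+1%:R * wexp (pi * expR v) (p.1.+1 * p.2.+1).
  rewrite /fB; case: odd; case: odd; rewrite ?mul1r ?mul0r ?lexx ?andbT ?lb//.
have lam v : exists S : R,
    nnsum (fun p : nat * nat => p.1.+1%:R * wexp (pi * expR v) (p.1.+1 * p.2.+1)) S.
  have [S hS] := lambert_summable 1 0 (y0 v); exists S.
  by apply: eq_nnsum hS => p; rewrite expr0 expr1 mulr1.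
have exA (v : R) : exists S, nnsum (fA v) S.
  by have [S hS] := lam v; exact: nnsum_le hS.
have [A hA] := choice exA.
have exB (v : R) : exists S, nnsum (fB v) S.
  by have [S hS] := lam v; exact: nnsum_le hS.
have [B hB] := choice exB.
have sg1 (p : nat * nat) : `|(-1) ^+ (p.1.+1 + p.2.+1)| = 1 :> R.
  by rewrite normrX normrN1 expr1n.
have exT (v : R) : exists S, has_sum (fun p : nat * nat =>
    (-1) ^+ (p.1.+1 + p.2.+1) * p.1.+1%:R * wexp (pi * expR v) (p.1.+1 * p.2.+1)) S.
  have [S hS] := lam v; apply: has_sum_dom hS => p.
  by rewrite -mulrA normrM sg1 mul1r ger0_norm.
have [T hT] := choice exT.
have exW (v : R) : exists S, has_sum (fun p : nat * nat =>
    (-1) ^+ (p.1.+1 + p.2.+1) * p.1.+1%:R ^+ 2 * p.2.+1%:R *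
    wexp (pi * expR v) (p.1.+1 * p.2.+1)) S.
  have [S hS] := lambert_summable 2 1 (y0 v); apply: has_sum_dom hS => p.
  rewrite -!mulrA normrM sg1 mul1r ger0_norm ?expr1 ?mulrA//.
  by rewrite !mulr_ge0 ?wexp_ge0 ?exprn_ge0.
have [W hW] := choice exW.
(* With y = e^v, the second factor is B at 1/y. *)
exists (fun v => A v * B (- v)), W.
have hG v : nnsum (fun n => bessel_term a b n.+1 v) (A v * B (- v)).
  apply: has_sum_nnsum; first by move=> n; exact: bessel_term_ge0.
  have h1 := a_lambert a_sum (nnsum_has_sum (hA v)).
  have h2 := b_lambert b_sum (nnsum_has_sum (hB (- v))).
  have := has_sum_divisors (f := fun d m => (a d)%:R * wexp (pi * expR v) d *
    ((b m)%:R * wexp (pi * expR (- v)) m)) (has_sum_mul h1 h2).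
  apply: eq_has_sum => n; apply: eq_bigr => d _.
  rewrite mulrACA; congr (_ * _); rewrite /wexp /bessel_kernel -expRD.
  by congr expR; ring.
split=> //.
  move=> v; have := @lambert_transform R (expR v) (T v) (B (- v)) (expR_gt0 v) (hT v).
  have := eisenstein_product (y0 v) (nnsum_has_sum (hA v)) (hT v) (hW v).
  rewrite -expRN => <- h; rewrite mulrCA h; last exact: (nnsum_has_sum (hB (- v))).
  by rewrite -expRM_natl; ring.
apply: expintegrable_power_bound.
  apply: (measurable_fun_cvg (h := fun n v => \sum_(0 <= i < n) bessel_term a b i.+1 v)) => //.
    move=> n; have [] // := @expintegrable_sum R 0 _ (index_iota 0 n) (fun i => bessel_term a b i.+1) _.
    by move=> i; have [] := @laplace_bessel_term R a b i.+1 0 isT.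
  by move=> v _; exact: nnsum_series (hG v).
(* A(y) is at most a multiple of y^(-3-k) and B(1/y) of y^(3+l); the 3s cancel and y^(l-k)
   remains. *)
move=> k l; have [C1 h1] := @lambert_sum_bound R k; have [C2 h2] := @lambert_sum_bound R l.
exists (C1 / pi ^+ (3 + k) * (C2 / pi ^+ (3 + l))) => v.
have A0 := nnsum_ge0 (hA v); have B0 := nnsum_ge0 (hB (- v)).
rewrite ger0_norm ?mulr_ge0//.
have hAv := h1 _ _ _ (y0 v) (fAb v) (hA v).
have hBv := h2 _ _ _ (y0 (- v)) (fBb (- v)) (hB (- v)).
apply: le_trans (ler_pM A0 B0 hAv hBv) _.
rewrite le_eqVlt; apply/orP; left; apply/eqP.
have split_pow (u : R) n : (pi * expR u) ^- n = pi ^- n * expR (- (n%:R * u)).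
  by rewrite expRN expRM_natl -invfM -exprMn.
rewrite !split_pow.
have -> : expR ((l%:R - k%:R) * v) =
    expR (- ((3 + k)%:R * v)) * expR (- ((3 + l)%:R * - v)).
  by rewrite -expRD; congr expR; rewrite !natrD; ring.
set x := expR _; set y := expR _; set p := pi ^- (3 + k); set q := pi ^- (3 + l).
by ring.
Qed.

End theta_function_product.

Theorem theorem4p1 (R : realType) (a b : nat -> nat)
  (a_mult : arith_multiplicative a)
  (a_odd : forall p f : nat, prime p -> odd p -> a (p ^ f)%N = sigma1 (p ^ f)%N)
  (a_two : forall f : nat, a (2 ^ f)%N = (2 ^ f)%N)
  (b_mult : arith_multiplicative b)
  (b_odd : forall p f : nat, prime p -> odd p -> b (p ^ f)%N = sigma1 (p ^ f)%N)
  (b_two : forall f : nat, (1 <= f)%N -> b (2 ^ f)%N = 0%N) :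
  exists F : R[i] -> R[i],
    entire_continuation [set s | 1 < complex.Re s]
      (fun s =>
         s * (s + 1) / (32 * pi ^+ 2 * Num.sqrt 2)%:C *
         (cpow 2 (s / 2) - cpow 2 (- (s / 2))) *
         (cpow 2 ((s - 1) / 2) - cpow 2 (- ((s - 1) / 2))) *
         zeta_star s * zeta_star (s + 1)) F /\
    forall s : R[i],
      series (fun n : nat =>
        cj a b n.+1 s * besselK s (2 * pi * Num.sqrt n.+1%:R) : R[i]^o) @ \oo
      --> (F s : R[i]^o).
Proof.
have aS n n0 := @a_divisor_sum a a_mult a_odd a_two n n0.
have bS n n0 := @b_divisor_sum b b_mult b_odd b_two n n0.
have [G [W [hG hW GW Gi]]] := @bessel_term_sum R a b aS bS.
have hGi d : expintegrable d (fun v => 2^-1 * G v) by exact: expintegrableZ.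
(* The 1/2 offsets the 2 in the transform 2 c_j K_s of a Bessel term; with 16 G = y^2 W it makes up
   the 32 of the statement. *)
exists (laplace (fun v => 2^-1 * G v)); split.
  split=> [s|s s1]; first exact: laplace_entire.
  rewrite completed_zeta_product// -(laplace_lambert s1 hW).
  have -> : (fun v => expR (2 * v) * W v) = (fun v => 16 * G v) by apply/funext => v; rewrite GW.
  rewrite !laplaceZ// mulrA; congr (_ * _).
  have -> : (16 : R)%:C = 16 :> R[i] by rewrite rmorph_nat.
  have -> : (2^-1 : R)%:C = 2^-1 :> R[i] by rewrite fmorphV rmorph_nat.
  by field.
move=> s.
have Bi n := (@laplace_bessel_term R a b n.+1 s isT).1.
have Bl n := (@laplace_bessel_term R a b n.+1 s isT).2.
have h2 v : nnsum (fun n => 2^-1 * bessel_term a b n.+1 v) (2^-1 * G v).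
  by apply: nnsumZ => //; rewrite invr_ge0.
(* The terms being nonnegative, the limit itself dominates the partial sums, and it is integrable
   against e^(s v) for every s. *)
have [|||_ h] := @laplace_series R (fun n v => 2^-1 * bessel_term a b n.+1 v)
  (fun v => 2^-1 * G v) (fun v => 2^-1 * G v) s _ (hGi _).
- by move=> n; exact: expintegrableZ.
- move=> v n; rewrite ger0_norm; first exact: (nnsum_partial_le n (h2 v)).
  by apply: sumr_ge0 => i _; have [] := h2 v.
- by move=> v; exact: nnsum_series (h2 v).
apply: cvg_trans h; apply: near_eq_cvg; near=> n.
rewrite /series/=; apply: eq_bigr => i _; rewrite laplaceZ// Bl.
have -> : (2^-1 : R)%:C = 2^-1 :> R[i] by rewrite fmorphV rmorph_nat.
by rewrite mulKf// pnatr_eq0.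
Unshelve. all: by end_near. Qed.
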